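(* Let $\mathscr H$ be a complex Hilbert space, let $A_j,B_j\in\mathbb B(\mathscr H)$ $(1\le j\le n)$ be positive operators such that $\sum_{j=1}^nA_j\le I_{\mathscr H}$ and $\sum_{j=1}^nB_j\le I_{\mathscr H}$, let $\sigma_f$ be an operator mean with representing function $f$, and let $p\in[0,1]$. Then for every $k=1,2,\dots,n-1$, $$\Big(I_{\mathscr H}-\sum_{j=1}^nA_j\Big)\sigma_{f^p}\Big(I_{\mathscr H}-\sum_{j=1}^nB_j\Big)\le\left(\Big(I_{\mathscr H}-\sum_{j=1}^kA_j\Big)\sigma_f\Big(I_{\mathscr H}-\sum_{j=1}^kB_j\Big)-\sum_{j=k+1}^n(A_j\sigma_fB_j)\right)^p\le\left(I_{\mathscr H}-\sum_{j=1}^n(A_j\sigma_fB_j)\right)^p.$$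
   Context: $\mathbb B(\mathscr H)$ is the algebra of bounded linear operators on $\mathscr H$, with identity $I_{\mathscr H}$. $A$ is positive ($A\ge0$) if $\langle Ax,x\rangle\ge0$ for all $x$; $A\le B$ means $B-A\ge0$ for self-adjoint $A,B$. For a positive operator monotone function $g$ on $(0,\infty)$ ($A\le B$ implies $g(A)\le g(B)$), the (Kubo–Ando) connection with representing function $g$ is $A\sigma_gB=A^{1/2}g(A^{-1/2}BA^{-1/2})A^{1/2}$ for positive invertible $A,B$, and is extended to all positive operators by $A\sigma_gB=\lim_{\varepsilon\downarrow0}(A+\varepsilon I_{\mathscr H})\sigma_g(B+\varepsilon I_{\mathscr H})$ in the strong operator topology. It is an operator mean if $g(1)=1$. $\sigma_{f^p}$ is the connection with representing function $t\mapsto f(t)^p$. Powers of positive operators are defined by functional calculus, with $X^0=I_{\mathscr H}$. *)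

(* Defs.v *)
From HB Require Import structures.
From mathcomp Require Import all_boot all_order all_algebra.
From mathcomp Require Import sesquilinear complex.
From mathcomp Require Import all_classical all_reals all_analysis.

Set Implicit Arguments.
Unset Strict Implicit.
Unset Printing Implicit Defensive.

Import Order.TTheory GRing.Theory Num.Theory.
Import numFieldNormedType.Exports.

Local Open Scope classical_set_scope.
Local Open Scope complex_scope.
Local Open Scope ring_scope.

Record hilbertType (R : realType) := HilbertType {
  hilbert_sort :> completeNormedModType R[i];
  (* linear in its first argument *)
  hdot : {dot hilbert_sort for Num.conj};
  hdot_norm : forall x, hdot x x = `|x| ^+ 2 }.

(* Operators are plain functions H -> H, with their pointwise vector space
   structure; "A is an element of B(H)" is the predicate [bounded_op A]. *)
Section Operators.
Context {R : realType} {H : hilbertType R}.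
Implicit Types (A B T : H -> H) (f g : R -> R) (q : {poly R}).

Definition bounded_op A : Prop :=
  linear A /\ exists M : R, forall x, `|A x| <= M%:C * `|x|.

(* On R[i], 0 <= z means that z is real and nonnegative. *)
Definition positive_op A : Prop :=
  bounded_op A /\ forall x, 0 <= hdot H (A x) x.

Definition op_le A B : Prop := positive_op (B - A).

Definition invertible_op A : Prop :=
  exists2 S : H -> H, bounded_op S & S \o A = id /\ A \o S = id.

Definition scalar_op (t : R) : H -> H := fun x => t%:C *: x.

(* The real points of the spectrum; for a self-adjoint A this is the whole
   spectrum. *)
Definition spectrum A : set R := [set t | ~ invertible_op (A - scalar_op t)].

Definition poly_op q A : H -> H := \sum_(i < size q) (q`_i)%:C *: iter i A.

(* T = f(A) for A self-adjoint and f continuous on the spectrum of A: (f, T) is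
   a limit of pairs (q, q(A)), q polynomial, for uniform convergence on the
   spectrum in the first component and the operator norm in the second. *)
Definition is_cfc f A T : Prop :=
  bounded_op T /\
  forall e : R, 0 < e -> exists q : {poly R},
    (forall t, spectrum A t -> `|q.[t] - f t| <= e) /\
    (forall x, `|poly_op q A x - T x| <= e%:C * `|x|).

Definition cfc f A : H -> H := xget 0 [set T | is_cfc f A T].

(* powR is such that 0 `^ 0 = 1, hence op_pow A 0 = id, and 0 `^ p = 0 for
   p != 0. *)
Definition op_pow A (p : R) : H -> H := cfc (fun t => t `^ p) A.

(* A^(1/2) g(A^(-1/2) B A^(-1/2)) A^(1/2) *)
Definition connection_inv g A B : H -> H :=
  op_pow A (1 / 2)
    \o cfc g (op_pow A (- (1 / 2)) \o B \o op_pow A (- (1 / 2)))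
    \o op_pow A (1 / 2).

(* The strong operator topology is that of pointwise convergence. *)
Definition connection g A B : H -> H := fun x =>
  lim (connection_inv g (A + scalar_op e) (B + scalar_op e) x @[e --> 0^'+]).

End Operators.

(* Operators on all Hilbert spaces are considered.  Continuity is part of the
   definition since g(A) is given by the continuous functional calculus. *)
Definition operator_monotone {R : realType} (g : R -> R) : Prop :=
  {in `]0, +oo[, continuous g} /\
  forall (K : hilbertType R) (A B : K -> K),
    positive_op A -> invertible_op A -> positive_op B -> invertible_op B ->
    op_le A B -> op_le (cfc g A) (cfc g B).

Definition mean_representing {R : realType} (f : R -> R) : Prop :=
  [/\ forall t, 0 < t -> 0 < f t, operator_monotone f & f 1 = 1].

(* Main.v *)
(** Write [sigma] for [sigma_f].  An operator monotone function satisfies Jensen's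
    inequality [X* g(C) X + Y* g(D) Y <= g(X* C X + Y* D Y)] when [X* X + Y* Y = 1]
    (compare [C (+) D] on [H (+) H] with a block diagonal operator above it).  Hence
    connections are superadditive: [A sigma B + C sigma D <= (A + C) sigma (B + D)].
    Splitting [1 - sum_(j <= k) A_j] as [(1 - sum_j A_j) + sum_(j > k) A_j], and [1] as
    [(1 - sum_(j <= k) A_j) + sum_(j <= k) A_j], this gives
    [T <= G <= 1 - sum_j A_j sigma B_j], where [T] is the [sigma]-connection of
    [1 - sum_j A_j] and [1 - sum_j B_j] and [G] is the operator under the power in the
    middle term.  The Loewner-Heinz inequality raises this to the power [p].  Finally,
    [C sigma_(f^p) D <= (C sigma D)^p] for [C <= 1], by Jensen's inequality for [t^p]. *)
Require Import Defs.
From HB Require Import structures.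
From mathcomp Require Import all_boot all_order all_algebra.
From mathcomp Require Import sesquilinear complex.
From mathcomp Require Import all_classical all_reals all_analysis.
From mathcomp Require Import ring lra zify.

Set Implicit Arguments.
Unset Strict Implicit.
Unset Printing Implicit Defensive.

Import Order.TTheory GRing.Theory Num.Theory.
Import numFieldNormedType.Exports.

Local Open Scope classical_set_scope.
Local Open Scope complex_scope.
Local Open Scope ring_scope.

Local Notation Re := (@complex.Re _).
Local Notation Im := (@complex.Im _).

(** * Real inner product and bounded operators *)

(** Both [cfc] (a choice with default 0) and [connection] (a [lim]) are total, so they carry no
    information until existence and convergence are proved. A representing function is continuous
    only on the open half-line and may have no usable value at 0. Hence inequalities are first
    proved for operators with a common lower bound [a > 0], and the shift by [e] is removed
    afterwards by strong limits along uniformly bounded families. Superadditivity for such operators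
    already makes the shifted connections monotone in [e], and this produces the limit that defines
    [connection]. Jensen's inequality needs the Hilbert sum of two copies of [H], so monotonicity
    must be known on other spaces than [H]. Loewner-Heinz is proved without integral
    representations, from the spectrum of a product of contractions, so [t^p] itself can be fed to
    Jensen. In the last step [C <= 1] lets [C^(1/2)] be completed by [(1 - C)^(1/2)] to an isometry;
    the second block carries a positive constant that tends to 0. *)

Section RealInnerProduct.
Context {R : realType} {H : hilbertType R}.
Implicit Types (x y z : H) (t : R).

Local Notation hdot := (hdot H).
(** The real part is a symmetric real bilinear form, so that expansions of quadratic forms become
    real arithmetic that [lra] can close. *)
Definition rdot x y : R := Re (hdot x y).
Definition rnorm x : R := Re `|x|.

Lemma ReD (u v : R[i]) : Re (u + v) = Re u + Re v.
Proof. by case: u; case: v. Qed.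

Lemma ReN (u : R[i]) : Re (- u) = - Re u.
Proof. by case: u. Qed.

Lemma ReZ t (v : R[i]) : Re (t%:C * v) = t * Re v.
Proof. by case: v => a b /=; rewrite mul0r subr0. Qed.

Lemma rdotDl x y z : rdot (x + y) z = rdot x z + rdot y z.
Proof. by rewrite /rdot linearDl ReD. Qed.

Lemma hdotC x y : hdot x y = (hdot y x)^*%C.
Proof. by rewrite (@hermitian_subproof _ _ false _ _ x y) expr0 mul1r. Qed.

Lemma rdotC x y : rdot x y = rdot y x.
Proof. by rewrite /rdot hdotC; case: (hdot y x). Qed.

Lemma rdotDr x y z : rdot x (y + z) = rdot x y + rdot x z.
Proof. by rewrite rdotC rdotDl !(rdotC x). Qed.

Lemma rdotZl t x y : rdot (t%:C *: x) y = t * rdot x y.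
Proof. by rewrite /rdot linearZl_LR ReZ. Qed.

Lemma rdotZr t x y : rdot x (t%:C *: y) = t * rdot x y.
Proof. by rewrite rdotC rdotZl rdotC. Qed.

Lemma rdotNl x y : rdot (- x) y = - rdot x y.
Proof. by rewrite /rdot linearNl ReN. Qed.

Lemma rdotNr x y : rdot x (- y) = - rdot x y.
Proof. by rewrite rdotC rdotNl rdotC. Qed.

Lemma rdotBl x y z : rdot (x - y) z = rdot x z - rdot y z.
Proof. by rewrite rdotDl rdotNl. Qed.

Lemma rdotBr x y z : rdot x (y - z) = rdot x y - rdot x z.
Proof. by rewrite rdotDr rdotNr. Qed.

Lemma rdot0l x : rdot 0 x = 0.
Proof. by rewrite /rdot linear0l. Qed.

Lemma rdot0r x : rdot x 0 = 0.
Proof. by rewrite rdotC rdot0l. Qed.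

Lemma normE x : `|x| = (rnorm x)%:C.
Proof.
have := normr_ge0 x; rewrite /rnorm; case: `|x| => a b.
by rewrite lecE /= => /andP[/eqP ->].
Qed.

Lemma rnorm_ge0 x : 0 <= rnorm x.
Proof. by have := normr_ge0 x; rewrite normE lecR. Qed.
Local Hint Resolve rnorm_ge0 : core.

Lemma rdotxx x : rdot x x = rnorm x ^+ 2.
Proof. by rewrite /rdot hdot_norm normE -rmorphXn. Qed.

Lemma rdot_ge0 x : 0 <= rdot x x.
Proof. by rewrite rdotxx sqr_ge0. Qed.

Lemma rnormD x y : rnorm (x + y) <= rnorm x + rnorm y.
Proof. by have := ler_normD x y; rewrite !normE -rmorphD lecR. Qed.

Lemma rnormZ t x : rnorm (t%:C *: x) = `|t| * rnorm x.
Proof.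
apply: (@complexI R); rewrite -normE normrZ normE rmorphM /=.
by rewrite normc_def /= expr0n addr0 sqrtr_sqr.
Qed.

Lemma rnormN x : rnorm (- x) = rnorm x.
Proof. by rewrite /rnorm normrN. Qed.

Lemma rnormB x y : rnorm (x - y) = rnorm (y - x).
Proof. by rewrite -rnormN opprB. Qed.

Lemma rnorm0 : rnorm (0 : H) = 0.
Proof. by rewrite /rnorm normr0. Qed.

Lemma rnorm_le0 x : rnorm x <= 0 -> x = 0.
Proof.
move=> h; apply/eqP; rewrite -normr_eq0 normE.
by have -> : rnorm x = 0 by apply/eqP; rewrite eq_le h rnorm_ge0.
Qed.

Lemma rnorm_triangle x y z : rnorm (x - z) <= rnorm (x - y) + rnorm (y - z).
Proof. by rewrite (_ : x - z = (x - y) + (y - z)) ?rnormD // addrA subrK. Qed.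

Lemma rdot_le x y : rdot x y <= rnorm x * rnorm y.
Proof.
have [->|y0] := eqVneq y 0; first by rewrite rdot0r rnorm0 mulr0.
have ny : 0 < rnorm y.
  rewrite lt_def rnorm_ge0 andbT; apply: contra y0 => /eqP h.
  by apply/eqP/rnorm_le0; rewrite h.
(* With [u], [v] the norms of [x], [y], the squared norm of [v x - u y] is
   [2 u v (u v - rdot x y)]. *)
have := rdot_ge0 ((rnorm y)%:C *: x - (rnorm x)%:C *: y).
rewrite rdotBl !rdotBr !(rdotZl, rdotZr) (rdotC y x) !rdotxx.
set a := rdot x y; set u := rnorm x; set v := rnorm y => h.
have : 0 <= 2 * (u * v) * (u * v - a) by lra.
have [u0|] := ltP 0 u.
  by rewrite pmulr_rge0 ?subr_ge0 // !mulr_gt0.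
move=> /rnorm_le0 xe; move: (erefl a) (erefl u).
by rewrite {1}/a {1}/u xe rdot0l rnorm0 => <- <-; rewrite mul0r.
Qed.

Lemma abs_rdot_le x y : `|rdot x y| <= rnorm x * rnorm y.
Proof.
rewrite ler_norml rdot_le andbT lerNl -rdotNl.
by rewrite -(rnormN x) rdot_le.
Qed.

End RealInnerProduct.
#[global] Hint Extern 0 (is_true (0 <= rnorm _)) => solve [apply: rnorm_ge0] : core.

Section BoundedOperators.
Context {R : realType} {H : hilbertType R}.
Implicit Types (A B T : H -> H) (x y z : H) (t : R).

Lemma addfE A B x : (A + B) x = A x + B x. Proof. by []. Qed.
Lemma oppfE A x : (- A) x = - A x. Proof. by []. Qed.
Lemma zerofE x : (0 : H -> H) x = 0. Proof. by []. Qed.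
Lemma scalefE (a : R[i]) A x : (a *: A) x = a *: A x. Proof. by []. Qed.
Definition opE := (addfE, oppfE, zerofE, scalefE).

Lemma bounded_opP A : bounded_op A <->
  linear A /\ exists2 M : R, 0 <= M & forall x, rnorm (A x) <= M * rnorm x.
Proof.
split=> -[lA]; last first.
  by case=> M _ h; split => //; exists M => x; rewrite !normE -rmorphM lecR.
case=> M h; split=> //; exists `|M| => // x.
have := h x; rewrite !normE -rmorphM lecR => /le_trans; apply.
by rewrite ler_wpM2r // ler_norm.
Qed.

Lemma bopD A : bounded_op A -> forall x y, A (x + y) = A x + A y.
Proof. by case=> lA _ x y; have := lA 1 x y; rewrite !scale1r. Qed.

Lemma bop0 A : bounded_op A -> A 0 = 0.
Proof.
move=> bA; have := bopD bA 0 0; rewrite addr0 => /eqP.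
by rewrite -subr_eq0 opprD addrA subrr sub0r oppr_eq0 => /eqP.
Qed.

Lemma bopZ A : bounded_op A -> forall (a : R[i]) x, A (a *: x) = a *: A x.
Proof.
by move=> bA a x; have [lA _] := bA; have := lA a x 0; rewrite !addr0 (bop0 bA) addr0.
Qed.

Lemma bopN A : bounded_op A -> forall x, A (- x) = - A x.
Proof. by move=> bA x; rewrite -scaleN1r (bopZ bA) scaleN1r. Qed.

Lemma bopB A : bounded_op A -> forall x y, A (x - y) = A x - A y.
Proof. by move=> bA x y; rewrite (bopD bA) (bopN bA). Qed.

Lemma bounded_op_id : bounded_op (@id H).
Proof.
apply/bounded_opP; split; first by move=> a u v.
by exists 1 => // x; rewrite mul1r.
Qed.

Lemma bounded_op0 : bounded_op (0 : H -> H).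
Proof.
apply/bounded_opP; split; first by move=> a u v; rewrite !opE scaler0 addr0.
by exists 0 => // x; rewrite mul0r !opE rnorm0.
Qed.

Lemma bounded_op_comp A B : bounded_op A -> bounded_op B -> bounded_op (A \o B).
Proof.
move=> bA bB; have /bounded_opP[_ [M M0 hM]] := bA.
have /bounded_opP[_ [N N0 hN]] := bB.
apply/bounded_opP; split.
  by move=> a u v /=; rewrite bopD // bopZ // bopD // bopZ.
exists (M * N) => [|x /=]; first exact: mulr_ge0.
by apply: le_trans (hM _) _; rewrite -mulrA ler_wpM2l.
Qed.

Lemma bounded_opD A B : bounded_op A -> bounded_op B -> bounded_op (A + B).
Proof.
move=> bA bB; have /bounded_opP[_ [M M0 hM]] := bA.
have /bounded_opP[_ [N N0 hN]] := bB.
apply/bounded_opP; split.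
  by move=> a u v; rewrite !opE (bopD bA) (bopD bB) (bopZ bA) (bopZ bB) scalerDr addrACA.
exists (M + N) => [|x]; first exact: addr_ge0.
by rewrite !opE mulrDl; apply: le_trans (rnormD _ _) _; rewrite lerD.
Qed.

Lemma bounded_op_scalar t : bounded_op (scalar_op t : H -> H).
Proof.
apply/bounded_opP; split.
  by move=> a u v; rewrite /scalar_op scalerDr !scalerA mulrC.
by exists `|t| => // x; rewrite /scalar_op rnormZ.
Qed.

Lemma bounded_opZ t A : bounded_op A -> bounded_op (t%:C *: A).
Proof. by move=> bA; apply: (bounded_op_comp (bounded_op_scalar t) bA). Qed.

Lemma bounded_opN A : bounded_op A -> bounded_op (- A).
Proof.
move=> bA; rewrite (_ : - A = (-1)%:C *: A); first exact: bounded_opZ.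
by rewrite rmorphN scaleN1r.
Qed.

Lemma bounded_opB A B : bounded_op A -> bounded_op B -> bounded_op (A - B).
Proof. by move=> bA bB; apply: bounded_opD => //; apply: bounded_opN. Qed.

Lemma bounded_op_sum I (r : seq I) (P : pred I) (F : I -> H -> H) :
  (forall i, P i -> bounded_op (F i)) -> bounded_op (\sum_(i <- r | P i) F i).
Proof.
move=> h; elim/big_ind: _ => //; [exact: bounded_op0|exact: bounded_opD].
Qed.

Lemma bounded_op_iter n A : bounded_op A -> bounded_op (iter n A).
Proof.
move=> bA; elim: n => [|n IH]; first exact: bounded_op_id.
exact: (bounded_op_comp bA IH).
Qed.

(* For complex-linear [A], symmetry for the real form [rdot] already makes [A]
   self-adjoint for [hdot]. *)
Definition symop A := forall x y, rdot (A x) y = rdot x (A y).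

Lemma symop0 : symop 0.
Proof. by move=> x y; rewrite !opE rdot0l rdot0r. Qed.

Lemma symopD A B : symop A -> symop B -> symop (A + B).
Proof. by move=> sA sB x y; rewrite !opE rdotDl rdotDr sA sB. Qed.

Lemma symopZ t A : symop A -> symop (t%:C *: A).
Proof. by move=> sA x y; rewrite !opE rdotZl rdotZr sA. Qed.

Lemma symop_scalar t : symop (scalar_op t).
Proof. by move=> x y; rewrite /scalar_op rdotZl rdotZr. Qed.

Lemma symopN A : symop A -> symop (- A).
Proof. by move=> sA x y; rewrite !opE rdotNl rdotNr sA. Qed.

Lemma symopB A B : symop A -> symop B -> symop (A - B).
Proof. by move=> sA sB; apply: symopD => //; apply: symopN. Qed.

Lemma symop_sum I (r : seq I) (P : pred I) (F : I -> H -> H) :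
  (forall i, P i -> symop (F i)) -> symop (\sum_(i <- r | P i) F i).
Proof.
move=> h; elim/big_ind: _ => //; [exact: symop0|exact: symopD].
Qed.

Lemma symop_iter n A : symop A -> symop (iter n A).
Proof. by move=> sA; elim: n => // n IH x y; rewrite iterS sA IH -iterSr. Qed.

Lemma symop_sandwich A B : symop A -> symop B -> symop (A \o B \o A).
Proof. by move=> sA sB x y /=; rewrite sA sB sA. Qed.

Local Notation hdot := (hdot H).
Lemma hdotZl (a : R[i]) x y : hdot (a *: x) y = a * hdot x y.
Proof. exact: linearZl_LR. Qed.

Lemma rdotiC x y : rdot ('i *: x) y = - rdot x ('i *: y).
Proof.
rewrite /rdot (hdotC x ('i *: y)) !hdotZl (hdotC x).
by case: (hdot y x) => a b /=; ring.
Qed.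

Lemma Im_hdot x y : Im (hdot x y) = rdot x ('i *: y).
Proof.
rewrite /rdot (hdotC x y) (hdotC x) hdotZl.
by case: (hdot y x) => a b /=; ring.
Qed.

(** Multiplication by ['i] is skew for [rdot] and commutes with [A], so [rdot (A x) ('i *: x)]
    equals its own negative. *)
Lemma symop_Im A x : bounded_op A -> symop A -> Im (hdot (A x) x) = 0.
Proof.
move=> bA sA; have e : rdot (A x) ('i *: x) = - rdot (A x) ('i *: x).
  by rewrite {1}sA (bopZ bA) rdotC rdotiC.
by rewrite Im_hdot; lra.
Qed.

Lemma positive_opP A : positive_op A <->
  [/\ bounded_op A, symop A & forall x, 0 <= rdot (A x) x].
Proof.
split=> [[bA pA]|[bA sA pA]]; last first.
  by split=> // x; rewrite lecE /= (symop_Im x bA sA) eqxx; exact: pA.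
split=> // [x y|x]; last by have := pA x; rewrite lecE => /andP[].
have im0 z : rdot (A z) ('i *: z) = 0.
  by rewrite -Im_hdot; have := pA z; rewrite lecE => /andP[/eqP].
have ii z : 'i *: ('i *: z) = - z :> H.
  by rewrite scalerA -expr2 sqr_i scaleN1r.
(* Polarization: the imaginary part of the form vanishes at every vector, and its expansion at
   [x + 'i *: y] leaves [rdot (A y) x - rdot (A x) y]. *)
have := im0 (x + 'i *: y).
rewrite (bopD bA) (bopZ bA) scalerDr !rdotDl !rdotDr ii.
have -> : rdot ('i *: A y) ('i *: x) = rdot (A y) x.
  by rewrite rdotiC ii rdotNr opprK.
have -> : rdot ('i *: A y) (- y) = 0.
  by rewrite rdotNr rdotiC opprK im0.
by rewrite im0 rdotNr add0r addr0 (rdotC x) => /eqP; rewrite addrC subr_eq0 => /eqP.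
Qed.

Lemma op_leP A B : op_le A B <->
  [/\ bounded_op (B - A), symop (B - A) & forall x, rdot (A x) x <= rdot (B x) x].
Proof.
split=> [/positive_opP[b s p]|[b s p]]; [|apply/positive_opP]; split => // x.
  by have := p x; rewrite !opE rdotBl subr_ge0.
by rewrite !opE rdotBl subr_ge0.
Qed.

(** Form version of [a I <= A <= b I]. It takes the place of a spectrum contained in the segment,
    and passes to sums and strong limits without any spectral argument. *)
Definition between a b A :=
  [/\ bounded_op A, symop A &
      forall x, a * rdot x x <= rdot (A x) x <= b * rdot x x].

Lemma between_bop a b A : between a b A -> bounded_op A. Proof. by case. Qed.
Lemma between_sym a b A : between a b A -> symop A. Proof. by case. Qed.
Lemma between_ge a b A x : between a b A -> a * rdot x x <= rdot (A x) x.
Proof. by case=> _ _ /(_ x) /andP[]. Qed.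
Lemma between_le a b A x : between a b A -> rdot (A x) x <= b * rdot x x.
Proof. by case=> _ _ /(_ x) /andP[]. Qed.

Lemma between_weak a b c d A : c <= a -> b <= d -> between a b A -> between c d A.
Proof.
move=> ca bd [bA sA h]; split=> // x; have /andP[h1 h2] := h x.
apply/andP; split; first by apply: le_trans h1; rewrite ler_wpM2r // rdot_ge0.
by apply: le_trans h2 _; rewrite ler_wpM2r // rdot_ge0.
Qed.

Lemma between_scalar t : between t t (scalar_op t).
Proof.
split; [exact: bounded_op_scalar|exact: symop_scalar|].
by move=> x; rewrite /scalar_op rdotZl lexx.
Qed.

Lemma betweenD a b c d A B : between a b A -> between c d B ->
  between (a + c) (b + d) (A + B).
Proof.
move=> [bA sA hA] [bB sB hB].
split; [exact: bounded_opD|exact: symopD|move=> x].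
have /andP[h1 h2] := hA x; have /andP[h3 h4] := hB x.
by rewrite !opE rdotDl !mulrDl !lerD.
Qed.

Lemma bounded_sym_between A : bounded_op A -> symop A ->
  exists2 M : R, 0 <= M & between (- M) M A.
Proof.
move=> bA sA; have /bounded_opP[_ [M M0 h]] := bA; exists M => //; split => // x.
rewrite mulNr -ler_norml; apply: le_trans (abs_rdot_le _ _) _.
by rewrite rdotxx expr2 mulrA ler_wpM2r.
Qed.

Lemma between_norm e A : between (- e) e A -> 0 <= e ->
  forall x, rnorm (A x) <= e * rnorm x.
Proof.
move=> hA e0 x; have [bA sA _] := hA.
(* The argument cancels a factor [d], so [e], which may be 0, is replaced by a larger positive
   number. *)
suff main d : 0 < d -> e < d -> rnorm (A x) <= d * rnorm x.
  apply/ler_addgt0Pr => eta eta0.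
  have nx : 0 < rnorm x + 1 by rewrite ltr_wpDl.
  set d := eta / (rnorm x + 1); have d0 : 0 < d by rewrite divr_gt0.
  have := main (e + d) (ltr_wpDl e0 d0) (ltr_pwDr d0 (lexx _)).
  move=> /le_trans; apply; rewrite mulrDl lerD2l /d mulrAC ler_pdivrMr //.
  by rewrite ler_wpM2l ?(ltW eta0) // lerDl.
move=> d0 ed; have {}hA : between (- d) d A.
  by apply: between_weak hA; rewrite ?lerN2 ltW.
rewrite -ler_sqr ?nnegrE ?mulr_ge0 ?(ltW d0) // exprMn.
(* Subtracting the lower bound at [d x - A x] from the upper bound at [d x + A x] cancels [v] and
   [w] and leaves [s <= d^2 u]. *)
have h1 := between_le (d%:C *: x + A x) hA.
have h2 := between_ge (d%:C *: x - A x) hA.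
move: h1 h2; rewrite !(bopB bA, bopD bA, bopZ bA).
rewrite !(rdotDl, rdotDr, rdotNl, rdotNr, rdotZl, rdotZr) -!rdotxx.
rewrite (rdotC (A (A x)) x) -(sA x (A x)) (rdotC x (A x)).
set s := rdot (A x) (A x); set u := rdot x x; set v := rdot (A x) x.
set w := rdot (A (A x)) (A x).
move=> h1 h2.
have : d * s <= d * (d ^+ 2 * u) by lra.
by rewrite ler_pM2l.
Qed.

(** This is [T^2 <= M T], obtained without square roots from [T >= 0] at [M x - T x] and [T <= M] at
    [T x]. It converts smallness of a form into smallness of a norm. *)
Lemma psd_norm_le M T : between 0 M T -> 0 < M ->
  forall x, rnorm (T x) ^+ 2 <= M * rdot (T x) x.
Proof.
move=> hT M0 x; have [bT sT _] := hT.
have := between_ge (M%:C *: x - T x) hT.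
have := between_le (T x) hT; rewrite !(bopB bT, bopZ bT).
rewrite !(rdotDl, rdotDr, rdotNl, rdotNr, rdotZl, rdotZr) -!rdotxx mul0r.
rewrite (rdotC (T (T x)) x) -(sT x (T x)).
set s := rdot (T x) (T x); set v := rdot (T x) x.
set w := rdot (T (T x)) (T x) => h1 h2.
have : M * s <= M * (M * v) by lra.
by rewrite ler_pM2l.
Qed.

End BoundedOperators.

(** * Invertibility *)

Lemma le_of_epsilon (R : realFieldType) (a b C : R) : 0 <= C ->
  (forall e : R, 0 < e -> a <= b + C * e) -> a <= b.
Proof.
move=> C0 h; apply/ler_addgt0Pr => e e0.
have C1 : 0 < C + 1 by rewrite ltr_wpDl.
have := h (e / (C + 1)) (divr_gt0 e0 C1).
move=> /le_trans; apply; rewrite lerD2l mulrA ler_pdivrMr // mulrC.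
by rewrite ler_wpM2l ?(ltW e0) // lerDl.
Qed.

Section Invertibility.
Context {R : realType} {H : hilbertType R}.
Implicit Types (A B T : H -> H) (x y z : H) (t : R).

Lemma rnorm_cauchy_cvg (u : nat -> H) :
  (forall e : R, 0 < e -> exists N, forall m n, (N <= m)%N -> (N <= n)%N ->
     rnorm (u m - u n) <= e) ->
  exists l, forall e : R, 0 < e -> exists N, forall n, (N <= n)%N ->
     rnorm (u n - l) <= e.
Proof.
move=> cu; have cv : cvg (u @ \oo).
  apply/cauchy_cvgP/cauchy_exP => e; rewrite ltcE /= => /andP[/eqP ei er].
  have [N hN] := cu (Re e / 2) (divr_gt0 er (ltr0Sn _ 1)).
  exists (u N); exists N => // n /= Nn.
  rewrite -ball_normE /= normE ltcE /= ei eqxx /=.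
  by apply: le_lt_trans (hN _ _ (leqnn N) Nn) _; rewrite ltr_pdivrMr // ltr_pMr ?ltr1n.
exists (lim (u @ \oo)) => e e0.
have e0c : 0 < e%:C by rewrite ltcR.
have /cvgrPdist_le /(_ _ e0c) [N _ hN] := cv.
by exists N => n /hN /=; rewrite normE lecR rnormB.
Qed.

Lemma expr_le_epsilon (k C e : R) : 0 <= k < 1 -> 0 <= C -> 0 < e ->
  exists N, forall n, (N <= n)%N -> k ^+ n * C <= e.
Proof.
move=> /andP[k0 k1] C0 e0.
have C1 : 0 < C + 1 by rewrite ltr_wpDl.
have kn : `|k| < 1 by rewrite ger0_norm.
have /cvgrPdist_le /(_ _ (divr_gt0 e0 C1)) [N _ hN] := cvg_expr kn.
exists N => n /hN /=; rewrite sub0r normrN ger0_norm ?exprn_ge0 // => h.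
apply: le_trans (ler_wpM2r C0 h) _; rewrite mulrAC ler_pdivrMr //.
by rewrite ler_wpM2l ?(ltW e0) // lerDl.
Qed.

(* Lax-Milgram: [T l = y] is solved by iterating the contraction
   [u |-> u + rho (y - T u)], where [rho = c / M^2]. *)
Lemma coercive_surjective T (c : R) : bounded_op T -> 0 < c ->
  (forall x, c * rdot x x <= rdot (T x) x) -> forall y, exists x, T x = y.
Proof.
move=> bT c0 hc y; have /bounded_opP[_ [M0 M00 hM0]] := bT.
(* Adding [c] makes [M] positive and [q = c / M] at most 1. *)
pose M := M0 + c; have M1 : 0 < M by rewrite ltr_wpDl.
have hM x : rnorm (T x) <= M * rnorm x.
  by apply: le_trans (hM0 _) _; rewrite ler_wpM2r // lerDl ltW.
pose q := c / M; have q0 : 0 < q by rewrite divr_gt0.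
have q1 : q <= 1 by rewrite ler_pdivrMr // mul1r lerDr.
have qM : q * M = c by rewrite /q divfK // gt_eqF.
pose rho := q / M; have rho0 : 0 < rho by rewrite divr_gt0.
have rhoM : rho * M = q by rewrite /rho divfK // gt_eqF.
(* The squared contraction factor is at most [1 - q^2], and [k^2 = 1 - q^2 + q^4 / 4] dominates it
   without a square root. *)
pose k := 1 - q ^+ 2 / 2.
have k01 : 0 <= k < 1 by rewrite /k; apply/andP; split; nra.
have /andP[k0 k1] := k01.
have contr x : rnorm (x - rho%:C *: T x) <= k * rnorm x.
  rewrite -ler_sqr ?nnegrE ?mulr_ge0 // exprMn -!rdotxx.
  rewrite !(rdotDl, rdotDr, rdotNl, rdotNr, rdotZl, rdotZr) (rdotC x (T x)).
  have h1 := hc x.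
  have h2 : rdot (T x) (T x) <= M ^+ 2 * rdot x x.
    by rewrite !rdotxx -exprMn ler_sqr ?nnegrE ?mulr_ge0 // ltW.
  set s := rdot (T x) (T x) in h2 *; set v := rdot (T x) x in h1 *.
  have := rdot_ge0 x; set w := rdot x x in h1 h2 *; move=> w0.
  have e1 : rho * (c * w) <= rho * v by rewrite ler_pM2l.
  have e2 : rho ^+ 2 * s <= rho ^+ 2 * (M ^+ 2 * w).
    by rewrite ler_pM2l // exprn_gt0.
  have e3 : rho ^+ 2 * (M ^+ 2 * w) = q ^+ 2 * w by rewrite -rhoM; ring.
  have e4 : rho * (c * w) = q ^+ 2 * w by rewrite expr2 -{1}rhoM -qM; ring.
  have e5 : k ^+ 2 * w = w - q ^+ 2 * w + q ^+ 4 / 4 * w by rewrite /k; field.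
  have e6 : 0 <= q ^+ 4 / 4 * w by rewrite mulr_ge0 // divr_ge0 // exprn_ge0 // ltW.
  by rewrite e5; move: e1 e2; rewrite e3 e4 => e1 e2; lra.
pose g x := x + rho%:C *: (y - T x).
have gB x z : rnorm (g x - g z) <= k * rnorm (x - z).
  rewrite (_ : g x - g z = (x - z) - rho%:C *: T (x - z)) ?contr // /g (bopB bT).
  by rewrite opprD addrACA -scalerBr opprB (addrC (y - _)) addrA subrK -(opprB (T x)) scalerN.
pose u n := iter n g 0.
have uB n m : rnorm (u (n + m)%N - u n) <= k ^+ n * rnorm (u m).
  elim: n => [|n IH]; first by rewrite add0n subr0 expr0 mul1r.
  rewrite exprS -mulrA addSn; apply: le_trans (gB _ _) _.
  by rewrite ler_wpM2l.
pose C := rnorm (rho%:C *: y) / (1 - k).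
have k2 : 0 < 1 - k by rewrite subr_gt0.
have C0 : 0 <= C by rewrite divr_ge0 // ltW.
have uC n : rnorm (u n) <= C.
  elim: n => [|n IH]; first by rewrite rnorm0.
  rewrite -[u n.+1](subrK (g 0)); apply: le_trans (rnormD _ _) _.
  rewrite {2}/g (bop0 bT) subr0 add0r.
  rewrite -lerBrDr; apply: le_trans (gB _ _) _; rewrite subr0.
  apply: le_trans (ler_wpM2l k0 IH) _.
  have : (1 - k) * C = rnorm (rho%:C *: y) by rewrite mulrC divfK // gt_eqF.
  lra.
have cauchy : forall e : R, 0 < e -> exists N, forall m n, (N <= m)%N -> (N <= n)%N ->
     rnorm (u m - u n) <= e.
  move=> e e0; have [N hN] := expr_le_epsilon k01 C0 e0.
  have main m n : (N <= n)%N -> (n <= m)%N -> rnorm (u m - u n) <= e.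
    move=> Nn nm; rewrite -(subnKC nm); apply: le_trans (uB _ _) _.
    by apply: le_trans (hN n Nn); rewrite ler_wpM2l ?exprn_ge0.
  exists N => m n Nm Nn; have [mn|nm] := leqP m n.
    by rewrite rnormB main.
  by apply: main => //; apply: ltnW.
have [l hl] := rnorm_cauchy_cvg cauchy.
exists l; have gl : g l = l; last first.
  have : rho%:C *: (y - T l) = 0.
    by apply: (addrI l); rewrite addr0 -[RHS]gl.
  move=> h; have : rnorm (rho%:C *: (y - T l)) = 0 by rewrite h rnorm0.
  rewrite rnormZ => /eqP; rewrite mulf_eq0 normr_eq0 gt_eqF //= => /eqP h2.
  by apply/eqP; rewrite eq_sym -subr_eq0; apply/eqP/rnorm_le0; rewrite h2.
apply/eqP; rewrite -subr_eq0; apply/eqP/rnorm_le0.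
apply: (@le_of_epsilon _ _ _ 2) => // e e0; rewrite add0r.
have [N hN] := hl e e0.
apply: le_trans (rnorm_triangle _ (u N.+1) _) _.
rewrite mulrDl !mul1r lerD ?hN //.
apply: le_trans (gB _ _) _; rewrite rnormB.
apply: le_trans (_ : 1 * rnorm (u N - l) <= _); last by rewrite mul1r hN.
by rewrite ler_wpM2r // ltW.
Qed.

(** Coercivity also gives injectivity and bounds the inverse by [1 / c]. The statement covers
    non-symmetric [T] because [loewner_heinz_mid] applies it to a product of contractions. *)
Lemma coercive_invertible T (c : R) : bounded_op T -> 0 < c ->
  (forall x, c * rdot x x <= rdot (T x) x) -> invertible_op T.
Proof.
move=> bT c0 hc; have /choice[S hS] := coercive_surjective bT c0 hc.
have injT x : T x = 0 -> x = 0.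
  move=> Tx; apply: rnorm_le0; have := hc x; rewrite Tx rdot0l rdotxx.
  rewrite pmulr_rle0 // => h.
  by have : rnorm x ^+ 2 == 0 by [rewrite eq_le h sqr_ge0]; rewrite sqrf_eq0 => /eqP ->.
have injT2 x y : T x = T y -> x = y.
  move=> e; apply/eqP; rewrite -subr_eq0; apply/eqP/injT.
  by rewrite (bopB bT) e subrr.
exists S; last by split; apply/funext => x /=; [apply: injT2|]; rewrite hS.
apply/bounded_opP; split.
  by move=> a u v; apply: injT2; rewrite (bopD bT) (bopZ bT) !hS.
exists c^-1 => [|x]; first by rewrite invr_ge0 ltW.
rewrite mulrC ler_pdivlMr // mulrC.
have [s0|s0] := lerP (rnorm (S x)) 0; first by rewrite (le_trans _ (rnorm_ge0 x)) // pmulr_rle0.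
have := le_trans (hc (S x)) (rdot_le _ _); rewrite hS rdotxx expr2 mulrA.
by rewrite ler_pM2r.
Qed.

Lemma invertible_opN T : invertible_op (- T) -> bounded_op T -> invertible_op T.
Proof.
move=> [S bS [ST TS]] bT; exists (- S); first exact: bounded_opN.
split; apply/funext => x.
  have /(congr1 (@^~ x)) /= := ST.
  by rewrite !opE (bopN bS).
by have /(congr1 (@^~ x)) /= := TS; rewrite !opE (bopN bT).
Qed.

Lemma invertible_op_comp A B : invertible_op A -> invertible_op B ->
  invertible_op (A \o B).
Proof.
move=> [S bS [SA AS]] [T bT [TB BT]].
exists (T \o S); first exact: bounded_op_comp.
split; apply/funext => x /=.
  have /(congr1 (@^~ (B x))) /= -> := SA.
  by have /(congr1 (@^~ x)) /= -> := TB.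
have /(congr1 (@^~ (S x))) /= -> := BT.
by have /(congr1 (@^~ x)) /= -> := AS.
Qed.

Lemma invertible_op_scalar t : t != 0 -> invertible_op (scalar_op t : H -> H).
Proof.
move=> t0; exists (scalar_op t^-1); first exact: bounded_op_scalar.
by split; apply/funext => x /=; rewrite /scalar_op scalerA -rmorphM ?mulVf ?divff ?scale1r.
Qed.

(** If the inverse is bounded by [s], then [rnorm x <= s * rnorm (T x)], and [psd_norm_le] bounds
    the square of the right side by [s^2 M] times the form. *)
Lemma psd_invertible_ge T M : between 0 M T -> invertible_op T ->
  exists2 d : R, 0 < d & forall x, d * rdot x x <= rdot (T x) x.
Proof.
move=> hT [S bS [ST _]].
have /bounded_opP[_ [s0 s00 hs]] := bS.
pose M1 := `|M| + 1; have M10 : 0 < M1 by rewrite ltr_wpDl.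
have hT1 : between 0 M1 T.
  by apply: between_weak hT => //; rewrite (le_trans (ler_norm M)) // lerDl.
pose s := s0 + 1; have s1 : 0 < s by rewrite ltr_wpDl.
exists (s ^+ 2 * M1)^-1 => [|x].
  by rewrite invr_gt0 mulr_gt0 // exprn_gt0.
rewrite mulrC ler_pdivrMr ?mulr_gt0 ?exprn_gt0 //.
have : rnorm x <= s * rnorm (T x).
  have /(congr1 (@^~ x)) /= e := ST.
  rewrite -{1}e; apply: le_trans (hs _) _.
  by rewrite ler_wpM2r // lerDl.
rewrite -ler_sqr ?nnegrE ?mulr_ge0 ?(ltW s1) // -rdotxx => /le_trans; apply.
rewrite exprMn [leRHS]mulrCA ler_wpM2l ?sqr_ge0 // [leRHS]mulrC.
exact: psd_norm_le.
Qed.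

(** The best lower bound [m] of the form is a spectral point: if [m < c], then [T - m] is positive
    and invertible, hence at least some [d > 0], and [m + d] is a better bound. *)
Lemma ge_of_resolvent T (c : R) : bounded_op T -> symop T ->
  (forall t, t < c -> invertible_op (T - scalar_op t)) ->
  forall x, c * rdot x x <= rdot (T x) x.
Proof.
move=> bT sT hinv x0; rewrite leNgt; apply/negP => hx0.
have [M M0 hM] := bounded_sym_between bT sT.
(* A vector violating the bound is nonzero, so its Rayleigh quotient [u0 < c] bounds the set [E]
   below from above. *)
have x00 : 0 < rdot x0 x0.
  rewrite lt_def rdot_ge0 andbT; apply: contraTN hx0 => /eqP h.
  have := between_ge x0 hM; rewrite h !mulr0 => h2; by rewrite -leNgt.
pose E := [set t | forall x, t * rdot x x <= rdot (T x) x].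
pose u0 := rdot (T x0) x0 / rdot x0 x0.
have Eub x t : 0 < rdot x x -> E t -> t <= rdot (T x) x / rdot x x.
  by move=> xx Et; rewrite ler_pdivlMr //; exact: Et.
have EM : E (- M) by move=> x; exact: between_ge hM.
have hsE : has_sup E.
  by split; [exists (- M)|exists u0 => t Et; apply: Eub].
pose m := sup E.
have mc : m < c.
  apply: le_lt_trans (_ : u0 < c); last by rewrite ltr_pdivrMr.
  by apply: ge_sup; [exists (- M)|move=> t Et; apply: Eub].
have Em : E m.
  move=> x; have [xx|xx] := ltP 0 (rdot x x).
    rewrite -ler_pdivlMr //; apply: ge_sup; first by exists (- M).
    by move=> t Et; apply: Eub.
  have xx0 : rdot x x = 0 by apply/eqP; rewrite eq_le xx rdot_ge0.
  by have := EM x; rewrite xx0 !mulr0.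
have hTm : between 0 (M - m) (T - scalar_op m).
  split; [|by apply: symopB => //; exact: symop_scalar|move=> x].
    by apply: bounded_opB => //; exact: bounded_op_scalar.
  rewrite !opE rdotBl rdotZl mul0r subr_ge0 Em /= mulrBl lerD2r //.
  exact: between_le hM.
have [d d0 hd] := psd_invertible_ge hTm (hinv m mc).
have : E (m + d).
  by move=> x; have := hd x; rewrite !opE rdotBl rdotZl mulrDl lerBrDl.
move=> /(ub_le_sup hsE.2); rewrite -/m; lra.
Qed.

End Invertibility.

(** * Polynomials of an operator and the spectrum *)

Section PolynomialCalculus.
Context {R : realType} {H : hilbertType R}.
Implicit Types (A B T : H -> H) (x y z : H) (t : R) (p q : {poly R}).

(** Padding the sum to a common length [n] allows polynomials of different sizes to be combined term
    by term. *)
Lemma poly_opE n q A x : (size q <= n)%N ->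
  poly_op q A x = \sum_(i < n) (q`_i)%:C *: iter i A x.
Proof.
move=> qn; rewrite /poly_op fct_sumE (big_ord_widen n (fun i => (q`_i)%:C *: iter i A x)) //.
rewrite big_mkcond /=; apply: eq_bigr => i _.
by case: ltnP => // h; rewrite nth_default // scale0r.
Qed.

Lemma poly_opD p q A x : poly_op (p + q) A x = poly_op p A x + poly_op q A x.
Proof.
pose n := maxn (size p) (size q).
rewrite (@poly_opE n) ?(@poly_opE n p) ?(@poly_opE n q) ?leq_maxl ?leq_maxr ?size_polyD //.
by rewrite -big_split; apply: eq_bigr => i _; rewrite coefD rmorphD scalerDl.
Qed.

Lemma poly_opZ t q A x : poly_op (t *: q) A x = t%:C *: poly_op q A x.
Proof.
rewrite (@poly_opE (size q)) ?size_scale_leq // (@poly_opE (size q) q) //.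
by rewrite scaler_sumr; apply: eq_bigr => i _; rewrite coefZ rmorphM scalerA.
Qed.

Lemma poly_opN q A x : poly_op (- q) A x = - poly_op q A x.
Proof. by rewrite -scaleN1r poly_opZ rmorphN scaleN1r. Qed.

Lemma poly_opB p q A x : poly_op (p - q) A x = poly_op p A x - poly_op q A x.
Proof. by rewrite poly_opD poly_opN. Qed.

Lemma poly_opC t A x : poly_op t%:P A x = t%:C *: x.
Proof. by rewrite (@poly_opE 1) ?size_polyC_leq1 // big_ord1 coefC. Qed.

Lemma poly_opMX q A x : poly_op (q * 'X) A x = poly_op q A (A x).
Proof.
rewrite (@poly_opE (size q).+1); last first.
  by rewrite (leq_trans (size_polyMleq _ _)) // size_polyX addn2.
rewrite (@poly_opE (size q)) // big_ord_recl coefMX /= scale0r add0r.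
by apply: eq_bigr => i _; rewrite coefMX /= -iterSr.
Qed.

Lemma poly_opX A x : poly_op 'X A x = A x.
Proof. by rewrite -['X]mul1r poly_opMX poly_opC scale1r. Qed.

Lemma poly_op_bounded q A : bounded_op A -> bounded_op (poly_op q A).
Proof.
move=> bA; apply: bounded_op_sum => i _; apply: bounded_opZ.
exact: bounded_op_iter.
Qed.

Lemma poly_op_sym q A : symop A -> symop (poly_op q A).
Proof.
by move=> sA; apply: symop_sum => i _; apply: symopZ; exact: symop_iter.
Qed.

Lemma poly_op_comm q A x : bounded_op A -> poly_op q A (A x) = A (poly_op q A x).
Proof.
move=> bA; elim/poly_ind: q x => [|q c IH] x.
  by rewrite -[0]/(0%:P) !poly_opC !scale0r (bop0 bA).
by rewrite !poly_opD !poly_opMX !poly_opC (bopD bA) (bopZ bA) !IH.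
Qed.

Lemma poly_opM p q A x : bounded_op A ->
  poly_op (p * q) A x = poly_op p A (poly_op q A x).
Proof.
move=> bA; elim/poly_ind: p q x => [|p c IH] q x.
  by rewrite mul0r -[0]/(0%:P) !poly_opC !scale0r.
rewrite mulrDl -mulrA mul_polyC poly_opD IH poly_opZ.
by rewrite poly_opD poly_opMX poly_opC ['X * _]mulrC poly_opMX (poly_op_comm _ _ bA).
Qed.

Lemma map_real_complex_root (q : {poly R}) t :
  root (map_poly (real_complex R) q) t%:C = root q t.
Proof. by rewrite /root horner_map /= -[0]/(0%:C) (inj_eq (@complexI R)). Qed.

(** The remainder has degree at most 1 and vanishes at a nonreal point; the imaginary part kills its
    linear coefficient, then the real part its constant one. *)
Lemma dvdp_quadratic (q : {poly R}) (a b : R) : b != 0 ->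
  root (map_poly (real_complex R) q) (a +i* b) ->
  (('X - a%:P) ^+ 2 + (b ^+ 2)%:P) %| q.
Proof.
move=> b0 rz; set d := _ + _; pose z := a +i* b.
have sd : size d = 3%N.
  rewrite /d size_polyDl ?size_exp_XsubC // ltnS.
  by rewrite (leq_trans (size_polyC_leq1 _)).
have dz : root (map_poly (real_complex R) d) z.
  rewrite /root /d rmorphD rmorphXn rmorphB /= map_polyX !map_polyC /=.
  rewrite !hornerE /= !expr2 eq_complex /=; apply/andP; split; apply/eqP => /=; ring.
have d0 : d != 0 by rewrite -size_poly_eq0 sd.
have sr : (size (q %% d)%R <= 2)%N by rewrite -ltnS -sd ltn_modp.
have : root (map_poly (real_complex R) (q %% d)) z.
  move: rz; rewrite {1}(divp_eq q d) rmorphD rmorphM /= /root hornerD hornerM.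
  by rewrite (eqP dz) mulr0 add0r.
rewrite /dvdp; move: (q %% d) sr => r sr.
rewrite /root (horner_coef_wide _ (n := 2)) ?size_map_poly //.
rewrite big_ord_recl big_ord1 /= !coef_map /= expr0 expr1 mulr1 eq_complex /=.
rewrite !mul0r subr0 add0r addr0 => /andP[/eqP h1 /eqP h2].
have r1 : r`_1 = 0 by apply/eqP; move/eqP: h2; rewrite mulf_eq0 (negPf b0) orbF.
have r0 : r`_0 = 0 by move: h1; rewrite r1 mul0r addr0.
apply/eqP/polyP => i; rewrite coef0.
by case: i => [|[|i]] //; rewrite nth_default // (leq_trans sr).
Qed.

(** The operator is [(A - a)^2 + b^2], at least [b^2] because the square of a symmetric operator is
    positive. This excludes nonreal spectrum. *)
Lemma spectrum_quadratic_invertible A (a b : R) : bounded_op A -> symop A -> b != 0 ->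
  invertible_op (poly_op (('X - a%:P) ^+ 2 + (b ^+ 2)%:P) A).
Proof.
move=> bA sA b0; apply: (@coercive_invertible _ _ _ (b ^+ 2)).
- exact: poly_op_bounded.
- by rewrite lt_def sqrf_eq0 b0 sqr_ge0.
- move=> x; rewrite poly_opD poly_opC rdotDl rdotZl lerDr expr2 (poly_opM _ _ _ bA).
  by rewrite (poly_op_sym _ sA) rdot_ge0.
Qed.

(** Half of the spectral mapping theorem. Induction on the size splits off a complex root of [q]: a
    real root gives a factor [A - a], a nonreal one a quadratic factor, both invertible. *)
Lemma poly_op_invertible A q : bounded_op A -> symop A -> q != 0 ->
  (forall t, spectrum A t -> q.[t] != 0) -> invertible_op (poly_op q A).
Proof.
move=> bA sA; have [n] := ubnP (size q); elim: n q => // n IH q sq q0 hq.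
have invM p r : q = p * r -> (size p < size q)%N -> invertible_op (poly_op r A) ->
    invertible_op (poly_op q A).
  move=> qe pq ir; rewrite (_ : poly_op q A = poly_op p A \o poly_op r A); last first.
    by apply/funext => x; rewrite qe (poly_opM _ _ _ bA).
  apply: invertible_op_comp => //; apply: IH.
  - exact: leq_trans pq sq.
  - by move: q0; rewrite qe mulf_eq0 negb_or => /andP[].
  - by move=> t /hq; rewrite qe hornerM mulf_eq0 negb_or => /andP[].
have [s1|s1] := leqP (size q) 1.
  have qe := size1_polyC s1; rewrite (_ : poly_op q A = scalar_op q`_0); last first.
    by apply/funext => x; rewrite {1}qe poly_opC.
  apply: invertible_op_scalar; apply: contra q0 => /eqP h.
  by rewrite qe h.
have : ~~ (size (map_poly (real_complex R) q) == 1%N).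
  by rewrite size_map_poly gtn_eqF.
move=> /closed_rootP[[a b] rz].
have [b0|b0] := eqVneq b 0.
  rewrite b0 complexr0 map_real_complex_root in rz.
  have /factor_theorem[p qe] := rz.
  have p0 : p != 0 by move: q0; rewrite qe mulf_eq0 negb_or => /andP[].
  apply: (invM _ _ qe).
    by rewrite qe size_Mmonic ?monicXsubC // size_XsubC addn2.
  rewrite (_ : poly_op _ A = A - scalar_op a); last first.
    by apply/funext => x; rewrite poly_opB poly_opX poly_opC.
  (* [a] is a root of [q], so it cannot be in the spectrum, where [q] does not vanish. *)
  apply: contrapT => /(hq a); rewrite -[_ == 0]/(root q a).
  by rewrite rz.
have /dvdpP[p qe] := dvdp_quadratic b0 rz.
have p0 : p != 0 by move: q0; rewrite qe mulf_eq0 negb_or => /andP[].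
apply: (invM _ _ qe); last exact: spectrum_quadratic_invertible.
have sd : size (('X - a%:P) ^+ 2 + (b ^+ 2)%:P) = 3%N.
  rewrite size_polyDl ?size_exp_XsubC // ltnS.
  by rewrite (leq_trans (size_polyC_leq1 _)).
rewrite qe size_mul // -?size_poly_eq0 sd // addn3 /=.
by rewrite ltnS leqnSn.
Qed.

(** For [t < c] the polynomial [q - t] has no zero on the spectrum, so [q(A) - t] is invertible and
    [ge_of_resolvent] applies. *)
Lemma poly_op_ge A q (c : R) : bounded_op A -> symop A ->
  (forall t, spectrum A t -> c <= q.[t]) ->
  forall x, c * rdot x x <= rdot (poly_op q A x) x.
Proof.
move=> bA sA hq; apply: ge_of_resolvent.
- exact: poly_op_bounded.
- exact: poly_op_sym.
move=> t tc; rewrite (_ : _ - _ = poly_op (q - t%:P) A); last first.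
  by apply/funext => x; rewrite poly_opB poly_opC.
have [q0|q0] := eqVneq (q - t%:P) 0; last first.
  apply: poly_op_invertible => // s /hq hs.
  by rewrite !hornerE subr_eq0 gt_eqF // (lt_le_trans tc).
have [[s hs]|ns] := pselect (exists s, spectrum A s).
  by have := hq s hs; rewrite (subr0_eq q0) hornerC leNgt tc.
(* Here [q] is the constant [t < c], so the spectrum is empty. Then [A >= M + 1] by
   [ge_of_resolvent], against [A <= M]: the space is trivial. *)
have x0 x : x = 0.
  have [M M0 hM] := bounded_sym_between bA sA.
  have inv s : s < M + 1 -> invertible_op (A - scalar_op s).
    by move=> _; apply: contrapT => h; apply: ns; exists s.
  have := le_trans (ge_of_resolvent bA sA inv x) (between_le x hM).
  rewrite mulrDl mul1r gerDl rdotxx => h; apply: rnorm_le0.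
  have : rnorm x ^+ 2 == 0 by rewrite eq_le h sqr_ge0.
  by rewrite sqrf_eq0 => /eqP ->.
apply: (@coercive_invertible _ _ _ 1) => // [|x]; first exact: poly_op_bounded.
by rewrite (x0 x) !rdot0r mulr0.
Qed.

Lemma poly_op_norm A q (e : R) : bounded_op A -> symop A -> 0 <= e ->
  (forall t, spectrum A t -> `|q.[t]| <= e) ->
  forall x, rnorm (poly_op q A x) <= e * rnorm x.
Proof.
move=> bA sA e0 hq; apply: between_norm => //.
split; [exact: poly_op_bounded|exact: poly_op_sym|move=> x].
have h1 : - e * rdot x x <= rdot (poly_op q A x) x.
  by apply: poly_op_ge => // t /hq; rewrite ler_norml => /andP[].
rewrite h1 /= -lerN2 -mulNr -rdotNl -poly_opN; apply: poly_op_ge => // t /hq.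
by rewrite hornerN lerN2 ler_norml => /andP[].
Qed.

Lemma spectrum_between a b A t : between a b A -> spectrum A t -> a <= t <= b.
Proof.
move=> hA st; have [bA sA _] := hA.
have bAt : bounded_op (A - scalar_op t).
  by apply: bounded_opB => //; exact: bounded_op_scalar.
apply/andP; split; rewrite leNgt; apply/negP => tlt; apply: st.
  apply: (@coercive_invertible _ _ _ (a - t)) => // [|x]; first by rewrite subr_gt0.
  by rewrite !opE rdotBl rdotZl mulrBl lerD2r (between_ge x hA).
apply: invertible_opN => //.
apply: (@coercive_invertible _ _ _ (t - b)) => [||x]; [exact: bounded_opN|by rewrite subr_gt0|].
by rewrite opprB !opE rdotDl rdotNl rdotZl mulrBl lerD2l lerN2 (between_le x hA).
Qed.

End PolynomialCalculus.

(** * Weierstrass approximation *)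

Section PolynomialApproximation.
Context {R : realType}.
Implicit Types (a b e t : R) (f g : R -> R).

(** Continuity relative to the segment: at the endpoint 0 the power functions are only tested from
    the right. *)
Definition continuous_seg a b f :=
  forall x, a <= x <= b -> forall e : R, 0 < e -> exists2 d : R, 0 < d &
    forall y, a <= y <= b -> `|y - x| < d -> `|f y - f x| <= e.

(** Compactness of the segment, packaged for constants: a bound that works near each point for all
    large [K] works everywhere for a single [K]. It serves for boundedness, for the quadratic
    modulus below and for positive lower bounds. *)
Lemma segment_uniform_bound a b (P : R -> R -> Prop) :
  (forall x, a <= x <= b -> exists2 d : R, 0 < d & exists K0 : R, forall K y,
     K0 <= K -> a <= y <= b -> `|y - x| < d -> P K y) ->
  exists K : R, forall x, a <= x <= b -> P K x.
Proof.
move=> h; have /compact_near_coveringP cov := @segment_compact R a b.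
have [x|K [_ hK]] :=
    cov R (pinfty_nbhs R) (fun K x => a <= x <= b -> P K x) _.
  rewrite /= in_itv /= => /h[d d0 [K0 hK0]].
  exists (ball x d, [set K | K0 < K]) => /=.
    by split; [exact: nbhsx_ballx|exists K0; split; rewrite ?num_real].
  move=> [y K] /= [yx K0K] yab; apply: hK0 => //; first exact: ltW.
  by move: yx; rewrite -ball_normE /= distrC.
exists (K + 1) => x xab; apply: (hK (K + 1)) => //; first by rewrite ltrDl.
Qed.

(** This form of uniform continuity suits Bernstein polynomials: the expectation of the quadratic
    term is a variance, so no tail estimate is needed. *)
Lemma continuous_seg_quadratic a b f e : continuous_seg a b f -> 0 < e ->
  exists K : R, forall x y, a <= x <= b -> a <= y <= b ->
    `|f y - f x| <= e + K * (y - x) ^+ 2.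
Proof.
move=> cf e0.
have [M hM] : exists M : R, forall x, a <= x <= b -> `|f x| <= M.
  apply: segment_uniform_bound => x /cf /(_ 1 ltr01)[d d0 hd].
  exists d => //; exists (`|f x| + 1) => K y hK yab /(hd _ yab) h.
  apply: le_trans hK; rewrite -[f y](subrK (f x)).
  by apply: le_trans (ler_normD _ _) _; rewrite addrC lerD2l.
suff [K hK] : exists K : R, forall x, a <= x <= b -> forall y, a <= y <= b ->
    `|f y - f x| <= e + K * (y - x) ^+ 2 by exists K => x y xab; apply: hK.
apply: segment_uniform_bound => x xab.
have [d d0 hd] := cf x xab (e / 2) (divr_gt0 e0 (ltr0Sn _ 1)).
have d2 : 0 < d / 2 by rewrite divr_gt0.
(* Points closer than [d / 2] to [z] are both within [d] of [x]; for farther ones this [K] makes the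
   quadratic term at least [2 * M]. *)
exists (d / 2) => //; exists (2 * M / (d / 2) ^+ 2) => K z hK zab zx y yab.
have K0 : 0 <= K.
  apply: le_trans hK; rewrite divr_ge0 ?sqr_ge0 // mulr_ge0 //.
  by apply: le_trans (hM x xab).
have [yz|yz] := ltP `|y - z| (d / 2).
  apply: (@le_trans _ _ e); last by rewrite lerDl mulr_ge0 // sqr_ge0.
  have h1 : `|f y - f x| <= e / 2.
    apply: hd => //; rewrite -(subrK z y) -addrA.
    by apply: le_lt_trans (ler_normD _ _) _; lra.
  have h2 : `|f z - f x| <= e / 2 by apply: hd => //; apply: lt_trans zx _; lra.
  rewrite -(subrK (f x) (f y)) -addrA; apply: le_trans (ler_normD _ _) _.
  by rewrite (distrC (f x)); lra.
have h1 := hM y yab; have h2 := hM z zab.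
apply: (@le_trans _ _ (2 * M)).
  by apply: le_trans (ler_normB _ _) _; lra.
apply: (@le_trans _ _ (K * (y - z) ^+ 2)); last by rewrite lerDr ltW.
apply: (@le_trans _ _ (K * (d / 2) ^+ 2)).
  by rewrite -ler_pdivrMr // exprn_gt0.
rewrite ler_wpM2l // -(real_normK (num_real (y - z))).
by rewrite ler_sqr ?nnegrE // ltW.
Qed.

(* The Bernstein polynomial [\sum_k 'C(n, k) g k X^k (1 - X)^(n - k)], i.e. the
   expectation of [g] under a binomial law, by conditioning on the first trial. *)
Fixpoint bernstein (n : nat) (g : nat -> R) : {poly R} :=
  if n is n'.+1 then 'X * bernstein n' (g \o succn) + (1 - 'X) * bernstein n' g
  else (g 0%N)%:P.

Lemma bernsteinS n (g : nat -> R) x : (bernstein n.+1 g).[x] =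
  x * (bernstein n (g \o succn)).[x] + (1 - x) * (bernstein n g).[x].
Proof. by rewrite /= !hornerE. Qed.

Lemma bernstein_le n (g h : nat -> R) x : 0 <= x <= 1 ->
  (forall k, (k <= n)%N -> g k <= h k) -> (bernstein n g).[x] <= (bernstein n h).[x].
Proof.
move=> /andP[x0 x1]; elim: n g h => [|n IH] g h gh.
  by rewrite /= !hornerC gh.
rewrite !bernsteinS lerD // ler_wpM2l ?subr_ge0 //; apply: IH => k kn.
  by apply: gh; rewrite ltnS.
by apply: gh; apply: leqW.
Qed.

(** Mean and variance of the binomial law. The center [s] is arbitrary because conditioning on a
    first success replaces it by [s - 1]. *)
Lemma bernstein_quadratic n (c d s x : R) :
  (bernstein n (fun k => c + d * (k%:R - s) ^+ 2)).[x] =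
  c + d * ((n%:R * x - s) ^+ 2 + n%:R * (x * (1 - x))).
Proof.
elim: n s => [|n IH] s; first by rewrite /= hornerC !mul0r addr0.
rewrite bernsteinS IH.
have -> : (fun k => c + d * (k%:R - s) ^+ 2) \o succn =
          fun k => c + d * (k%:R - (s - 1)) ^+ 2.
  by apply/funext => k /=; rewrite -natr1 opprB addrA addrAC.
by rewrite IH -natr1; ring.
Qed.

Definition poly_approx a b f := forall e : R, 0 < e -> exists q : {poly R},
  forall t, a <= t <= b -> `|q.[t] - f t| <= e.

(** The samples [g k] lie between two quadratics in [k] centered at [n x]. By [bernstein_le] the
    polynomial lies between their expectations, which differ from [f t] by at most
    [e / 2 + C / n]. *)
Theorem weierstrass a b f : a < b -> continuous_seg a b f -> poly_approx a b f.
Proof.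
move=> ab cf e e0; have e2 : 0 < e / 2 by rewrite divr_gt0.
have [K0 hK0] := continuous_seg_quadratic cf e2.
pose K := `|K0|; have K0' : 0 <= K by rewrite normr_ge0.
have hK x y : a <= x <= b -> a <= y <= b ->
    `|f y - f x| <= e / 2 + K * (y - x) ^+ 2.
  move=> xab yab; apply: le_trans (hK0 x y xab yab) _.
  by rewrite lerD2l ler_wpM2r ?sqr_ge0 // ler_norm.
pose w := b - a; have w0 : 0 < w by rewrite subr_gt0.
pose C := K * w ^+ 2; have C0 : 0 <= C by rewrite mulr_ge0 // sqr_ge0.
have [n n0 nC] : exists2 n, 0 < n%:R :> R & C / n%:R <= e / 2.
  exists (Num.truncn (C / (e / 2))).+1; first by rewrite ltr0n.
  rewrite ler_pdivrMr ?ltr0n // -ler_pdivrMl // mulrC ltW //.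
  by have /andP[] := truncn_itv (divr_ge0 C0 (ltW e2)).
pose g k := f (a + w * (k%:R / n%:R)).
exists (bernstein n g \Po (w^-1 *: ('X - a%:P))) => t tab.
rewrite horner_comp !hornerE; set x := w^-1 * (t - a).
have /andP[ta tb] := tab.
have tE : t = a + w * x by rewrite /x mulrA divff ?gt_eqF // mul1r addrC subrK.
have x01 : 0 <= x <= 1.
  rewrite /x mulrC divr_ge0 ?subr_ge0 ?(ltW ab) //=.
  by rewrite ler_pdivrMr // mul1r lerD2r.
have hg k : (k <= n)%N ->
    `|g k - f t| <= e / 2 + C / n%:R ^+ 2 * (k%:R - n%:R * x) ^+ 2.
  move=> kn; apply: le_trans (hK t _ tab _) _.
    have : 0 <= (k%:R / n%:R : R) <= 1.
      by rewrite divr_ge0 //= ler_pdivrMr // mul1r ler_nat.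
    move: (k%:R / n%:R) => r /andP[r0 r1]; rewrite lerDl mulr_ge0 ?(ltW w0) //=.
    by rewrite -[leRHS](subrK a) addrC lerD2r ler_piMr // ltW.
  rewrite lerD2l {1}tE le_eqVlt; apply/orP; left; apply/eqP.
  by rewrite /C; field; rewrite gt_eqF.
have x14 : n%:R * (x * (1 - x)) * (C / n%:R ^+ 2) <= e / 2.
  apply: le_trans nC; rewrite (_ : _ * _ * _ = x * (1 - x) * (C / n%:R)); last first.
    by field; rewrite gt_eqF.
  have /andP[x0 x1] := x01.
  rewrite ler_piMl ?divr_ge0 // ?ler0n //.
  by rewrite mulr_ile1 // ?subr_ge0 // gerBl.
have h0 : n%:R * x - n%:R * x = 0 by rewrite subrr.
rewrite ler_norml; apply/andP; split.
  have : (bernstein n (fun k => (f t - e / 2) +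
     (- (C / n%:R ^+ 2)) * (k%:R - n%:R * x) ^+ 2)).[x] <= (bernstein n g).[x].
    by apply: bernstein_le => // k /hg; rewrite ler_norml => /andP[h1 h2]; lra.
  by rewrite bernstein_quadratic h0; lra.
have : (bernstein n g).[x] <= (bernstein n (fun k => (f t + e / 2) +
     (C / n%:R ^+ 2) * (k%:R - n%:R * x) ^+ 2)).[x].
  by apply: bernstein_le => // k /hg; rewrite ler_norml => /andP[h1 h2]; lra.
by rewrite bernstein_quadratic h0; lra.
Qed.

End PolynomialApproximation.

(** * Continuous functional calculus *)

(** Restricting to [e <= 1] lets terms of order [e^2], as in products of approximations, be absorbed
    into [C * e]. *)
Lemma le_of_epsilon1 (R : realFieldType) (a b C : R) : 0 <= C ->
  (forall e : R, 0 < e -> e <= 1 -> a <= b + C * e) -> a <= b.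
Proof.
move=> C0 h; apply: (@le_of_epsilon _ _ _ C) => // e e0.
have [e1|e1] := leP e 1; first exact: h.
apply: le_trans (h 1 ltr01 (lexx _)) _.
by rewrite lerD2l ler_wpM2l // ltW.
Qed.

Lemma eq_of_epsilon (R : realType) (H : hilbertType R) (x y : H) (C : R) : 0 <= C ->
  (forall e : R, 0 < e -> e <= 1 -> rnorm (x - y) <= C * e) -> x = y.
Proof.
move=> C0 h; apply/eqP; rewrite -subr_eq0; apply/eqP/rnorm_le0.
by apply: (@le_of_epsilon1 _ _ _ C) => // e e0 e1; rewrite add0r h.
Qed.

(** * Operations on uniform limits of polynomials *)

Section PolyApproxTheory.
Context {R : realType}.
Implicit Types (a b c d e t : R) (f g h : R -> R).

Lemma poly_bounded (q : {poly R}) a b : exists2 M : R, 0 <= M &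
  forall t, a <= t <= b -> `|q.[t]| <= M.
Proof.
elim/poly_ind: q => [|q c [M M0 hM]]; first by exists 0 => // t _; rewrite horner0 normr0.
exists (M * (`|a| + `|b|) + `|c|) => [|t tab].
  by rewrite addr_ge0 // mulr_ge0 // addr_ge0.
rewrite !hornerE; apply: le_trans (ler_normD _ _) _; rewrite lerD2r normrM.
rewrite ler_pM // ?hM //; have /andP[ta tb] := tab.
have [[[h1 h2] h3] h4] := (ler_norm a, ler_norm b, ler_norm (- a), ler_norm (- b)).
rewrite !normrN in h3 h4; have [h5 h6] := (normr_ge0 a, normr_ge0 b).
by rewrite ler_norml; apply/andP; split; lra.
Qed.

Lemma poly_approx_bounded a b g : poly_approx a b g -> exists2 M : R, 0 <= M &
  forall t, a <= t <= b -> `|g t| <= M.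
Proof.
move=> /(_ 1 ltr01)[q hq]; have [M M0 hM] := poly_bounded q a b.
exists (M + 1) => [|t tab]; first by rewrite addr_ge0.
rewrite (_ : g t = q.[t] - (q.[t] - g t)); last by ring.
by apply: le_trans (ler_normB _ _) _; rewrite lerD ?hM ?hq.
Qed.

Lemma poly_approx_lim a b g : (forall e : R, 0 < e -> exists2 h, poly_approx a b h &
  forall t, a <= t <= b -> `|h t - g t| <= e) -> poly_approx a b g.
Proof.
move=> lg e e0; have e2 : 0 < e / 2 by rewrite divr_gt0.
have [h ph hh] := lg _ e2; have [q hq] := ph _ e2.
exists q => t tab; rewrite -(subrK (h t) q.[t]) -addrA.
apply: le_trans (ler_normD _ _) _.
by rewrite [leRHS](splitr e) lerD ?hq ?hh.
Qed.

Lemma poly_approx_poly a b (q : {poly R}) : poly_approx a b (fun t => q.[t]).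
Proof. by move=> e e0; exists q => t _; rewrite subrr normr0 ltW. Qed.

Lemma eq_poly_approx a b g h : (forall t, a <= t <= b -> g t = h t) ->
  poly_approx a b g -> poly_approx a b h.
Proof.
by move=> gh pg e /pg[q hq]; exists q => t tab; rewrite -gh // hq.
Qed.

Lemma poly_approx_sub a b c d g : a <= c -> d <= b ->
  poly_approx a b g -> poly_approx c d g.
Proof.
move=> ac db pg e /pg[q hq]; exists q => t /andP[ct td].
by apply: hq; rewrite (le_trans ac ct) (le_trans td db).
Qed.

Lemma poly_approx_cst a b c : poly_approx a b (fun=> c).
Proof.
by apply: eq_poly_approx (poly_approx_poly a b c%:P) => t _; rewrite hornerC.
Qed.

Lemma poly_approx_id a b : poly_approx a b id.
Proof.
by apply: eq_poly_approx (poly_approx_poly a b 'X) => t _; rewrite hornerX.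
Qed.

Lemma poly_approxD a b g h : poly_approx a b g -> poly_approx a b h ->
  poly_approx a b (fun t => g t + h t).
Proof.
move=> pg ph e e0; have e2 : 0 < e / 2 by rewrite divr_gt0.
have [p hp] := pg _ e2; have [q hq] := ph _ e2.
exists (p + q) => t tab; rewrite hornerD opprD addrACA.
apply: le_trans (ler_normD _ _) _.
by rewrite [leRHS](splitr e) lerD ?hq ?hp.
Qed.

Lemma mul_approx (p q g h e M N : R) : `|g| <= M -> `|h| <= N -> `|p - g| <= e ->
  `|q - h| <= e -> e <= 1 -> `|p * q - g * h| <= (M + N + 1) * e.
Proof.
move=> hg hh hp hq e1.
rewrite (_ : _ - _ = (p - g) * (q - h) + ((p - g) * h + g * (q - h))); last by ring.
have e0 : 0 <= e by apply: le_trans hp.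
apply: le_trans (ler_normD _ _) _.
apply: (@le_trans _ _ (e * 1 + (e * N + M * e))); last by rewrite le_eqVlt; apply/orP; left; apply/eqP; ring.
rewrite lerD // ?normrM ?ler_pM //; first exact: le_trans hq _.
by apply: le_trans (ler_normD _ _) _; rewrite !normrM lerD // ler_pM.
Qed.

Lemma poly_approxM a b g h : poly_approx a b g -> poly_approx a b h ->
  poly_approx a b (fun t => g t * h t).
Proof.
move=> pg ph; have [M M0 hM] := poly_approx_bounded pg.
have [N N0 hN] := poly_approx_bounded ph.
move=> e e0; have C0 : 0 < M + N + 1 by rewrite ltr_wpDl // addr_ge0.
have C1 : 0 < M + N + 1 + e by apply: addr_gt0.
pose d := e / (M + N + 1 + e); have d0 : 0 < d by rewrite divr_gt0.
have d1 : d <= 1 by rewrite ler_pdivrMr // mul1r lerDr ltW.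
have [p hp] := pg _ d0; have [q hq] := ph _ d0.
exists (p * q) => t tab; rewrite hornerM.
apply: le_trans (mul_approx (hM _ tab) (hN _ tab) (hp _ tab) (hq _ tab) d1) _.
rewrite /d mulrA ler_pdivrMr // mulrC ler_wpM2l ?(ltW e0) //.
by rewrite lerDl ltW.
Qed.

Lemma poly_approx_horner a b (q : {poly R}) g : poly_approx a b g ->
  poly_approx a b (fun t => q.[g t]).
Proof.
move=> pg; elim/poly_ind: q => [|q c IH].
  by apply: eq_poly_approx (poly_approx_cst a b 0) => t _; rewrite horner0.
have := poly_approxD (poly_approxM IH pg) (poly_approx_cst a b c).
by apply: eq_poly_approx => t _; rewrite !hornerE.
Qed.

Lemma poly_approx_comp a b c d g h : poly_approx a b g ->
  (forall t, a <= t <= b -> c <= g t <= d) -> poly_approx c d h ->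
  poly_approx a b (fun t => h (g t)).
Proof.
move=> pg gcd ph; apply: poly_approx_lim => e /ph[q hq].
exists (fun t => q.[g t]); first exact: poly_approx_horner.
by move=> t /gcd; exact: hq.
Qed.

End PolyApproxTheory.

Section FunctionalCalculus.
Context {R : realType} {H : hilbertType R}.
Implicit Types (A B T : H -> H) (x y z : H) (a b c d e t : R) (g h : R -> R).

Lemma rnormZc (s : R[i]) x : rnorm (s *: x) = Re `|s| * rnorm x.
Proof.
rewrite {1}/rnorm normrZ normE mulrC.
by case: `|s| => u v /=; rewrite mul0r subr0 mulrC.
Qed.

(** By [poly_op_norm], polynomials within [1 / (n + 1)] of [g] on the segment give operators that
    are Cauchy in norm. The limit is taken vector by vector, and [qT] recovers the uniform rate. *)
Lemma cfc_exists a b A g : between a b A -> poly_approx a b g ->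
  exists T, is_cfc g A T.
Proof.
move=> hA pg; have [bA sA _] := hA.
pose dl n : R := n.+1%:R^-1; have dl0 n : 0 < dl n by rewrite invr_gt0.
have dl_small e : 0 < e -> exists N, forall n, (N <= n)%N -> dl n <= e.
  move=> e0; exists (Num.truncn e^-1) => n Nn; rewrite /dl -[leRHS]invrK.
  rewrite lef_pV2 ?posrE ?invr_gt0 ?ltr0Sn //.
  have /andP[_ h] := truncn_itv (ltW (etrans (invr_gt0 e) e0)).
  by apply: le_trans (ltW h) _; rewrite ler_nat ltnS.
have /choice[q hq] : forall n, exists q : {poly R}, forall t, a <= t <= b ->
    `|q.[t] - g t| <= dl n by move=> n; apply: pg.
have qq m n x : rnorm (poly_op (q m) A x - poly_op (q n) A x) <= (dl m + dl n) * rnorm x.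
  rewrite -poly_opB; apply: poly_op_norm => //; first by rewrite addr_ge0 // ltW.
  move=> t /(spectrum_between hA) tab; rewrite hornerD hornerN.
  rewrite -(subrK (g t) (q m).[t]) -addrA.
  apply: le_trans (ler_normD _ _) _.
  by rewrite lerD ?hq // distrC hq.
have /choice[T hT] : forall x, exists l, forall e : R, 0 < e -> exists N, forall n,
    (N <= n)%N -> rnorm (poly_op (q n) A x - l) <= e.
  move=> x; apply: rnorm_cauchy_cvg => e e0.
  have nx : 0 < 2 * (rnorm x + 1) by rewrite mulr_gt0 // ltr_wpDl.
  have [N hN] := dl_small _ (divr_gt0 e0 nx).
  exists N => m n /hN hm /hN hn; apply: le_trans (qq _ _ _) _.
  apply: (@le_trans _ _ ((dl m + dl n) * (rnorm x + 1))).
    by rewrite ler_wpM2l ?lerDl // addr_ge0 // ltW.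
  apply: le_trans (_ : (e / (2 * (rnorm x + 1)) * 2) * (rnorm x + 1) <= _).
    by rewrite ler_wpM2r ?addr_ge0 // mulr_natr mulr2n lerD.
  by rewrite -mulrA divfK // gt_eqF.
have qT n x : rnorm (poly_op (q n) A x - T x) <= dl n * rnorm x.
  apply: (@le_of_epsilon _ _ _ (rnorm x + 1)) => [|e e0]; first exact: addr_ge0.
  have [N hN] := dl_small e e0; have [N' hN'] := hT x e e0.
  pose m := maxn N N'.
  apply: le_trans (rnorm_triangle _ (poly_op (q m) A x) _) _.
  have h1 := hN m (leq_maxl _ _); have h2 := hN' m (leq_maxr _ _).
  have h3 := qq n m x.
  have h4 : dl m * rnorm x <= e * rnorm x by rewrite ler_wpM2r.
  by rewrite mulrDl in h3; lra.
have TP e : 0 < e -> exists n, dl n <= e /\ forall x,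
    rnorm (T x - poly_op (q n) A x) <= e * rnorm x.
  move=> /dl_small[n /(_ n (leqnn n)) hn]; exists n; split => // x.
  by rewrite rnormB; apply: le_trans (qT n x) _; rewrite ler_wpM2r.
have bT : bounded_op T.
  apply/bounded_opP; split=> [s u v|].
    apply: (@eq_of_epsilon _ _ _ _
      (rnorm (s *: u + v) + (Re `|s| * rnorm u + rnorm v))) => [|e e0 _].
      rewrite !addr_ge0 // mulr_ge0 //.
      by have := normr_ge0 s; rewrite lecE => /andP[].
    have [n [_ hn]] := TP e e0; pose P := poly_op (q n) A.
    have bP : bounded_op P by exact: poly_op_bounded.
    rewrite (_ : _ - _ = (T (s *: u + v) - P (s *: u + v)) -
                         (s *: (T u - P u) + (T v - P v))); last first.
      rewrite (bopD bP) (bopZ bP) scalerBr addrACA -opprD opprB addrA.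
      by rewrite subrK.
    rewrite mulrDl mulrDl; apply: le_trans (rnormD _ _) _; rewrite rnormN.
    rewrite lerD ?(mulrC _ e) //; apply: le_trans (rnormD _ _) _.
    rewrite lerD ?(mulrC _ e) // rnormZc mulrCA ler_wpM2l //.
    by have := normr_ge0 s; rewrite lecE => /andP[].
  have [n [_ hn]] := TP 1 ltr01.
  have /bounded_opP[_ [M M0 hM]] := poly_op_bounded (q n) bA.
  exists (1 + M) => [|x]; first by rewrite addr_ge0.
  rewrite -(subrK (poly_op (q n) A x) (T x)) mulrDl.
  by apply: le_trans (rnormD _ _) _; rewrite lerD.
exists T; split => // e e0; have [n [hn hP]] := TP e e0.
exists (q n); split=> [t /(spectrum_between hA) tab|x].
  exact: le_trans (hq n t tab) hn.
by rewrite !normE -rmorphM lecR rnormB.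
Qed.

Lemma cfcP a b A g : between a b A -> poly_approx a b g -> is_cfc g A (cfc g A).
Proof. by move=> hA /(cfc_exists hA)/(xgetPex (0 : H -> H)). Qed.

Lemma cfc_bounded a b A g : between a b A -> poly_approx a b g ->
  bounded_op (cfc g A).
Proof. by move=> hA /(cfcP hA)[]. Qed.

(** Any polynomial close to [g] on the segment works, not only those supplied by [is_cfc]. This
    contains the uniqueness of the operator and frees later proofs from the choice made by [cfc]. *)
Lemma cfc_near a b A g (q : {poly R}) e : between a b A -> poly_approx a b g ->
  0 <= e -> (forall t, a <= t <= b -> `|q.[t] - g t| <= e) ->
  forall x, rnorm (poly_op q A x - cfc g A x) <= e * rnorm x.
Proof.
move=> hA pg e0 hq x; have [bA sA _] := hA; have [_ hT] := cfcP hA pg.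
apply: (@le_of_epsilon _ _ _ (2 * rnorm x)) => [|d d0]; first exact: mulr_ge0.
have [p [hp hpx]] := hT d d0.
have h1 : rnorm (poly_op p A x - cfc g A x) <= d * rnorm x.
  by have := hpx x; rewrite !normE -rmorphM lecR.
(* [p] is controlled on the spectrum only, so the two polynomials are compared there. *)
have h2 : rnorm (poly_op q A x - poly_op p A x) <= (e + d) * rnorm x.
  rewrite -poly_opB; apply: poly_op_norm => //; first by rewrite addr_ge0 // ltW.
  move=> t st; have tab := spectrum_between hA st; rewrite hornerD hornerN.
  rewrite -(subrK (g t) q.[t]) -addrA; apply: le_trans (ler_normD _ _) _.
  by rewrite lerD ?hq // distrC hp.
apply: le_trans (rnorm_triangle _ (poly_op p A x) _) _.
by rewrite mulrDl in h2; lra.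
Qed.

Lemma cfc_approx a b A g e : between a b A -> poly_approx a b g -> 0 < e ->
  exists q : {poly R}, (forall t, a <= t <= b -> `|q.[t] - g t| <= e) /\
    forall x, rnorm (poly_op q A x - cfc g A x) <= e * rnorm x.
Proof.
move=> hA pg e0; have [q hq] := pg _ e0; exists q; split => //.
by apply: cfc_near hA pg _ hq; exact: ltW.
Qed.

Lemma cfc_dist a b A g h e : between a b A -> poly_approx a b g ->
  poly_approx a b h -> 0 <= e -> (forall t, a <= t <= b -> `|g t - h t| <= e) ->
  forall x, rnorm (cfc g A x - cfc h A x) <= e * rnorm x.
Proof.
move=> hA pg ph e0 gh x.
apply: (@le_of_epsilon _ _ _ (2 * rnorm x)) => [|d d0]; first exact: mulr_ge0.
have [q [hq hqx]] := cfc_approx hA pg d0.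
have ed : 0 <= e + d by rewrite addr_ge0 // ltW.
have := cfc_near hA ph ed _ x => /(_ q) h1.
have {}h1 : rnorm (poly_op q A x - cfc h A x) <= (e + d) * rnorm x.
  apply: h1 => t tab; rewrite -(subrK (g t) q.[t]) -addrA addrC [leRHS]addrC.
  by rewrite addrC; apply: le_trans (ler_normD _ _) _; rewrite lerD ?hq ?gh.
have h2 := hqx x.
apply: le_trans (rnorm_triangle _ (poly_op q A x) _) _.
by rewrite rnormB; rewrite mulrDl in h1; lra.
Qed.

Lemma eq_cfc a b A g h : between a b A -> poly_approx a b g ->
  (forall t, a <= t <= b -> g t = h t) -> cfc g A = cfc h A.
Proof.
move=> hA pg gh; have ph := eq_poly_approx gh pg.
apply/funext => x; apply: (@eq_of_epsilon _ _ _ _ 0) => // e _ _.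
rewrite mul0r -(mul0r (rnorm x)); apply: (cfc_dist hA pg ph (lexx _)).
by move=> t /gh ->; rewrite subrr normr0.
Qed.

Lemma cfc_poly a b A (q : {poly R}) : between a b A ->
  cfc (fun t => q.[t]) A = poly_op q A.
Proof.
move=> hA; apply/funext => x; apply: (@eq_of_epsilon _ _ _ _ 0) => // e _ _.
rewrite mul0r -(mul0r (rnorm x)) rnormB.
apply: (cfc_near hA (poly_approx_poly a b q) (lexx _)).
by move=> t _; rewrite subrr normr0.
Qed.

Lemma cfc_cst a b A c : between a b A -> cfc (fun=> c) A = scalar_op c.
Proof.
move=> hA; rewrite (_ : (fun=> c) = fun t => (c%:P).[t]).
  by rewrite (cfc_poly _ hA); apply/funext => x; rewrite poly_opC.
by apply/funext => t; rewrite hornerC.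
Qed.

Lemma cfc_id a b A : between a b A -> cfc id A = A.
Proof.
move=> hA; rewrite (_ : id = fun t => ('X : {poly R}).[t]).
  by rewrite (cfc_poly _ hA); apply/funext => x; rewrite poly_opX.
by apply/funext => t; rewrite hornerX.
Qed.

Lemma cfc_sym a b A g : between a b A -> poly_approx a b g -> symop (cfc g A).
Proof.
move=> hA pg x y; have [bA sA _] := hA.
apply/eqP; rewrite -subr_eq0 -normr_le0.
apply: (@le_of_epsilon _ _ _ (2 * (rnorm x * rnorm y))) => [|e e0].
  by rewrite !mulr_ge0.
have [q [_ hq]] := cfc_approx hA pg e0; pose P := poly_op q A.
have sP : symop P by exact: poly_op_sym.
rewrite (_ : _ - _ = rdot x (P y - cfc g A y) - rdot (P x - cfc g A x) y); last first.
  by rewrite rdotBr rdotBl sP; ring.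
rewrite add0r; apply: le_trans (ler_normB _ _) _.
have h1 := abs_rdot_le x (P y - cfc g A y).
have h2 := abs_rdot_le (P x - cfc g A x) y.
have h3 : rnorm x * rnorm (P y - cfc g A y) <= rnorm x * (e * rnorm y).
  by rewrite ler_wpM2l.
have h4 : rnorm (P x - cfc g A x) * rnorm y <= e * rnorm x * rnorm y.
  by rewrite ler_wpM2r.
by lra.
Qed.

Lemma cfc_between a b c d A g : between a b A -> poly_approx a b g ->
  (forall t, a <= t <= b -> c <= g t <= d) -> between c d (cfc g A).
Proof.
move=> hA pg hg; have [bA sA _] := hA.
split; [exact: cfc_bounded hA pg|exact: cfc_sym hA pg|move=> x].
have near e : 0 < e -> exists q : {poly R},
    [/\ `|rdot (poly_op q A x) x - rdot (cfc g A x) x| <= e * rdot x x,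
        (c - e) * rdot x x <= rdot (poly_op q A x) x &
        rdot (poly_op q A x) x <= (d + e) * rdot x x].
  move=> e0; have [q [hq hqx]] := cfc_approx hA pg e0; exists q; split.
  - rewrite -rdotBl; apply: le_trans (abs_rdot_le _ _) _.
    by rewrite rdotxx expr2 mulrA ler_wpM2r.
  - apply: poly_op_ge => // t /(spectrum_between hA) tab.
    have := hq t tab; have /andP[h1 h2] := hg t tab.
    by rewrite ler_norml => /andP[h3 h4]; lra.
  - rewrite -lerN2 -mulNr -rdotNl -poly_opN.
    apply: poly_op_ge => // t /(spectrum_between hA) tab.
    have := hq t tab; have /andP[h1 h2] := hg t tab.
    by rewrite ler_norml hornerN => /andP[h3 h4]; lra.
have x2 : 0 <= 2 * rdot x x by rewrite mulr_ge0 // rdot_ge0.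
apply/andP; split; apply: (le_of_epsilon x2) => e e0.
  have [q [h1 h2 _]] := near e e0.
  by move: h1; rewrite ler_norml => /andP[h3 h4]; lra.
have [q [h1 _ h2]] := near e e0.
by move: h1; rewrite ler_norml => /andP[h3 h4]; lra.
Qed.

Lemma cfcM a b A g h x : between a b A -> poly_approx a b g -> poly_approx a b h ->
  cfc (fun t => g t * h t) A x = cfc g A (cfc h A x).
Proof.
move=> hA pg ph; have [bA sA _] := hA.
have [M M0 hM] := poly_approx_bounded pg; have [N N0 hN] := poly_approx_bounded ph.
have pgh := poly_approxM pg ph.
have bg := cfc_bounded hA pg; have /bounded_opP[_ [M1 M10 hM1]] := bg.
pose y := cfc h A x.
apply: (@eq_of_epsilon _ _ _ _ ((M + N + 1) * rnorm x + M1 * rnorm x +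
  (1 + N) * rnorm x + rnorm x)) => [|e e0 e1].
  by rewrite !addr_ge0 ?mulr_ge0 ?addr_ge0.
have [p [hp hpx]] := cfc_approx hA pg e0; have [q [hq hqx]] := cfc_approx hA ph e0.
have C0 : 0 <= (M + N + 1) * e by rewrite mulr_ge0 ?addr_ge0 // ltW.
have hpq t : a <= t <= b -> `|(p * q).[t] - g t * h t| <= (M + N + 1) * e.
  by move=> tab; rewrite hornerM; apply: mul_approx; rewrite ?hM ?hN ?hp ?hq.
have := cfc_near hA pgh C0 hpq x; rewrite (poly_opM _ _ _ bA) rnormB => h1.
apply: le_trans (rnorm_triangle _ (poly_op p A (poly_op q A x)) _) _.
have h2 := hpx (poly_op q A x).
have h3 : rnorm (cfc g A (poly_op q A x) - cfc g A y) <= M1 * (e * rnorm x).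
  by rewrite -(bopB bg); apply: le_trans (hM1 _) _; rewrite ler_wpM2l.
have h4 : rnorm (poly_op q A x) <= (1 + N) * rnorm x.
  apply: poly_op_norm => //; first by rewrite addr_ge0.
  move=> t /(spectrum_between hA) tab; rewrite -(subrK (h t) q.[t]).
  apply: le_trans (ler_normD _ _) _; rewrite lerD ?hN //.
  exact: le_trans (hq t tab) e1.
have h5 := rnorm_triangle (poly_op p A (poly_op q A x)) (cfc g A (poly_op q A x)) (cfc g A y).
have h6 : e * rnorm (poly_op q A x) <= e * ((1 + N) * rnorm x).
  by rewrite ler_wpM2l // ltW.
have h7 : 0 <= e * rnorm x by rewrite mulr_ge0 // ltW.
by rewrite -/y; lra.
Qed.

Lemma cfcD a b A g h x : between a b A -> poly_approx a b g -> poly_approx a b h ->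
  cfc (fun t => g t + h t) A x = cfc g A x + cfc h A x.
Proof.
move=> hA pg ph; have pgh := poly_approxD pg ph.
apply: (@eq_of_epsilon _ _ _ _ (4 * rnorm x)) => [|e e0 _]; first exact: mulr_ge0.
have [p [hp hpx]] := cfc_approx hA pg e0; have [q [hq hqx]] := cfc_approx hA ph e0.
have e2 : 0 <= e * 2 by rewrite mulr_ge0 // ltW.
have hpq t : a <= t <= b -> `|(p + q).[t] - (g t + h t)| <= e * 2.
  move=> tab; rewrite hornerD opprD addrACA; apply: le_trans (ler_normD _ _) _.
  by have := hp t tab; have := hq t tab; lra.
have := cfc_near hA pgh e2 hpq x; rewrite poly_opD rnormB => h1.
apply: le_trans (rnorm_triangle _ (poly_op p A x + poly_op q A x) _) _.
have h2 := rnormD (poly_op p A x - cfc g A x) (poly_op q A x - cfc h A x).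
rewrite addrACA -opprD in h2.
by have := hpx x; have := hqx x; lra.
Qed.

Lemma poly_op_cfc a b c d A g (q : {poly R}) : between a b A -> poly_approx a b g ->
  (forall t, a <= t <= b -> c <= g t <= d) ->
  poly_op q (cfc g A) = cfc (fun t => q.[g t]) A.
Proof.
move=> hA pg hg; apply/funext => x.
have hgA := cfc_between hA pg hg; have bg := between_bop hgA.
elim/poly_ind: q x => [|q s IH] x.
  rewrite -[0]/(0%:P) poly_opC (_ : (fun t => _) = fun=> 0); last first.
    by apply/funext => t; rewrite hornerC.
  by rewrite (cfc_cst _ hA).
rewrite (_ : (fun t => _) = fun t => q.[g t] * g t + s); last first.
  by apply/funext => t; rewrite !hornerE.
have pq := poly_approx_horner q pg.
rewrite (cfcD _ hA (poly_approxM pq pg) (poly_approx_cst _ _ _)).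
by rewrite (cfcM _ hA pq pg) (cfc_cst _ hA) poly_opD poly_opMX poly_opC IH.
Qed.

(** For polynomial [h] this is [poly_op_cfc]; the general case follows because an approximation of
    [h] on the range of [g] is uniform after composition. *)
Lemma cfc_comp a b c d A g h : between a b A -> poly_approx a b g ->
  (forall t, a <= t <= b -> c <= g t <= d) -> poly_approx c d h ->
  cfc h (cfc g A) = cfc (fun t => h (g t)) A.
Proof.
move=> hA pg hg ph; apply/funext => x; have hgA := cfc_between hA pg hg.
have phg := poly_approx_comp pg hg ph.
apply: (@eq_of_epsilon _ _ _ _ (2 * rnorm x)) => [|e e0 _]; first exact: mulr_ge0.
have [q [hq hqx]] := cfc_approx hgA ph e0.
apply: le_trans (rnorm_triangle _ (poly_op q (cfc g A) x) _) _; rewrite rnormB.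
have h1 := hqx x.
have : rnorm (poly_op q (cfc g A) x - cfc (fun t => h (g t)) A x) <= e * rnorm x.
  rewrite (poly_op_cfc _ hA pg hg).
  apply: cfc_dist hA (poly_approx_horner q pg) phg (ltW e0) _ _.
  by move=> t /hg; exact: hq.
by lra.
Qed.

End FunctionalCalculus.

(** * Transport of the calculus between spaces *)

Section Intertwining.
Context {R : realType} {H K : hilbertType R}.

Lemma poly_op_intertwine (A : H -> H) (B : K -> K) (W : H -> K) (q : {poly R}) :
  (forall x y, W (x + y) = W x + W y) -> (forall t x, W (t%:C *: x) = t%:C *: W x) ->
  (forall x, W (A x) = B (W x)) ->
  forall x, W (poly_op q A x) = poly_op q B (W x).
Proof.
move=> WD WZ WAB; elim/poly_ind: q => [|q c IH] x.
  by rewrite -[0]/(0%:P) !poly_opC WZ.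
by rewrite !poly_opD !poly_opMX !poly_opC WD WZ IH WAB.
Qed.

(** The relation [W A = B W] passes to polynomials, then to their limits. Real homogeneity of [W]
    suffices since the polynomials are real. It serves for the embeddings of [H] in the Hilbert sum
    and for the isometry in [jensen]. *)
Lemma cfc_intertwine (A : H -> H) (B : K -> K) (W : H -> K) (a b M : R) (g : R -> R) :
  (forall x y, W (x + y) = W x + W y) -> (forall t x, W (t%:C *: x) = t%:C *: W x) ->
  (forall x, rnorm (W x) <= M * rnorm x) -> 0 <= M ->
  (forall x, W (A x) = B (W x)) -> between a b A -> between a b B ->
  poly_approx a b g -> forall x, W (cfc g A x) = cfc g B (W x).
Proof.
move=> WD WZ hM M0 WAB hA hB pg x.
apply: (@eq_of_epsilon _ _ _ _ (M * rnorm x + rnorm (W x))) => [|e e0 _].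
  by rewrite addr_ge0 ?mulr_ge0.
have [q hq] := pg e e0.
have h1 := cfc_near hA pg (ltW e0) hq x.
have h2 := cfc_near hB pg (ltW e0) hq (W x).
apply: le_trans (rnorm_triangle _ (poly_op q B (W x)) _) _.
rewrite -(poly_op_intertwine q WD WZ WAB).
have WB u v : W (u - v) = W u - W v.
  by rewrite WD -scaleN1r -(rmorphN1 (real_complex R)) WZ rmorphN1 scaleN1r.
rewrite -WB; have h3 := hM (cfc g A x - poly_op q A x).
rewrite rnormB in h1.
have h4 : M * rnorm (cfc g A x - poly_op q A x) <= M * (e * rnorm x).
  by rewrite ler_wpM2l.
by rewrite (poly_op_intertwine q WD WZ WAB); lra.
Qed.

End Intertwining.

(** * Strong limits *)

Section StrongLimits.
Context {R : realType} {H : hilbertType R}.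
Implicit Types (T S : R -> H -> H) (L : H -> H) (x : H) (a b c d e t : R).

Definition strong_cvg T L := forall x (eta : R), 0 < eta -> exists2 d : R, 0 < d &
  forall e, 0 < e < d -> rnorm (T e x - L x) <= eta.

Lemma strong_cvg_lim T L x : strong_cvg T L -> lim (T e x @[e --> 0^'+]) = L x.
Proof.
move=> TL; apply: cvg_lim; first exact: norm_hausdorff.
apply/cvgrPdist_le => eta; rewrite ltcE /= => /andP[/eqP ei er].
have [d d0 hd] := TL x _ er.
exists d => // e /=; rewrite sub0r normrN => ed e0.
rewrite normE lecE /= ei eqxx /= rnormB hd // e0 /=.
by apply: le_lt_trans ed; exact: ler_norm.
Qed.

Lemma eq_strong_cvg T S L : (forall e, 0 < e < 1 -> T e = S e) ->
  strong_cvg T L -> strong_cvg S L.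
Proof.
move=> TS TL x eta /(TL x)[d d0 hd].
exists (Num.min d 1); first by rewrite lt_min d0 ltr01.
move=> e /andP[e0]; rewrite lt_min => /andP[ed e1].
by rewrite -TS ?hd ?e0.
Qed.

Lemma strong_cvg_cst L : strong_cvg (fun=> L) L.
Proof. by move=> x eta eta0; exists 1 => // e _; rewrite subrr rnorm0 ltW. Qed.

Lemma strong_cvg_both T S L K x (eta : R) : strong_cvg T L -> strong_cvg S K -> 0 < eta ->
  exists2 d : R, 0 < d & forall e, 0 < e < d ->
    e < 1 /\ rnorm (T e x - L x) <= eta /\ rnorm (S e x - K x) <= eta.
Proof.
move=> TL SK eta0; have [d d0 hd] := TL x _ eta0; have [d' d0' hd'] := SK x _ eta0.
exists (Num.min 1 (Num.min d d')); first by rewrite !lt_min ltr01 d0.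
move=> e /andP[e0]; rewrite !lt_min => /and3P[e1 ed ed'].
by rewrite hd ?hd' ?e0.
Qed.

Lemma strong_cvgD T S L K : strong_cvg T L -> strong_cvg S K ->
  strong_cvg (fun e => T e + S e) (L + K).
Proof.
move=> TL SK x eta eta0.
have [d d0 hd] := strong_cvg_both x TL SK (divr_gt0 eta0 (ltr0Sn _ 1)).
exists d => // e /hd[_ [h1 h2]]; rewrite !opE opprD addrACA.
by apply: le_trans (rnormD _ _) _; rewrite [leRHS](splitr eta) lerD.
Qed.

Lemma strong_cvg_unif T L C : 0 <= C ->
  (forall e x, 0 < e < 1 -> rnorm (T e x - L x) <= C * e * rnorm x) -> strong_cvg T L.
Proof.
move=> C0 h x eta eta0; have D0 : 0 < C * rnorm x + eta.
  by rewrite ltr_wpDl // mulr_ge0.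
exists (eta / (C * rnorm x + eta)); first by rewrite divr_gt0.
move=> e /andP[e0 ed]; have e1 : e < 1.
  by apply: lt_le_trans ed _; rewrite ler_pdivrMr // mul1r lerDr mulr_ge0.
apply: le_trans (h _ _ _) _; first by rewrite e0.
move: ed; rewrite ltr_pdivlMr // => ed.
have : 0 <= e * eta by rewrite mulr_ge0 // ltW.
by lra.
Qed.

Lemma strong_cvg_shift L : strong_cvg (fun e => L + scalar_op e) L.
Proof.
apply: (@strong_cvg_unif _ _ 1) => // e x /andP[e0 _].
by rewrite !opE addrC addKr rnormZ gtr0_norm // mul1r.
Qed.

Lemma strong_cvg_rescale T L c : 0 < c -> strong_cvg T L ->
  strong_cvg (fun e => T (c * e)) L.
Proof.
move=> c0 TL x eta /(TL x)[d d0 hd]; exists (d / c); first by rewrite divr_gt0.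
move=> e /andP[e0 ed]; apply: hd; rewrite mulr_gt0 //=.
by rewrite mulrC -ltr_pdivlMr.
Qed.

(** Used with [s e = 1 / (1 + e)], the factor that normalizes [A + e] when [A <= 1]. *)
Lemma strong_cvg_scale T L (s : R -> R) : strong_cvg T L ->
  (forall e, 0 < e < 1 -> `|s e - 1| <= e) -> strong_cvg (fun e => (s e)%:C *: T e) L.
Proof.
move=> TL hs x eta eta0; pose D := rnorm (L x) + eta + 2.
have D0 : 0 < D by rewrite /D ltr_wpDl // addr_ge0 // ltW.
have h2 : 0 < eta / 2 by rewrite divr_gt0.
have [d d0 hd] := strong_cvg_both x TL TL h2.
have dD : 0 < eta / 2 / D by rewrite divr_gt0.
exists (Num.min d (eta / 2 / D)); first by rewrite lt_min d0.
move=> e /andP[e0]; rewrite lt_min => /andP[ed eD].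
have [e1 [h3 _]] := hd e (introT andP (conj e0 ed)).
have -> : ((s e)%:C *: T e) x - L x = (s e - 1)%:C *: T e x + (T e x - L x).
  by rewrite !opE rmorphB scalerBl scale1r addrA subrK.
apply: le_trans (rnormD _ _) _; rewrite [leRHS](splitr eta) lerD // rnormZ.
have : rnorm (T e x) <= D.
  rewrite -(subrK (L x) (T e x)); apply: le_trans (rnormD _ _) _.
  by rewrite /D; lra.
move=> hT; apply: (@le_trans _ _ (e * D)).
  by rewrite ler_pM // hs // e0.
by rewrite -ler_pdivlMr // ltW.
Qed.

Lemma strong_cvg_le T S L K : strong_cvg T L -> strong_cvg S K ->
  (forall e x, 0 < e < 1 -> rdot (T e x) x <= rdot (S e x) x) ->
  forall x, rdot (L x) x <= rdot (K x) x.
Proof.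
move=> TL SK h x.
apply: (@le_of_epsilon _ _ _ (2 * rnorm x)) => [|eta eta0]; first exact: mulr_ge0.
have [d d0 hd] := strong_cvg_both x TL SK eta0.
have d2 : 0 < d / 2 < d by rewrite divr_gt0 //= ltr_pdivrMr // ltr_pMr // ltr1n.
have [e1 [h1 h2]] := hd _ d2.
have := h (d / 2) x; rewrite e1 andbT => /(_ _)/= h3.
have {}h3 := h3 (andP d2).1.
have h4 := abs_rdot_le (T (d / 2) x - L x) x.
have h5 := abs_rdot_le (S (d / 2) x - K x) x.
have h6 : rnorm (T (d / 2) x - L x) * rnorm x <= eta * rnorm x by rewrite ler_wpM2r.
have h7 : rnorm (S (d / 2) x - K x) * rnorm x <= eta * rnorm x by rewrite ler_wpM2r.
have := le_trans h4 h6; have := le_trans h5 h7.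
by rewrite !ler_norml !rdotBl => /andP[h8 h9] /andP[h10 h11]; lra.
Qed.

Lemma between_norm_le a b A : between a b A ->
  forall x, rnorm (A x) <= (`|a| + `|b|) * rnorm x.
Proof.
move=> hA; apply: between_norm; last exact: addr_ge0.
apply: between_weak hA.
  by rewrite lerNl; apply: le_trans (ler_norm _) _; rewrite normrN lerDl.
by apply: le_trans (ler_norm _) _; rewrite lerDr.
Qed.

(** The uniform bounds make the pointwise limit a bounded operator; its linearity and symmetry are
    inherited from the approximants, whereas [L] is a mere function at the outset. *)
Lemma strong_cvg_between T L a b : strong_cvg T L ->
  (forall e, 0 < e < 1 -> between a b (T e)) -> between a b L.
Proof.
move=> TL hT; pose M := `|a| + `|b|; have M0 : 0 <= M by rewrite addr_ge0.
(* A single index must serve three vectors at once, since linearity compares the values at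
   [s *: u + v], [u] and [v]. *)
have near x y z (eta : R) : 0 < eta -> exists e, [/\ between a b (T e),
    rnorm (T e x - L x) <= eta, rnorm (T e y - L y) <= eta &
    rnorm (T e z - L z) <= eta].
  move=> eta0; have [d d0 hd] := strong_cvg_both x TL TL eta0.
  have [d' d0' hd'] := TL y _ eta0; have [d'' d0'' hd''] := TL z _ eta0.
  pose e := Num.min d (Num.min d' d'') / 2.
  have m0 : 0 < Num.min d (Num.min d' d'') by rewrite !lt_min d0 d0'.
  have e0 : 0 < e by rewrite divr_gt0.
  have : e < Num.min d (Num.min d' d'') by rewrite ltr_pdivrMr // ltr_pMr // ltr1n.
  rewrite !lt_min => /and3P[e1 e2 e3].
  have /hd[e4 [h1 _]] : 0 < e < d by rewrite e0.
  by exists e; split; rewrite ?hd' ?hd'' ?e0 //; apply: hT; rewrite e0.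
have bL : bounded_op L.
  apply/bounded_opP; split=> [s u v|].
    apply: (@eq_of_epsilon _ _ _ _ (1 + (Re `|s| + 1))) => [|e e0 _].
      rewrite !addr_ge0 //; by have := normr_ge0 s; rewrite lecE => /andP[].
    have [e' [hTe h1 h2 h3]] := near (s *: u + v) u v e e0.
    have bT := between_bop hTe.
    have -> : L (s *: u + v) - (s *: L u + L v) =
        (s *: (T e' u - L u) + (T e' v - L v)) - (T e' (s *: u + v) - L (s *: u + v)).
      rewrite (bopD bT) (bopZ bT) scalerBr addrACA -opprD opprB.
      by rewrite [RHS]addrC addrA subrK.
    rewrite mulrDl mul1r addrC; apply: le_trans (rnormD _ _) _; rewrite rnormN lerD //.
    apply: le_trans (rnormD _ _) _; rewrite mulrDl mul1r lerD // rnormZc ler_wpM2l //.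
    by have := normr_ge0 s; rewrite lecE => /andP[].
  exists M => // x; apply: (@le_of_epsilon _ _ _ 1) => // e e0.
  have [e' [hTe h1 _ _]] := near x x x e e0.
  rewrite mul1r -(subrK (T e' x) (L x)) addrC; apply: le_trans (rnormD _ _) _.
  by rewrite rnormB in h1; rewrite lerD // between_norm_le.
split=> // [x y|x].
  apply/eqP; rewrite -subr_eq0 -normr_le0.
  apply: (@le_of_epsilon _ _ _ (rnorm x + rnorm y)) => [|e e0]; first exact: addr_ge0.
  have [e' [hTe h1 h2 _]] := near x y x e e0; have sT := between_sym hTe.
  have -> : rdot (L x) y - rdot x (L y) = rdot x (T e' y - L y) - rdot (T e' x - L x) y.
    by rewrite rdotBr rdotBl sT; ring.
  rewrite add0r; apply: le_trans (ler_normB _ _) _.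
  have h3 := abs_rdot_le x (T e' y - L y); have h4 := abs_rdot_le (T e' x - L x) y.
  have h5 : rnorm x * rnorm (T e' y - L y) <= rnorm x * e by rewrite ler_wpM2l.
  have h6 : rnorm (T e' x - L x) * rnorm y <= e * rnorm y by rewrite ler_wpM2r.
  by lra.
apply/andP; split.
  have := @strong_cvg_le _ _ _ _ (strong_cvg_cst (scalar_op a)) TL.
  move=> /(_ _)/(_ _) h; have := h _ x; rewrite rdotZl; apply=> e y /hT he.
  by rewrite rdotZl; exact: between_ge he.
have := @strong_cvg_le _ _ _ _ TL (strong_cvg_cst (scalar_op b)).
move=> /(_ _)/(_ _) h; have := h _ x; rewrite rdotZl; apply=> e y /hT he.
by rewrite rdotZl; exact: between_le he.
Qed.

Lemma strong_cvg_comp T S L K a b : strong_cvg T L -> strong_cvg S K ->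
  (forall e, 0 < e < 1 -> between a b (T e)) ->
  strong_cvg (fun e => T e \o S e) (L \o K).
Proof.
move=> TL SK hT x eta eta0; pose M := `|a| + `|b| + 1.
have M0 : 0 < M by rewrite ltr_wpDl // addr_ge0.
have h1 : 0 < eta / 2 by rewrite divr_gt0.
have h2 : 0 < eta / 2 / M by rewrite divr_gt0.
have [d d0 hd] := SK x _ h2.
have [d' d0' hd'] := strong_cvg_both (K x) TL TL h1.
exists (Num.min d d'); first by rewrite lt_min d0.
move=> e /andP[e0]; rewrite lt_min => /andP[ed ed'].
have [e1 [h3 _]] := hd' e (introT andP (conj e0 ed')).
have h4 := hd e (introT andP (conj e0 ed)).
have hTe : between a b (T e) by apply: hT; rewrite e0.
apply: le_trans (rnorm_triangle _ (T e (K x)) _) _ => /=.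
rewrite [leRHS](splitr eta) lerD // -(bopB (between_bop hTe)).
apply: le_trans (between_norm_le hTe _) _.
apply: (@le_trans _ _ (M * (eta / 2 / M))); last by rewrite mulrC divfK // gt_eqF.
by rewrite ler_pM // ?addr_ge0 // /M lerDl.
Qed.

Lemma strong_cvg_poly T L a b (q : {poly R}) : strong_cvg T L ->
  (forall e, 0 < e < 1 -> between a b (T e)) ->
  strong_cvg (fun e => poly_op q (T e)) (poly_op q L).
Proof.
move=> TL hT; have bL := between_bop (strong_cvg_between TL hT).
elim/poly_ind: q => [|q c IH].
  have e0 (A : H -> H) : poly_op 0 A = scalar_op 0.
    by apply/funext => x; rewrite -[0 in LHS]/(0%:P) poly_opC.
  by rewrite e0; apply: eq_strong_cvg (strong_cvg_cst _) => e _; rewrite e0.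
have eS (A : H -> H) : bounded_op A -> poly_op (q * 'X + c%:P) A = (A \o poly_op q A) + scalar_op c.
  by move=> bA; apply/funext => x; rewrite poly_opD poly_opMX poly_opC poly_op_comm.
rewrite (eS L bL); apply: eq_strong_cvg (strong_cvgD (strong_cvg_comp TL IH hT)
  (strong_cvg_cst (scalar_op c))) => e he.
by rewrite (eS _ (between_bop (hT e he))).
Qed.

(** On a family with common bounds, polynomials are strongly continuous because composition is, and
    one polynomial approximates [g] with the same error for all members and for the limit. *)
Lemma strong_cvg_cfc T L a b (g : R -> R) : poly_approx a b g -> strong_cvg T L ->
  (forall e, 0 < e < 1 -> between a b (T e)) ->
  strong_cvg (fun e => cfc g (T e)) (cfc g L).
Proof.
move=> pg TL hT x eta eta0; have hL := strong_cvg_between TL hT.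
have nx : 0 < rnorm x + 1 by rewrite ltr_wpDl.
have d0 : 0 < eta / 3 / (rnorm x + 1) by rewrite !divr_gt0.
have h3 : 0 < eta / 3 by rewrite divr_gt0.
have [q hq] := pg _ d0.
have small A : between a b A -> rnorm (poly_op q A x - cfc g A x) <= eta / 3.
  move=> hA; apply: le_trans (cfc_near hA pg (ltW d0) hq x) _.
  by rewrite mulrAC ler_pdivrMr // ler_wpM2l ?(ltW h3) // lerDl.
have qTL := strong_cvg_poly q TL hT.
have [d dpos hd] := strong_cvg_both x qTL qTL h3.
exists d => // e ed; have [e1 [h4 _]] := hd e ed.
have e0 : 0 < e by case/andP: ed.
have h5 := small L hL; have h6 := small (T e) (hT e (introT andP (conj e0 e1))).
rewrite rnormB in h6.
apply: le_trans (rnorm_triangle _ (poly_op q (T e) x) _) _.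
have h7 := rnorm_triangle (poly_op q (T e) x) (poly_op q L x) (cfc g L x).
by lra.
Qed.

(** The forms decrease with [e] and are bounded below, so they converge; [psd_norm_le] for
    [T e' - T e] turns this into norm convergence at each vector. *)
Lemma strong_cvg_monotone T M : 0 < M ->
  (forall e, 0 < e < 1 -> between 0 M (T e)) ->
  (forall e e' x, 0 < e -> e < e' -> e' < 1 -> rdot (T e x) x <= rdot (T e' x) x) ->
  exists L, strong_cvg T L.
Proof.
move=> M0 hT mT.
suff /choice[L hL] : forall x, exists l, forall eta : R, 0 < eta ->
    exists2 d : R, 0 < d & forall e, 0 < e < d -> rnorm (T e x - l) <= eta.
  by exists L.
move=> x; pose phi e := rdot (T e x) x.
have diff e e' : 0 < e -> e < e' -> e' < 1 ->
    rnorm (T e' x - T e x) ^+ 2 <= M * (phi e' - phi e).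
  move=> e0 ee e1; have h := hT e; have h' := hT e'.
  have {}h := h (introT andP (conj e0 (lt_trans ee e1))).
  have {}h' := h' (introT andP (conj (lt_trans e0 ee) e1)).
  have hd : between 0 M (T e' - T e).
    split; first exact: bounded_opB (between_bop h') (between_bop h).
      exact: symopB (between_sym h') (between_sym h).
    move=> z; rewrite !opE rdotBl mul0r subr_ge0 mT //=.
    have := between_ge z h; have := between_le z h'; lra.
  by have := psd_norm_le hd M0 x; rewrite !opE rdotBl.
pose E := [set phi e | e in [set e | 0 < e < 1]].
have hE : has_inf E.
  split; first by exists (phi (1 / 2)), (1 / 2) => //=; apply/andP; split; lra.
  by exists 0 => _ [e /hT he <-]; have := between_ge x he; rewrite mul0r.
have close eta : 0 < eta -> exists2 d : R, 0 < d <= 1 & forall e e', 0 < e < d -> 0 < e' < d ->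
    rnorm (T e x - T e' x) <= eta.
  move=> eta0; have eM : 0 < eta ^+ 2 / M by rewrite divr_gt0 // exprn_gt0.
  have [_ [d /= /andP[d0 d1] <-] hd] := inf_adherent eM hE.
  exists d; first by rewrite d0 ltW.
  have main e e' : 0 < e -> e < e' -> e' < d -> rnorm (T e x - T e' x) <= eta.
    move=> e0 ee ed; rewrite rnormB -ler_sqr ?nnegrE // ?(ltW eta0) //.
    apply: le_trans (diff e e' e0 ee (lt_trans ed d1)) _.
    rewrite mulrC -ler_pdivlMr //.
    have h1 : inf E <= phi e.
      apply: ge_inf; first by case: hE.
      by exists e => //=; rewrite e0 (lt_trans ee) // (lt_trans ed).
    have h2 : phi e' <= phi d by apply: mT => //; apply: lt_trans ee.
    by lra.
  move=> e e' /andP[e0 ed] /andP[e0' ed'].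
  have [ee|ee|->] := ltgtP e e'; first exact: main.
    by rewrite rnormB main.
  by rewrite subrr rnorm0 ltW.
(* Completeness is used through sequences, hence the indices [1 / (n + 2)], all below 1. *)
pose u n := T (n.+2%:R^-1) x.
have ud d : 0 < d -> exists N, forall n, (N <= n)%N -> 0 < (n.+2%:R^-1 : R) < d.
  move=> d0; exists (Num.truncn d^-1) => n Nn; rewrite invr_gt0 ltr0Sn /=.
  rewrite -[ltRHS]invrK ltf_pV2 ?posrE ?invr_gt0 ?ltr0Sn //.
  have /andP[_ h] := truncn_itv (ltW (etrans (invr_gt0 d) d0)).
  by apply: lt_le_trans h _; rewrite ler_nat ltnS leqW.
have [l hl] : exists l, forall e : R, 0 < e -> exists N, forall n, (N <= n)%N ->
    rnorm (u n - l) <= e.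
  apply: rnorm_cauchy_cvg => e /close[d /andP[d0 _] hd]; have [N hN] := ud d d0.
  by exists N => m n /hN hm /hN hn; apply: hd.
exists l => eta eta0; have h2 : 0 < eta / 2 by rewrite divr_gt0.
have [d /andP[d0 _] hd] := close _ h2; exists d => // e ed.
have [N hN] := ud d d0; have [N' hN'] := hl _ h2.
apply: le_trans (rnorm_triangle _ (u (maxn N N')) _) _.
rewrite [leRHS](splitr eta) lerD ?hN' ?leq_maxr //.
by apply: hd => //; apply: hN; rewrite leq_maxl.
Qed.

End StrongLimits.

(** * Hilbert sums *)

Section HilbertSum.
Context {R : realType} (H : hilbertType R).

(** An alias from which only the module structure is copied: the library norm on a product is the
    max norm, while an inner product needs the Euclidean one. *)
Definition hsum := (H * H)%type.

HB.instance Definition _ := GRing.Lmodule.copy hsum (H * H)%type.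

Definition hsum_dot (u v : hsum) : R[i] := hdot H u.1 v.1 + hdot H u.2 v.2.
Definition hsum_norm (u : hsum) : R[i] :=
  (Num.sqrt (rnorm u.1 ^+ 2 + rnorm u.2 ^+ 2))%:C.

Lemma hsum_normD u v : hsum_norm (u + v) <= hsum_norm u + hsum_norm v.
Proof.
rewrite /hsum_norm -rmorphD lecR.
set p := Num.sqrt (rnorm u.1 ^+ 2 + _); set q := Num.sqrt (rnorm v.1 ^+ 2 + _).
have p0 : 0 <= p by exact: sqrtr_ge0.
have q0 : 0 <= q by exact: sqrtr_ge0.
rewrite -ler_sqr ?nnegrE ?sqrtr_ge0 ?addr_ge0 // sqrrD.
rewrite !sqr_sqrtr ?addr_ge0 ?sqr_ge0 //=.
have h1 : rnorm (u.1 + v.1) ^+ 2 <= (rnorm u.1 + rnorm v.1) ^+ 2.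
  by rewrite ler_sqr ?nnegrE ?addr_ge0 // rnormD.
have h2 : rnorm (u.2 + v.2) ^+ 2 <= (rnorm u.2 + rnorm v.2) ^+ 2.
  by rewrite ler_sqr ?nnegrE ?addr_ge0 // rnormD.
have h3 : rnorm u.1 * rnorm v.1 + rnorm u.2 * rnorm v.2 <= p * q.
  rewrite -ler_sqr ?nnegrE ?addr_ge0 ?mulr_ge0 // exprMn.
  rewrite !sqr_sqrtr ?addr_ge0 ?sqr_ge0 //.
  have := sqr_ge0 (rnorm u.1 * rnorm v.2 - rnorm u.2 * rnorm v.1); lra.
lra.
Qed.

Lemma hsum_normZ (s : R[i]) u : hsum_norm (s *: u) = `|s| * hsum_norm u.
Proof.
rewrite /hsum_norm /= !rnormZc !exprMn -mulrDr sqrtrM ?sqr_ge0 // sqrtr_sqr.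
have := normr_ge0 s; case: `|s| => a b; rewrite lecE /= => /andP[/eqP -> a0].
by rewrite ger0_norm // rmorphM.
Qed.

Lemma hsum_norm0 u : hsum_norm u = 0 -> u = 0.
Proof.
case: u => x y /(@complexI R)/eqP; rewrite sqrtr_eq0 /= => h.
have h1 := sqr_ge0 (rnorm x); have h2 := sqr_ge0 (rnorm y).
have x0 : rnorm x ^+ 2 == 0 by rewrite eq_le h1 andbT; lra.
have y0 : rnorm y ^+ 2 == 0 by rewrite eq_le h2 andbT; lra.
rewrite sqrf_eq0 in x0; rewrite sqrf_eq0 in y0.
by rewrite (rnorm_le0 (x := x)) ?(eqP x0) // (rnorm_le0 (x := y)) ?(eqP y0).
Qed.

HB.instance Definition _ := Lmodule_isNormed.Build R[i] hsum
  hsum_normD hsum_normZ hsum_norm0.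

Lemma hsum_norm_fst (u : hsum) : `|u.1| <= `|u|.
Proof.
rewrite [leRHS]/(hsum_norm u) normE lecR -ler_sqr ?nnegrE ?sqrtr_ge0 //.
by rewrite sqr_sqrtr ?addr_ge0 ?sqr_ge0 // lerDl sqr_ge0.
Qed.

Lemma hsum_norm_snd (u : hsum) : `|u.2| <= `|u|.
Proof.
rewrite [leRHS]/(hsum_norm u) normE lecR -ler_sqr ?nnegrE ?sqrtr_ge0 //.
by rewrite sqr_sqrtr ?addr_ge0 ?sqr_ge0 // lerDr sqr_ge0.
Qed.

Lemma hsum_norm_le (u : hsum) : `|u| <= `|u.1| + `|u.2|.
Proof.
rewrite [leLHS]/(hsum_norm u) !normE -rmorphD lecR.
rewrite -ler_sqr ?nnegrE ?sqrtr_ge0 ?addr_ge0 //.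
rewrite sqr_sqrtr ?addr_ge0 ?sqr_ge0 // sqrrD lerD2r lerDl.
by rewrite mulrn_wge0 // mulr_ge0.
Qed.

(** The projections do not increase norms, so a Cauchy filter projects to two Cauchy filters;
    [hsum_norm_le] reassembles their limits. *)
Lemma hsum_complete (F : set_system hsum) : ProperFilter F -> cauchy F -> cvg F.
Proof.
move=> PF /cauchy_ballP cF; have pick (p : hsum -> H) :
    (forall u v, p (u - v) = p u - p v) -> (forall u, `|p u| <= `|u|) ->
    exists l : H, p @ F --> l.
  move=> pB hp; suff cv : cvg (p @ F) by exists (lim (p @ F)).
  apply/cauchy_cvgP/cauchy_ballP => e e0.
  rewrite near_map2; have := cF e e0; apply: filterS => -[u v] /=.
  rewrite -!ball_normE /= -pB; exact: le_lt_trans.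
have [l1 h1] := pick fst (fun=> fun=> erefl) hsum_norm_fst.
have [l2 h2] := pick snd (fun=> fun=> erefl) hsum_norm_snd.
apply/cvg_ex; exists ((l1, l2) : hsum); apply/cvgrPdist_le => e e0.
have e2 : 0 < e / 2 by rewrite divr_gt0.
move/cvgrPdist_le : h1 => /(_ _ e2) h1; move/cvgrPdist_le : h2 => /(_ _ e2) h2.
apply: filterS2 h1 h2 => u h1 h2.
by apply: le_trans (hsum_norm_le _) _; rewrite [leRHS](splitr e) lerD.
Qed.

HB.instance Definition _ := Uniform_isComplete.Build hsum hsum_complete.

Lemma hsum_dotDl (v : hsum) : zmod_morphism (hsum_dot^~ v).
Proof. by move=> u w; rewrite /hsum_dot /= !linearBl opprD addrACA. Qed.

Lemma hsum_dotDr (u : hsum) : zmod_morphism (hsum_dot u).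
Proof. by move=> v w; rewrite /hsum_dot /= !linearBr opprD addrACA. Qed.

Lemma hsum_dotZl (v : hsum) : scalable_for *%R (hsum_dot^~ v).
Proof. by move=> s u; rewrite /hsum_dot /= !linearZl_LR mulrDr. Qed.

Lemma hsum_dotZr (u : hsum) : scalable_for (Num.conj \; *%R) (hsum_dot u).
Proof. by move=> s v; rewrite /hsum_dot /= !linearZr_LR /= mulrDr. Qed.

HB.instance Definition _ := isBilinear.Build R[i] hsum hsum R[i]
  *%R (Num.conj \; *%R) hsum_dot hsum_dotDl hsum_dotDr hsum_dotZl hsum_dotZr.

Lemma hsum_dot_hermitian (u v : hsum) :
  hsum_dot u v = (-1) ^+ false * Num.conj (hsum_dot v u).
Proof.
rewrite expr0 mul1r /hsum_dot rmorphD /=.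
rewrite (@hermitian_subproof _ _ false _ _ u.1 v.1).
rewrite (@hermitian_subproof _ _ false _ _ u.2 v.2).
by rewrite expr0 !mul1r.
Qed.

HB.instance Definition _ := @isHermitianSesquilinear.Build R[i] hsum false
  Num.conj hsum_dot hsum_dot_hermitian.

Lemma hsum_dot_norm (u : hsum) : hsum_dot u u = `|u| ^+ 2.
Proof.
rewrite [in RHS]/Num.norm /= /hsum_norm -rmorphXn /= sqr_sqrtr; last first.
  by rewrite addr_ge0 // sqr_ge0.
by rewrite rmorphD /= !rmorphXn /= -!normE /hsum_dot !hdot_norm.
Qed.

Lemma hsum_dot_gt0 (u : hsum) : u != 0 -> 0 < hsum_dot u u.
Proof. by move=> u0; rewrite hsum_dot_norm exprn_gt0 // normr_gt0. Qed.

HB.instance Definition _ := @isDotProduct.Build R[i] hsum hsum_dot hsum_dot_gt0.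

Definition hilbert_sum : hilbertType R :=
  @HilbertType R hsum hsum_dot hsum_dot_norm.

Lemma rdot_sum (u v : hilbert_sum) : rdot u v = rdot u.1 v.1 + rdot u.2 v.2.
Proof. by rewrite /rdot /= /hsum_dot ReD. Qed.

End HilbertSum.

(** * Jensen's operator inequality *)

(** The working form of operator monotonicity, restricted to operators with a common positive lower
    bound. Besides [f] it covers [t^p] and [f^p], for which it is derived from Loewner-Heinz. *)
Definition form_monotone {R : realType} (g : R -> R) : Prop :=
  (forall a b, 0 < a -> poly_approx a b g) /\
  forall (K : hilbertType R) (A B : K -> K) (a b : R), 0 < a ->
    between a b A -> between a b B -> (forall x, rdot (A x) x <= rdot (B x) x) ->
    forall x, rdot (cfc g A x) x <= rdot (cfc g B x) x.

Section Jensen.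
Context {R : realType}.

Lemma between_invertible (H : hilbertType R) (a b : R) (A : H -> H) : 0 < a -> between a b A ->
  invertible_op A.
Proof.
move=> a0 hA; apply: (coercive_invertible (between_bop hA) a0) => x.
exact: between_ge hA.
Qed.

Lemma between_positive (H : hilbertType R) (a b : R) (A : H -> H) : 0 <= a -> between a b A ->
  positive_op A.
Proof.
move=> a0 hA; apply/positive_opP; split.
- exact: between_bop hA.
- exact: between_sym hA.
- by move=> x; apply: le_trans (between_ge x hA); rewrite mulr_ge0 // rdot_ge0.
Qed.

Lemma poly_approx_pos (g : R -> R) : {in `]0, +oo[, continuous g} ->
  forall a b, 0 < a -> poly_approx a b g.
Proof.
(* The given segment may be degenerate or empty, so it is enlarged before Weierstrass applies. *)
move=> cg a b a0; have ab : a < `|a| + `|b| + 1.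
  by rewrite -addrA ltr_pwDr ?ler_norm // ltr_wpDl.
apply: (@poly_approx_sub _ a (`|a| + `|b| + 1)) => //.
  by have := normr_ge0 a; have := ler_norm b; lra.
apply: weierstrass => // x /andP[ax xb] e e0.
have /cg : x \in `]0, +oo[ by rewrite in_itv /= andbT (lt_le_trans a0).
move=> /cvgrPdist_le /(_ e e0) [d /= d0 hd].
exists d => // y _ yx; rewrite distrC; apply: hd; rewrite /ball /= distrC.
exact: yx.
Qed.

Lemma operator_monotone_form (g : R -> R) : operator_monotone g -> form_monotone g.
Proof.
move=> [cg mg]; have pg := poly_approx_pos cg; split => // K A B a b a0 hA hB AB x.
have lAB : op_le A B.
  apply/op_leP; split => //.
    exact: bounded_opB (between_bop hB) (between_bop hA).
  exact: symopB (between_sym hB) (between_sym hA).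
have := mg K A B (between_positive (ltW a0) hA) (between_invertible a0 hA)
  (between_positive (ltW a0) hB) (between_invertible a0 hB) lAB.
by move=> /op_leP[_ _]; apply.
Qed.

(* Jensen's operator inequality, for the isometry [V x = (X x, Y x)] with adjoint
   [W].  With [T = D1 (+) D2] and [E = W T V], the operator [T] lies below
   [T' = V (E + e) W + lam (1 - V W)] for [lam] large, and [T' V = V (E + e)],
   so that monotonicity gives [W g(T) V <= W g(T') V = g(E + e)]. *)
Lemma jensen (g : R -> R) (H : hilbertType R) (X Y X' Y' D1 D2 : H -> H) (m M : R) :
  form_monotone g ->
  bounded_op X -> bounded_op Y -> bounded_op X' -> bounded_op Y' ->
  (forall x y, rdot (X x) y = rdot x (X' y)) ->
  (forall x y, rdot (Y x) y = rdot x (Y' y)) ->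
  (forall x, X' (X x) + Y' (Y x) = x) ->
  0 < m -> m <= M -> between m M D1 -> between m M D2 ->
  forall x, rdot (cfc g D1 (X x)) (X x) + rdot (cfc g D2 (Y x)) (Y x) <=
    rdot (cfc g (fun x => X' (D1 (X x)) + Y' (D2 (Y x))) x) x.
Proof.
move=> [pg mg] bX bY bX' bY' aX aY XY m0 mM hD1 hD2.
have M0 : 0 < M by apply: lt_le_trans mM.
pose K := hilbert_sum H.
pose V x : K := (X x, Y x); pose W (k : K) : H := X' k.1 + Y' k.2.
pose T (k : K) : K := (D1 k.1, D2 k.2).
pose E x := X' (D1 (X x)) + Y' (D2 (Y x)).
have VE x k : rdot (V x) k = rdot x (W k).
  by rewrite rdot_sum /= aX aY -rdotDr.
have WV x : W (V x) = x by exact: XY.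
have VV x : rdot (V x) (V x) = rdot x x by rewrite VE WV.
have nV x : rnorm (V x) = rnorm x.
  by apply/eqP; rewrite -(@eqrXn2 _ 2%N) // -!rdotxx VV.
have VD x y : V (x + y) = V x + V y by rewrite /V (bopD bX) (bopD bY).
have VZ (s : R[i]) x : V (s *: x) = s *: V x by rewrite /V (bopZ bX) (bopZ bY).
have VB x y : V (x - y) = V x - V y by rewrite /V (bopB bX) (bopB bY).
have WD k l : W (k + l) = W k + W l.
  by rewrite /W /= (bopD bX') (bopD bY') addrACA.
have WZ (s : R[i]) k : W (s *: k) = s *: W k.
  by rewrite /W /= (bopZ bX') (bopZ bY') scalerDr.
have bT1 := between_bop hD1; have bT2 := between_bop hD2.
have TD k l : T (k + l) = T k + T l by rewrite /T /= (bopD bT1) (bopD bT2).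
have TZ (s : R[i]) k : T (s *: k) = s *: T k by rewrite /T /= (bopZ bT1) (bopZ bT2).
have sT : symop T.
  by move=> k l; rewrite !rdot_sum /= (between_sym hD1) (between_sym hD2).
have fT k : m * rdot k k <= rdot (T k) k <= M * rdot k k.
  rewrite !rdot_sum /= !mulrDr.
  by rewrite !lerD ?(between_ge _ hD1) ?(between_ge _ hD2) ?(between_le _ hD1) ?(between_le _ hD2).
have nD D : between m M D -> forall u, rnorm (D u) <= M * rnorm u.
  by move=> hD; apply: between_norm (ltW M0); apply: between_weak hD; lra.
have nT k : rnorm (T k) <= M * rnorm k.
  rewrite -ler_sqr ?nnegrE ?mulr_ge0 ?(ltW M0) // exprMn -!rdotxx !rdot_sum /= !rdotxx.
  by rewrite mulrDr -!exprMn lerD // ler_sqr ?nnegrE ?mulr_ge0 ?(ltW M0) // nD.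
have bT : bounded_op T.
  apply/bounded_opP; split; first by move=> s k l; rewrite TD TZ.
  by exists M => //; exact: ltW.
have hT : between m M T by [].
(* Bessel's inequality: [V W] is the orthogonal projection onto the range of [V]. *)
have WW k : 0 <= rdot k k - rdot (W k) (W k).
  have := rdot_ge0 (k - V (W k)).
  rewrite rdotBl !rdotBr (rdotC k) VV !VE; lra.
have nW k : rnorm (W k) <= rnorm k.
  by rewrite -ler_sqr ?nnegrE // -!rdotxx -subr_ge0.
have EE x : E x = W (T (V x)) by [].
have bE : bounded_op E.
  apply/bounded_opP; split; first by move=> s u v; rewrite !EE VD VZ TD TZ WD WZ.
  exists M => [|x]; first exact: ltW.
  by rewrite EE; apply: le_trans (nW _) _; apply: le_trans (nT _) _; rewrite nV.
have sE : symop E.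
  by move=> x y; rewrite !EE rdotC -VE rdotC sT VE.
have fE x : rdot (E x) x = rdot (T (V x)) (V x) by rewrite EE rdotC -VE rdotC.
have hE : between m M E by split=> // x; rewrite fE -VV fT.
have M1 : M <= M + 1 by rewrite lerDl.
have gE (e : R) : 0 < e < 1 -> between m (M + 1) (E + scalar_op e).
  move=> /andP[e0 e1]; apply: between_weak (betweenD hE (between_scalar e)).
    by rewrite lerDl ltW.
  by rewrite lerD2l ltW.
(* The calculus of a direct sum is computed blockwise, because the embeddings [i1] and [i2]
   intertwine each block with [T]. *)
have gTV x : rdot (cfc g T (V x)) (V x) =
    rdot (cfc g D1 (X x)) (X x) + rdot (cfc g D2 (Y x)) (Y x).
  pose i1 (u : H) : K := (u, 0); pose i2 (u : H) : K := (0, u).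
  have c1 : i1 (cfc g D1 (X x)) = cfc g T (i1 (X x)).
    apply: (@cfc_intertwine _ _ _ D1 T i1 m M 1) hD1 hT (pg _ _ m0) _ => //.
    - by move=> u v; rewrite /i1 -[0 in LHS]addr0.
    - by move=> t u; rewrite /i1 -[0 in LHS](scaler0 _ t%:C).
    - move=> u; rewrite mul1r -ler_sqr ?nnegrE // -!rdotxx rdot_sum /=.
      by rewrite rdot0l addr0.
    - by move=> u; rewrite /i1 /T /= (bop0 bT2).
  have c2 : i2 (cfc g D2 (Y x)) = cfc g T (i2 (Y x)).
    apply: (@cfc_intertwine _ _ _ D2 T i2 m M 1) hD2 hT (pg _ _ m0) _ => //.
    - by move=> u v; rewrite /i2 -[0 in LHS]addr0.
    - by move=> t u; rewrite /i2 -[0 in LHS](scaler0 _ t%:C).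
    - move=> u; rewrite mul1r -ler_sqr ?nnegrE // -!rdotxx rdot_sum /=.
      by rewrite rdot0l add0r.
    - by move=> u; rewrite /i2 /T /= (bop0 bT1).
  have -> : V x = i1 (X x) + i2 (Y x) by rewrite /V /i1 /i2; congr (_, _); rewrite ?addr0 ?add0r.
  rewrite (bopD (cfc_bounded hT (pg _ _ m0))) -c1 -c2 rdot_sum /=.
  by rewrite !addr0 !add0r.
have main (e : R) x : 0 < e < 1 ->
    rdot (cfc g T (V x)) (V x) <= rdot (cfc g (E + scalar_op e) x) x.
  move=> e01; have /andP[e0 e1] := e01.
  (* [M ^+ 2 / e] pays for the off-diagonal part of [T] through [2 M s w <= e s^2 + (M^2 / e) w^2],
     [M] pays for its compression to the complement, and [M + 1] bounds [Ee]. *)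
  pose lam := M + 1 + M ^+ 2 / e; pose Ee := E + scalar_op e.
  have hEe : between m (M + 1) Ee := gE e e01.
  have Me : 0 < M ^+ 2 / e by rewrite divr_gt0 // exprn_gt0.
  pose T' k := V (Ee (W k)) + lam%:C *: (k - V (W k)).
  have bEe : bounded_op Ee := between_bop hEe.
  have nT' : bounded_op T'.
    have /bounded_opP[_ [C C0 hC]] := bEe.
    have l0 : 0 <= lam by rewrite /lam; lra.
    apply/bounded_opP; split.
      move=> s k l; rewrite /T' WD WZ (bopD bEe) (bopZ bEe) !(VD (s *: _)) !VZ.
      rewrite opprD addrACA -scalerBr scalerDr [in RHS]scalerDr addrACA.
      by rewrite !scalerA (mulrC s).
    exists (C + lam * 2) => [|k]; first by rewrite addr_ge0 // mulr_ge0.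
    apply: le_trans (rnormD _ _) _; rewrite mulrDl lerD //.
      by rewrite nV; apply: le_trans (hC _) _; rewrite ler_wpM2l.
    rewrite rnormZ ger0_norm // -mulrA ler_wpM2l //.
    by apply: le_trans (rnormD _ _) _; rewrite rnormN nV mulrDl mul1r lerD2l nW.
  have fT' k : rdot (T' k) k =
      rdot (Ee (W k)) (W k) + lam * (rdot k k - rdot (W k) (W k)).
    by rewrite rdotDl rdotZl rdotBl !VE.
  have sT' : symop T'.
    move=> k l; rewrite rdotDl rdotDr rdotZl rdotZr rdotBl rdotBr.
    by rewrite !(rdotC k) !VE (between_sym hEe) (rdotC (W k) (W l)) [in LHS]rdotC (between_sym hEe).
  have hT' : between m lam T'.
    split=> // k; rewrite fT'.
    have h1 := between_ge (W k) hEe; have h2 := between_le (W k) hEe.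
    have h3 := WW k; have h4 := rdot_ge0 (W k).
    have l1 : m <= lam by rewrite /lam; lra.
    have l2 : M + 1 <= lam by rewrite /lam; lra.
    have h5 : m * (rdot k k - rdot (W k) (W k)) <= lam * (rdot k k - rdot (W k) (W k)).
      by rewrite ler_wpM2r.
    have h6 : (M + 1) * rdot (W k) (W k) <= lam * rdot (W k) (W k).
      by rewrite ler_wpM2r.
    by apply/andP; split; lra.
  have hT2 : between m lam T.
    by apply: between_weak hT => //; rewrite /lam; lra.
  have T'V y : V (Ee y) = T' (V y).
    by rewrite /T' WV subrr scaler0 addr0.
  have TT' k : rdot (T k) k <= rdot (T' k) k.
    (* Split [k] into its component [V s] in the range of [V] and the orthogonal remainder [w]; the
       shift by [e] in [Ee] absorbs the cross term. *)
    pose s := W k; pose w := k - V s.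
    have ke : k = V s + w by rewrite /w addrC subrK.
    have ww : rdot w w = rdot k k - rdot s s.
      by rewrite /w rdotBl !rdotBr (rdotC k) VV !VE -/s; ring.
    have eEe : rdot (Ee s) s = rdot (T (V s)) (V s) + e * rdot s s.
      by rewrite /Ee addfE rdotDl fE rdotZl.
    have gen u v : rdot (T (u + v)) (u + v) =
        rdot (T u) u + 2 * rdot (T u) v + rdot (T v) v.
      by rewrite TD rdotDl !rdotDr (rdotC (T v) u) -(sT u v); ring.
    have Tk : rdot (T k) k = rdot (T (V s)) (V s) + 2 * rdot (T (V s)) w + rdot (T w) w.
      by rewrite -gen -ke.
    rewrite fT' -ww -/s eEe Tk.
    have h1 := between_le w hT.
    have h2 : rdot (T (V s)) w <= M * rnorm s * rnorm w.
      apply: le_trans (rdot_le _ _) _; rewrite ler_wpM2r //.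
      by rewrite -(nV s).
    have h3 : 2 * (M * rnorm s * rnorm w) <= e * rdot s s + M ^+ 2 / e * rdot w w.
      rewrite !rdotxx -subr_ge0.
      rewrite (_ : _ - _ = e * (rnorm s - M / e * rnorm w) ^+ 2); last first.
        by field; rewrite gt_eqF.
      by rewrite mulr_ge0 ?sqr_ge0 // ltW.
    have h4 : rdot w w >= 0 by rewrite rdot_ge0.
    by rewrite -/s /lam; lra.
  have := mg K T T' m lam m0 hT2 hT' TT' (V x).
  have hEl : between m lam Ee by apply: between_weak hEe => //; rewrite /lam; lra.
  have Vn y : rnorm (V y) <= 1 * rnorm y by rewrite nV mul1r.
  rewrite -(cfc_intertwine VD (fun t => VZ t%:C) Vn ler01 T'V hEl hT' (pg _ _ m0)).
  by rewrite [X in _ <= X]VE WV.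
move=> x; rewrite -gTV.
have lim := strong_cvg_cfc (pg _ _ m0) (strong_cvg_shift E) gE.
pose F y := W (cfc g T (V y)).
have fF y : rdot (F y) y = rdot (cfc g T (V y)) (V y) by rewrite rdotC -VE rdotC.
rewrite -fF; apply: (strong_cvg_le (strong_cvg_cst F) lim) => e y he.
by rewrite fF main.
Qed.

End Jensen.

(** * Connections *)

Section Powers.
Context {R : realType}.
Implicit Types (a b p q t : R).

Lemma continuous_powR p : {in `]0, +oo[, continuous (fun t : R => t `^ p)}.
Proof.
move=> t t0; apply/differentiable_continuous/derivable1_diffP.
exact: derivable_powR.
Qed.

Lemma poly_approx_powR p a b : 0 < a -> poly_approx a b (fun t => t `^ p).
Proof. by move=> a0; apply: poly_approx_pos a0; exact: continuous_powR. Qed.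

Lemma poly_approx_powR0 p b : 0 <= p -> poly_approx 0 b (fun t => t `^ p).
Proof.
rewrite le_eqVlt => /predU1P[<-|p0].
  by apply: eq_poly_approx (poly_approx_cst _ _ 1) => t _; rewrite powRr0.
apply: (@poly_approx_sub _ 0 (`|b| + 1)) => //.
  by apply: le_trans (ler_norm b) _; rewrite lerDl.
apply: weierstrass => [|x /andP[x0 xb] e e0]; first by rewrite ltr_wpDl.
move: x0; rewrite le_eqVlt => /predU1P[<-|x0].
  (* At 0, the condition [y < e^(1/p)] gives [y^p <= e]. *)
  exists (e `^ p^-1) => [|y /andP[y0 _]]; first exact: powR_gt0.
  rewrite subr0 ger0_norm // => ye.
  rewrite powR0 ?gt_eqF // subr0 ger0_norm ?powR_ge0 //.
  have -> : e = (e `^ p^-1) `^ p by rewrite -powRrM mulVf ?gt_eqF // powRr1 // ltW.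
  by apply: ge0_ler_powR => //; rewrite ?nnegrE ?powR_ge0 // ltW.
have /continuous_powR : x \in `]0, +oo[ by rewrite in_itv /= andbT.
move=> /(_ p) /cvgrPdist_le /(_ e e0) [d /= d0 hd].
exists d => // y _ yx; rewrite distrC; apply: hd; rewrite /ball /= distrC.
exact: yx.
Qed.

Context {H : hilbertType R}.
Implicit Types (A B : H -> H) (x : H).

Lemma op_powD a b A p q x : 0 < a -> between a b A ->
  op_pow A p (op_pow A q x) = op_pow A (p + q) x.
Proof.
move=> a0 hA; rewrite /op_pow.
have pp := poly_approx_powR p b a0; have pq := poly_approx_powR q b a0.
rewrite -(cfcM _ hA pp pq); congr (_ x).
apply: (eq_cfc hA (poly_approxM pp pq)) => t /andP[ta _].
rewrite powRD //; apply/implyP => _.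
by rewrite gt_eqF // (lt_le_trans a0).
Qed.

Lemma op_pow0 a b A : between a b A -> op_pow A 0 = id.
Proof.
move=> hA; rewrite /op_pow (_ : (fun t => t `^ 0) = fun=> 1); last first.
  by apply/funext => t; rewrite powRr0.
by rewrite (cfc_cst _ hA); apply/funext => x; rewrite /scalar_op scale1r.
Qed.

Lemma op_pow1 b A : between 0 b A -> op_pow A 1 = A.
Proof.
move=> hA; rewrite /op_pow -[RHS](cfc_id hA); apply/esym.
by apply: (eq_cfc hA (poly_approx_id _ _)) => t /andP[t0 _]; rewrite powRr1.
Qed.

Lemma op_pow_bounded a b A p : 0 < a -> between a b A -> bounded_op (op_pow A p).
Proof. by move=> a0 hA; apply: cfc_bounded hA (poly_approx_powR p b a0). Qed.

Lemma op_pow_sym a b A p : 0 < a -> between a b A -> symop (op_pow A p).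
Proof. by move=> a0 hA; apply: cfc_sym hA (poly_approx_powR p b a0). Qed.

Lemma op_powVl a b A p x : 0 < a -> between a b A ->
  op_pow A p (op_pow A (- p) x) = x.
Proof. by move=> a0 hA; rewrite (op_powD _ _ _ a0 hA) subrr (op_pow0 hA). Qed.

Lemma op_powVr a b A p x : 0 < a -> between a b A ->
  op_pow A (- p) (op_pow A p x) = x.
Proof. by move=> a0 hA; rewrite (op_powD _ _ _ a0 hA) addNr (op_pow0 hA). Qed.

Lemma op_pow_half a b A x : 0 < a -> between a b A ->
  op_pow A (1 / 2) (op_pow A (1 / 2) x) = A x.
Proof.
move=> a0 hA; rewrite (op_powD _ _ _ a0 hA) -splitr (@op_pow1 b) //.
by apply: between_weak hA => //; exact: ltW.
Qed.

End Powers.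

Section Connections.
Context {R : realType} {H : hilbertType R}.
Implicit Types (A B C D : H -> H) (x y : H) (a b e : R) (g : R -> R).

Definition relative A B : H -> H := op_pow A (- (1 / 2)) \o B \o op_pow A (- (1 / 2)).

(** With [y = A^(-1/2) x], the form at [x] is that of [B] at [y], while [rdot x x] is that of [A] at
    [y]; their ratio lies between [a / b] and [b / a]. *)
Lemma relative_between a b A B : 0 < a -> a <= b -> between a b A -> between a b B ->
  between (a / b) (b / a) (relative A B).
Proof.
move=> a0 ab hA hB; have b0 := lt_le_trans a0 ab.
have bi := op_pow_bounded (- (1 / 2)) a0 hA; have si := op_pow_sym (- (1 / 2)) a0 hA.
split.
- exact: bounded_op_comp (bounded_op_comp bi (between_bop hB)) bi.
- by apply: symop_sandwich => //; exact: between_sym hB.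
move=> x; rewrite /relative /=; set y := op_pow A _ x.
rewrite si -/y; have h1 := between_ge y hB; have h2 := between_le y hB.
have e : rdot x x = rdot (A y) y.
  rewrite -(op_pow_half y a0 hA) (op_pow_sym _ a0 hA) /y.
  by rewrite (op_powVl _ x a0 hA).
have := between_ge y hA; have := between_le y hA; rewrite -e => h3 h4.
apply/andP; split.
  apply: le_trans h1; rewrite -mulrA ler_pM2l // mulrC ler_pdivrMr // mulrC.
  exact: h3.
apply: le_trans h2 _; rewrite -mulrA ler_pM2l // mulrC ler_pdivlMr // mulrC.
exact: h4.
Qed.

Lemma connection_invE g A B x : connection_inv g A B x =
  op_pow A (1 / 2) (cfc g (relative A B) (op_pow A (1 / 2) x)).
Proof. by []. Qed.

Lemma rdot_connection_inv g a b A B x : 0 < a -> between a b A ->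
  rdot (connection_inv g A B x) x =
  rdot (cfc g (relative A B) (op_pow A (1 / 2) x)) (op_pow A (1 / 2) x).
Proof. by move=> a0 hA; rewrite connection_invE (op_pow_sym _ a0 hA). Qed.

Lemma connection_inv_sym g a b A B : (forall a b, 0 < a -> poly_approx a b g) ->
  0 < a -> a <= b -> between a b A -> between a b B ->
  bounded_op (connection_inv g A B) /\ symop (connection_inv g A B).
Proof.
move=> pg a0 ab hA hB; have hr := relative_between a0 ab hA hB.
have ab0 : 0 < a / b by rewrite divr_gt0 // (lt_le_trans a0).
have bh := op_pow_bounded (1 / 2) a0 hA; have sh := op_pow_sym (1 / 2) a0 hA.
split; last exact: symop_sandwich (cfc_sym hr (pg _ _ ab0)).
exact: bounded_op_comp (bounded_op_comp bh (cfc_bounded hr (pg _ _ ab0))) bh.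
Qed.

(* With [S = A + C], [X = A^(1/2) S^(-1/2)] and [Y = C^(1/2) S^(-1/2)] satisfy
   [X* X + Y* Y = 1], so this is Jensen's inequality conjugated by [S^(1/2)]. *)
Lemma connection_inv_superadditive g a b A B C D : form_monotone g ->
  0 < a -> a <= b ->
  between a b A -> between a b B -> between a b C -> between a b D ->
  forall x, rdot (connection_inv g A B x) x + rdot (connection_inv g C D x) x <=
    rdot (connection_inv g (A + C) (B + D) x) x.
Proof.
move=> mg a0 ab hA hB hC hD x; pose S := A + C.
have hS : between (a + a) (b + b) S := betweenD hA hC.
have aa0 : 0 < a + a by rewrite addr_gt0.
rewrite (rdot_connection_inv _ _ _ a0 hA) (rdot_connection_inv _ _ _ a0 hC).
rewrite (rdot_connection_inv _ _ _ aa0 hS).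
pose h T := @op_pow _ H T (1 / 2); pose i T := @op_pow _ H T (- (1 / 2)).
rewrite -![op_pow _ (1 / 2) x]/(h _ x) -/S.
have Ah := op_pow_bounded (1 / 2) a0 hA; have sAh := op_pow_sym (1 / 2) a0 hA.
have Ch := op_pow_bounded (1 / 2) a0 hC; have sCh := op_pow_sym (1 / 2) a0 hC.
have Si := op_pow_bounded (- (1 / 2)) aa0 hS; have sSi := op_pow_sym (- (1 / 2)) aa0 hS.
have b0 := lt_le_trans a0 ab; have ab0 : 0 < a / b by rewrite divr_gt0.
have XY y : (i S \o h A) ((h A \o i S) y) + (i S \o h C) ((h C \o i S) y) = y.
  rewrite /= /h (op_pow_half _ a0 hA) (op_pow_half _ a0 hC) -(bopD Si).
  have -> : A (i S y) + C (i S y) = S (i S y) by [].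
  rewrite -(op_pow_half _ aa0 hS) /i (op_powVl _ _ aa0 hS).
  by rewrite (op_powVr _ _ aa0 hS).
have := @jensen _ g H (h A \o i S) (h C \o i S) (i S \o h A) (i S \o h C)
  (relative A B) (relative C D) (a / b) (b / a) mg
  (bounded_op_comp Ah Si) (bounded_op_comp Ch Si)
  (bounded_op_comp Si Ah) (bounded_op_comp Si Ch) _ _ XY ab0 _
  (relative_between a0 ab hA hB) (relative_between a0 ab hC hD) (h S x).
(* Since [A^(1/2)] cancels [A^(-1/2)], the two terms are [S^(-1/2) B S^(-1/2)] and
   [S^(-1/2) D S^(-1/2)], which add up to the relative operator of [S] and [B + D]. *)
have -> : (fun y => (i S \o h A) (relative A B ((h A \o i S) y)) +
    (i S \o h C) (relative C D ((h C \o i S) y))) = relative S (B + D).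
  apply/funext => y; rewrite /= /relative /= /h /i.
  rewrite (op_powVl _ _ a0 hA) (op_powVl _ _ a0 hC).
  rewrite (op_powVr _ _ a0 hA) (op_powVr _ _ a0 hC).
  by rewrite -(bopD Si).
have hSK : i S (h S x) = x by rewrite /i /h (op_powVr _ _ aa0 hS).
rewrite /= hSK; apply.
- by move=> u v; rewrite /= sAh sSi.
- by move=> u v; rewrite /= sCh sSi.
- by rewrite ler_pdivrMr // mulrAC ler_pdivlMr // ler_pM // ltW.
Qed.

Lemma connection_inv_ge0 g a b A B : (forall a b, 0 < a -> poly_approx a b g) ->
  (forall t, 0 < t -> 0 <= g t) -> 0 < a -> a <= b -> between a b A -> between a b B ->
  forall x, 0 <= rdot (connection_inv g A B x) x.
Proof.
move=> pg g0 a0 ab hA hB x; rewrite (rdot_connection_inv _ _ _ a0 hA).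
have hr := relative_between a0 ab hA hB.
have ab0 : 0 < a / b by rewrite divr_gt0 // (lt_le_trans a0).
have [M M0 hM] := poly_approx_bounded (pg (a / b) (b / a) ab0).
have hg : between 0 M (cfc g (relative A B)).
  apply: cfc_between hr (pg _ _ ab0) _ => t tab; have := hM t tab.
  have /g0 gt : 0 < t by case/andP: tab => + _; exact: lt_le_trans.
  by rewrite ger0_norm // gt => ->.
by have := between_ge (op_pow A (1 / 2) x) hg; rewrite mul0r.
Qed.

Lemma betweenD_scalar a b e A : between a b A -> between (a + e) (b + e) (A + scalar_op e).
Proof. by move=> hA; apply: betweenD hA (between_scalar e). Qed.

Section Limit.
Variable g : R -> R.
Hypothesis mg : form_monotone g.
Hypothesis g0 : forall t, 0 < t -> 0 <= g t.

Let ci A B e := connection_inv g (A + scalar_op e) (B + scalar_op e).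

(** Write [A + e' = (A + e) + d]: superadditivity splits off the connection of the scalar [d] with
    itself, which is positive. *)
Lemma connection_inv_mono M A B e e' x : between 0 M A -> between 0 M B ->
  0 < e -> e < e' -> rdot (ci A B e x) x <= rdot (ci A B e' x) x.
Proof.
move=> hA hB e0 ee; pose d := e' - e; have d0 : 0 < d by rewrite subr_gt0.
(* Superadditivity needs one pair of bounds for all four operators; this minimum is a lower bound
   for the shifted ones and for the scalar [d]. *)
have md : 0 < Num.min e d by rewrite lt_min e0 d0.
have sE (T : H -> H) : T + scalar_op e' = (T + scalar_op e) + scalar_op d :> (H -> H).
  by apply/funext => y; rewrite !opE -addrA /scalar_op -scalerDl -rmorphD /d [e + _]addrC subrK.
have wk (T : H -> H) : between 0 M T -> between (Num.min e d) (`|M| + e + d) (T + scalar_op e).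
  move=> hT; apply: between_weak (betweenD_scalar e hT); first by rewrite add0r ge_min lexx.
  by have := ler_norm M; lra.
have wd : between (Num.min e d) (`|M| + e + d) (scalar_op d : H -> H).
  apply: between_weak (between_scalar d); first by rewrite ge_min lexx orbT.
  by have := normr_ge0 M; lra.
have le : Num.min e d <= `|M| + e + d.
  by rewrite ge_min; apply/orP; left; have := normr_ge0 M; lra.
have := connection_inv_superadditive mg md le (wk _ hA) (wk _ hB) wd wd x.
rewrite -!sE; apply: le_trans; rewrite lerDl.
exact: (connection_inv_ge0 mg.1 g0 md le wd wd x).
Qed.

(** The strong limit really exists, by monotonicity in [e], so [connection] is not a default value
    of [lim]. The uniform bound is taken from the index 1. *)
Lemma connection_cvg M A B : 0 <= M -> between 0 M A -> between 0 M B ->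
  strong_cvg (ci A B) (connection g A B) /\
  exists2 N, 0 < N & forall e, 0 < e < 1 -> between 0 N (ci A B e).
Proof.
move=> M0 hA hB.
have sh e (T : H -> H) : between 0 M T -> between e (M + e) (T + scalar_op e).
  by move=> hT; have := betweenD_scalar e hT; rewrite add0r.
have le e : e <= M + e by rewrite lerDr.
have bs e : 0 < e -> bounded_op (ci A B e) /\ symop (ci A B e).
  by move=> e0; exact: connection_inv_sym mg.1 e0 (le e) (sh _ _ hA) (sh _ _ hB).
have [N0 N00 hN] := bounded_sym_between (bs 1 ltr01).1 (bs 1 ltr01).2.
pose N := N0 + 1; have hci e : 0 < e < 1 -> between 0 N (ci A B e).
  move=> /andP[e0 e1]; have [h1 h2] := bs e e0; split=> // x; rewrite mul0r.
  rewrite (connection_inv_ge0 mg.1 g0 e0 (le e) (sh _ _ hA) (sh _ _ hB)) /=.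
  apply: le_trans (connection_inv_mono x hA hB e0 e1) _.
  apply: le_trans (between_le x hN) _.
  by rewrite ler_wpM2r ?rdot_ge0 // lerDl.
have NN : 0 < N by rewrite ltr_wpDl.
split; last by exists N.
have mono e e' x : 0 < e -> e < e' -> e' < 1 ->
    rdot (ci A B e x) x <= rdot (ci A B e' x) x.
  by move=> e0 ee _; exact: (connection_inv_mono _ hA hB).
have [L hL] := strong_cvg_monotone NN hci mono.
have -> : connection g A B = L; last exact: hL.
by apply/funext => x; exact: strong_cvg_lim hL.
Qed.

Lemma connection_between M A B : 0 <= M -> between 0 M A -> between 0 M B ->
  exists2 N, 0 < N & between 0 N (connection g A B).
Proof.
move=> M0 hA hB; have [h [N N0 hN]] := connection_cvg M0 hA hB.
by exists N => //; exact: strong_cvg_between h hN.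
Qed.

Lemma connection_superadditive M A B C D : 0 <= M ->
  between 0 M A -> between 0 M B -> between 0 M C -> between 0 M D ->
  forall x, rdot (connection g A B x) x + rdot (connection g C D x) x <=
    rdot (connection g (A + C) (B + D) x) x.
Proof.
move=> M0 hA hB hC hD x.
have M2 : 0 <= M + M by rewrite addr_ge0.
have hAC : between 0 (M + M) (A + C) by rewrite -[0]addr0; exact: betweenD.
have hBD : between 0 (M + M) (B + D) by rewrite -[0]addr0; exact: betweenD.
have [h1 _] := connection_cvg M0 hA hB; have [h2 _] := connection_cvg M0 hC hD.
have [h3 _] := connection_cvg M2 hAC hBD.
rewrite -rdotDl -[_ + _]/((connection g A B + connection g C D) x).
(* Adding two operators shifted by [e] gives a shift by [2 e], so the right side is followed along
   [2 e]. *)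
have h4 := strong_cvg_rescale (ltr0Sn _ 1) h3.
apply: (strong_cvg_le (strong_cvgD h1 h2) h4) => e y /andP[e0 _].
rewrite !opE rdotDl /ci.
have sE (T S : H -> H) : (T + S) + scalar_op (2 * e) = (T + scalar_op e) + (S + scalar_op e) :> (H -> H).
  apply/funext => z; rewrite !opE addrACA; congr (_ + _).
  by rewrite /scalar_op -scalerDl -rmorphD mulr_natl mulr2n.
rewrite !sE.
have sh (T : H -> H) : between 0 M T -> between e (M + e) (T + scalar_op e).
  by move=> hT; have := betweenD_scalar e hT; rewrite add0r.
have le : e <= M + e by rewrite lerDr.
exact: connection_inv_superadditive mg e0 le (sh _ hA) (sh _ hB) (sh _ hC) (sh _ hD) y.
Qed.

Lemma positive_between A : positive_op A -> exists2 M : R, 0 <= M & between 0 M A.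
Proof.
move=> /positive_opP[bA sA pA]; have [M M0 hM] := bounded_sym_between bA sA.
by exists M => //; split=> // x; rewrite mul0r pA (between_le x hM).
Qed.

Lemma between0_positive M A : between 0 M A -> positive_op A.
Proof. exact: between_positive. Qed.

Lemma positive_op0 : positive_op (0 : H -> H).
Proof.
apply/positive_opP; split; [exact: bounded_op0|exact: symop0|move=> x].
by rewrite zerofE rdot0l.
Qed.

Lemma positive_opD A B : positive_op A -> positive_op B -> positive_op (A + B).
Proof.
move=> /positive_opP[bA sA pA] /positive_opP[bB sB pB]; apply/positive_opP.
split; [exact: bounded_opD|exact: symopD|move=> x].
by rewrite addfE rdotDl addr_ge0.
Qed.

Lemma positive_op_sum I (r : seq I) (P : pred I) (F : I -> H -> H) :
  (forall i, positive_op (F i)) -> positive_op (\sum_(i <- r | P i) F i).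
Proof.
by move=> hF; elim/big_ind: _ => //; [exact: positive_op0|exact: positive_opD].
Qed.

Lemma connection_positive A B : positive_op A -> positive_op B ->
  positive_op (connection g A B).
Proof.
move=> /positive_between[M M0 hM] /positive_between[N N0 hN].
have MN : 0 <= M + N by rewrite addr_ge0.
have hA : between 0 (M + N) A by apply: between_weak hM => //; rewrite lerDl.
have hB : between 0 (M + N) B by apply: between_weak hN => //; rewrite lerDr.
by have [K _] := connection_between MN hA hB; exact: between0_positive.
Qed.

Lemma connectionD_le A B C D : positive_op A -> positive_op B ->
  positive_op C -> positive_op D ->
  forall x, rdot (connection g A B x) x + rdot (connection g C D x) x <=
    rdot (connection g (A + C) (B + D) x) x.
Proof.
move=> /positive_between[M1 M10 h1] /positive_between[M2 M20 h2].
move=> /positive_between[M3 M30 h3] /positive_between[M4 M40 h4].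
apply: (@connection_superadditive (M1 + M2 + M3 + M4)); first by rewrite !addr_ge0.
- by apply: between_weak h1 => //; lra.
- by apply: between_weak h2 => //; lra.
- by apply: between_weak h3 => //; lra.
- by apply: between_weak h4 => //; lra.
Qed.

Lemma connection_sum_le I (r : seq I) (P : pred I) (A B : I -> H -> H) :
  (forall i, positive_op (A i)) -> (forall i, positive_op (B i)) ->
  forall x, rdot ((\sum_(i <- r | P i) connection g (A i) (B i)) x) x <=
    rdot (connection g (\sum_(i <- r | P i) A i) (\sum_(i <- r | P i) B i) x) x.
Proof.
move=> hA hB x; elim: r => [|i r IH].
  rewrite !big_nil zerofE rdot0l.
  by have /positive_opP[_ _] := connection_positive positive_op0 positive_op0; apply.
rewrite !big_cons; case: (P i) => //.
rewrite addfE rdotDl; apply: le_trans (connectionD_le (hA i) (hB i) _ _ x).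
- by rewrite lerD2l.
- exact: positive_op_sum.
- exact: positive_op_sum.
Qed.

(** The relative operator of [A + e] with itself is the identity, where [g] acts as the constant
    [g 1]. Needed for the connection of [id] with itself. *)
Lemma connection_id A : g 1 = 1 -> positive_op A -> connection g A A = A.
Proof.
move=> g1 /positive_between[M M0 hA].
have s1 z : scalar_op 1 z = z :> H by rewrite /scalar_op scale1r.
have hAe e : 0 < e -> between e (M + e) (A + scalar_op e).
  by move=> e0; have := betweenD_scalar e hA; rewrite add0r.
have eA e : 0 < e < 1 -> A + scalar_op e = ci A A e.
  move=> /andP[e0 e1]; have hB := hAe e e0; apply/funext => y.
  rewrite /ci connection_invE.
  have -> : relative (A + scalar_op e) (A + scalar_op e) = scalar_op 1.
    apply/funext => z; rewrite /relative /= -[in X in op_pow _ _ X](op_pow_half _ e0 hB).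
    by rewrite (op_powVl _ _ e0 hB) (op_powVr _ _ e0 hB) /scalar_op scale1r.
  have h1 : between 1 1 (scalar_op 1 : H -> H) by exact: between_scalar.
  have -> : cfc g (scalar_op 1 : H -> H) = cfc (fun=> 1) (scalar_op 1 : H -> H).
    apply: (eq_cfc h1 (mg.1 1 1 ltr01)) => t /andP[t1 t2].
    by rewrite (_ : t = 1) //; apply/eqP; rewrite eq_le t1 t2.
  by rewrite (cfc_cst 1 h1) s1 (op_pow_half _ e0 hB).
apply/funext => x; apply: (@strong_cvg_lim _ _ (ci A A)).
exact: eq_strong_cvg eA (strong_cvg_shift A).
Qed.

End Limit.
End Connections.

(** * The Loewner-Heinz inequality *)

Section LoewnerHeinz.
Context {R : realType}.
Implicit Types (a b p q t : R).

Lemma abs_expR_sub1_le (u : R) : `|u| <= 1 / 2 -> `|expR u - 1| <= 2 * `|u|.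
Proof.
move=> hu; have h1 := expR_ge1Dx u; have h2 := expR_ge1Dx (- u).
rewrite expRN in h2; have e0 := expR_gt0 u.
have := ler_norm u; have := ler_norm (- u); rewrite normrN => h3 h4.
have h5 : expR u * (1 - u) <= 1.
  by rewrite -[leRHS](divff (lt0r_neq0 e0)) ler_wpM2l // ltW.
rewrite ler_norml; apply/andP; split; first by lra.
have h6 : 0 < 1 - u by lra.
have h7 : expR u * (1 - u) <= (1 + 2 * `|u|) * (1 - u).
  apply: le_trans h5 _; have [u0|u0] := leP 0 u.
    by rewrite ger0_norm // in hu *; nra.
  by rewrite ltr0_norm // in hu *; nra.
by move: h7; rewrite ler_pM2r // => h7; lra.
Qed.

(** Write [t^p - t^q = t^q (exp ((p - q) ln t) - 1)]; on the segment the sum of the two logarithms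
    in absolute value bounds the one of [t]. This carries inequalities from dyadic to real
    exponents. *)
Lemma powR_exponent_dist a b p q t : 0 < a -> a <= t <= b -> 0 <= q <= 1 ->
  (`|ln a| + `|ln b|) * `|p - q| <= 1 / 2 ->
  `|t `^ p - t `^ q| <=
    expR (`|ln a| + `|ln b|) * (2 * ((`|ln a| + `|ln b|) * `|p - q|)).
Proof.
move=> a0 /andP[ta tb] /andP[q0 q1]; set L := _ + _ => hL.
have t0 := lt_le_trans a0 ta; have b0 := lt_le_trans t0 tb.
have lt1 : `|ln t| <= L.
  have h1 : ln a <= ln t by rewrite ler_ln ?posrE.
  have h2 : ln t <= ln b by rewrite ler_ln ?posrE.
  have := ler_norm (- ln a); have := ler_norm (ln b); rewrite normrN => h3 h4.
  have := normr_ge0 (ln a); have := normr_ge0 (ln b) => h5 h6.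
  by rewrite ler_norml /L; apply/andP; split; lra.
have -> : t `^ p - t `^ q = t `^ q * (expR ((p - q) * ln t) - 1).
  have -> : p = q + (p - q) by rewrite addrC subrK.
  rewrite powRD; last by apply/implyP => _; rewrite gt_eqF.
  rewrite (_ : q + (p - q) - q = p - q); last by ring.
  by rewrite mulrBr mulr1 {2}/powR gt_eqF.
rewrite normrM ler_pM //.
  rewrite ger0_norm ?powR_ge0 // /powR gt_eqF // ler_expR.
  apply: le_trans (ler_norm _) _; rewrite normrM ger0_norm //.
  by rewrite -[leRHS]mul1r ler_pM.
have h : `|(p - q) * ln t| <= L * `|p - q|.
  by rewrite normrM mulrC ler_wpM2r.
apply: le_trans (abs_expR_sub1_le (le_trans h hL)) _.
by rewrite ler_wpM2l.
Qed.

(** Stated one exponent at a time, so that closure of the set of good exponents under midpoints can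
    be expressed. *)
Definition loewner_heinz_at (H : hilbertType R) p :=
  forall (A B : H -> H) a b, 0 < a -> between a b A -> between a b B ->
    (forall x, rdot (A x) x <= rdot (B x) x) ->
    forall x, rdot (op_pow A p x) x <= rdot (op_pow B p x) x.

(** The square of [rnorm (D y)] is [rdot (C (D y)) y], at most [rnorm (D y) * rnorm y]. *)
Lemma contraction_adjoint (H : hilbertType R) (C D : H -> H) :
  (forall x y, rdot (C x) y = rdot x (D y)) ->
  (forall x, rnorm (C x) <= rnorm x) -> forall y, rnorm (D y) <= rnorm y.
Proof.
move=> CD hC y; have [d0|d0] := leP (rnorm (D y)) 0; first exact: le_trans d0 _.
rewrite -(ler_pM2l d0) -expr2 -rdotxx -CD.
by apply: le_trans (rdot_le _ _) _; rewrite ler_wpM2r.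
Qed.

(* Pedersen's argument: [S = B^(-s/2) A^s B^(-s/2)] with [s = (p + q) / 2] is similar
   to [Z = (B^(-p/2) A^(p/2)) (A^(q/2) B^(-q/2))], a product of two contractions,
   so the spectrum of [S] does not meet the half-line above [1]. *)
Lemma loewner_heinz_mid (H : hilbertType R) p q :
  loewner_heinz_at H p -> loewner_heinz_at H q -> loewner_heinz_at H ((p + q) / 2).
Proof.
move=> hp hq A B a b a0 hA hB AB x; set s := (p + q) / 2.
pose P r := op_pow A r; pose Q r := op_pow B r.
have bP r : bounded_op (P r) := op_pow_bounded r a0 hA.
have bQ r : bounded_op (Q r) := op_pow_bounded r a0 hB.
have sP r : symop (P r) := op_pow_sym r a0 hA.
have sQ r : symop (Q r) := op_pow_sym r a0 hB.
have PP r r' y : P r (P r' y) = P (r + r') y := op_powD r r' y a0 hA.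
have QQ r r' y : Q r (Q r' y) = Q (r + r') y := op_powD r r' y a0 hB.
have Q0 y : Q 0 y = y by rewrite /Q (op_pow0 hB).
(* With [z = B^(-r/2) y], the squared norm is the form of [A^r] at [z], below that of [B^r] at [z],
   which is [rdot y y]. *)
have contr r : loewner_heinz_at H r -> forall y,
    rnorm (P (r / 2) (Q (- (r / 2)) y)) <= rnorm y.
  move=> hr y; rewrite -ler_sqr ?nnegrE // -!rdotxx sP PP -splitr rdotC.
  apply: le_trans (hr A B a b a0 hA hB AB _) _.
  rewrite -/(Q r) [r in Q r](splitr r) -QQ sQ !QQ.
  by rewrite subrr !Q0 lexx.
have contr' r : loewner_heinz_at H r -> forall y,
    rnorm (Q (- (r / 2)) (P (r / 2) y)) <= rnorm y.
  move=> /contr hr; apply: contraction_adjoint hr => u v.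
  by rewrite sP sQ.
pose Z := (Q (- (p / 2)) \o P (p / 2)) \o (P (q / 2) \o Q (- (q / 2))).
have bZ : bounded_op Z :=
  bounded_op_comp (bounded_op_comp (bQ _) (bP _)) (bounded_op_comp (bP _) (bQ _)).
have nZ y : rnorm (Z y) <= rnorm y.
  exact: le_trans (contr' p hp _) (contr q hq _).
pose S := Q (- (s / 2)) \o P s \o Q (- (s / 2)).
have bS : bounded_op S := bounded_op_comp (bounded_op_comp (bQ _) (bP _)) (bQ _).
have sS : symop S by exact: symop_sandwich.
(* This is [S <= 1], written as a lower bound for [- S] to fit [ge_of_resolvent]. *)
have S1 : forall y, -1 * rdot y y <= rdot ((- S) y) y.
  apply: ge_of_resolvent; [exact: bounded_opN|exact: symopN|move=> t t1].
  (* Conjugation by [B^r] equalizes the outer exponents of [Z]: both [r - p / 2] and [- q / 2 - r]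
     equal [- s / 2]. *)
  pose r := (p - q) / 4.
  rewrite (_ : _ - _ = Q r \o (scalar_op (- t) - Z) \o Q (- r)); last first.
    apply/funext => y; rewrite /= !opE (bopB (bQ r)) {2}/scalar_op (bopZ (bQ r)).
    rewrite QQ subrr Q0 /scalar_op rmorphN scaleNr addrC; congr (_ - _).
    rewrite /S /Z /= !QQ PP.
    by congr (Q _ (P _ (Q _ y))); rewrite /s /r; field.
  have iQ r' : invertible_op (Q r').
    exists (Q (- r')) => //; split; apply/funext => y /=; rewrite QQ.
      by rewrite addNr Q0.
    by rewrite subrr Q0.
  apply: invertible_op_comp => //; apply: invertible_op_comp => //.
  apply: (@coercive_invertible _ _ _ (- t - 1)); last 1 first.
  - move=> y; rewrite !opE rdotBl rdotZl mulrBl mul1r lerD2l lerN2.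
    by apply: le_trans (rdot_le _ _) _; rewrite rdotxx expr2 ler_wpM2r.
  - by apply: bounded_opB => //; exact: bounded_op_scalar.
  - lra.
(* Evaluating [S <= 1] at [B^(s/2) x] undoes the conjugation and gives [A^s <= B^s] at [x]. *)
have := S1 (Q (s / 2) x); rewrite oppfE rdotNl mulN1r lerN2 /S /=.
by rewrite !sQ !QQ !addNr !Q0 -splitr.
Qed.

Lemma loewner_heinz0 (H : hilbertType R) : loewner_heinz_at H 0.
Proof. by move=> A B a b a0 hA hB AB x; rewrite (op_pow0 hA) (op_pow0 hB). Qed.

Lemma loewner_heinz1 (H : hilbertType R) : loewner_heinz_at H 1.
Proof.
move=> A B a b a0 hA hB AB x.
have wk (C : H -> H) : between a b C -> between 0 b C by apply: between_weak => //; exact: ltW.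
by rewrite (op_pow1 (wk A hA)) (op_pow1 (wk B hB)).
Qed.

(** At the next level the exponent is the midpoint of those obtained by rounding [k / 2] down and
    up, starting from the exponents 0 and 1. *)
Lemma loewner_heinz_dyadic (H : hilbertType R) n k : (k <= 2 ^ n)%N ->
  loewner_heinz_at H (k%:R / 2 ^+ n).
Proof.
elim: n k => [|n IH] k kn.
  rewrite expr0 divr1; case: k kn => [|[|k]] // _; first exact: loewner_heinz0.
  exact: loewner_heinz1.
have k2 : (k./2 <= 2 ^ n)%N.
  by rewrite -(doubleK (2 ^ n)%N) half_leq // -mul2n -expnS.
have k3 : (k - k./2 <= 2 ^ n)%N.
  rewrite leq_subLR; rewrite expnS mul2n -addnn in kn.
  have := odd_double_half k; rewrite -addnn => e.
  case: (odd k) e => /= e; last by lia.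
  by lia.
have := loewner_heinz_mid (IH _ k2) (IH _ k3).
rewrite -mulrDl -natrD subnKC ?half_le //; last first.
  by rewrite -divn2 leq_div.
by rewrite exprSr invfM mulrA.
Qed.

End LoewnerHeinz.

(** * Real exponents and connections represented by powers *)

Section PowerMonotonicity.
Context {R : realType}.
Implicit Types (a b p q t : R).

Lemma dyadic_approx p d : 0 <= p <= 1 -> 0 < d ->
  exists n k, (k <= 2 ^ n)%N /\ `|p - k%:R / 2 ^+ n| <= d.
Proof.
move=> /andP[p0 p1] d0.
have [|N hN] := @expr_le_epsilon R (1 / 2) 1 d _ ler01 d0.
  by apply/andP; split; lra.
have := hN N (leqnn N); rewrite mulr1 => hd.
have e0 : 0 < (2 ^+ N : R) by rewrite exprn_gt0.
have /andP[h1 h2] := truncn_itv (mulr_ge0 p0 (ltW e0)).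
exists N, (Num.truncn (p * 2 ^+ N)); split.
  rewrite -(ler_nat R) natrX; apply: le_trans h1 _.
  by rewrite -[leRHS]mul1r ler_wpM2r // ltW.
apply: le_trans hd; rewrite expr_div_n expr1n.
rewrite ger0_norm ?subr_ge0 ?ler_pdivrMr // lerBlDr -mulrDl ler_pdivlMr //.
by rewrite addrC natr1 ltW.
Qed.

Lemma op_pow_dist (H : hilbertType R) (A : H -> H) a b p q e x : 0 < a ->
  between a b A -> 0 <= q <= 1 -> 0 <= e -> e <= 1 ->
  (`|ln a| + `|ln b|) * `|p - q| <= e / 2 ->
  `|rdot (op_pow A p x) x - rdot (op_pow A q x) x| <=
    expR (`|ln a| + `|ln b|) * rdot x x * e.
Proof.
move=> a0 hA q01 e0 e1; set L := _ + _ => hL.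
rewrite -rdotBl; apply: le_trans (abs_rdot_le _ _) _.
have E0 : 0 <= expR L * e by rewrite mulr_ge0 // expR_ge0.
rewrite rdotxx expr2 mulrAC mulrA ler_wpM2r //.
apply: (cfc_dist hA (poly_approx_powR _ _ a0) (poly_approx_powR _ _ a0) E0).
move=> t tab; apply: le_trans (powR_exponent_dist a0 tab q01 _) _.
  by apply: le_trans hL _; lra.
by rewrite ler_wpM2l ?expR_ge0 // -/L; lra.
Qed.

(** Dyadic exponents are dense, and by [op_pow_dist] the forms of [A^p] and [B^p] depend
    continuously on [p]. *)
Theorem loewner_heinz (H : hilbertType R) p : 0 <= p <= 1 -> loewner_heinz_at H p.
Proof.
move=> p01 A B a b a0 hA hB AB x.
pose L := `|ln a| + `|ln b|; have L0 : 0 <= L by rewrite addr_ge0.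
have C0 : 0 <= 2 * (expR L * rdot x x).
  by rewrite !mulr_ge0 ?expR_ge0 ?rdot_ge0.
apply: (le_of_epsilon1 C0) => e e0 e1.
have d0 : 0 < e / 2 / (L + 1) by rewrite !divr_gt0 // ltr_wpDl.
have [n [k [kn hk]]] := dyadic_approx p01 d0; set q := k%:R / 2 ^+ n in hk.
have q01 : 0 <= q <= 1.
  have z0 : 0 < (2 ^+ n : R) by rewrite exprn_gt0.
  rewrite divr_ge0 ?(ltW z0) //= ler_pdivrMr // mul1r.
  by rewrite -natrX ler_nat.
have hL : L * `|p - q| <= e / 2.
  apply: (@le_trans _ _ ((L + 1) * (e / 2 / (L + 1)))).
    by rewrite ler_pM // lerDl.
  by rewrite mulrC divfK // gt_eqF // ltr_wpDl.
have h1 := op_pow_dist x a0 hA q01 (ltW e0) e1 hL.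
have h2 := op_pow_dist x a0 hB q01 (ltW e0) e1 hL.
have h3 := loewner_heinz_dyadic kn a0 hA hB AB x; rewrite -/q in h3.
move: h1 h2; rewrite !ler_norml -/L => /andP[h4 h5] /andP[h6 h7].
by lra.
Qed.

Lemma form_monotone_powR p : 0 <= p <= 1 -> form_monotone (fun t : R => t `^ p).
Proof.
move=> p01; split=> [a b|K A B a b a0 hA hB AB]; first exact: poly_approx_powR.
exact: loewner_heinz p01 A B a b a0 hA hB AB.
Qed.

(** Operators that need not be invertible are reached from their shifts by [e]: for [p >= 0] the
    power is approximable by polynomials up to 0, so it is strongly continuous there. *)
Lemma op_pow_monotone (H : hilbertType R) (A B : H -> H) p : 0 <= p <= 1 ->
  positive_op A -> positive_op B -> (forall x, rdot (A x) x <= rdot (B x) x) ->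
  forall x, rdot (op_pow A p x) x <= rdot (op_pow B p x) x.
Proof.
move=> p01 /positive_between[M M0 hM] /positive_between[N N0 hN] AB.
have hA : between 0 (M + N) A by apply: between_weak hM => //; rewrite lerDl.
have hB : between 0 (M + N) B by apply: between_weak hN => //; rewrite lerDr.
have he (C : H -> H) e : between 0 (M + N) C -> 0 < e < 1 ->
    between e (M + N + 1) (C + scalar_op e) /\ between 0 (M + N + 1) (C + scalar_op e).
  move=> hC /andP[e0 e1]; have := betweenD_scalar e hC; rewrite add0r => h.
  by split; apply: between_weak h => //; rewrite ?lerD2l ltW.
have /andP[p0 _] := p01.
have lim (C : H -> H) : between 0 (M + N) C ->
    strong_cvg (fun e => op_pow (C + scalar_op e) p) (op_pow C p).
  move=> hC; apply: (strong_cvg_cfc (poly_approx_powR0 (M + N + 1) p0) (strong_cvg_shift C)).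
  by move=> e /(he C e hC)[].
apply: (strong_cvg_le (lim A hA) (lim B hB)) => e x e01; have /andP[e0 _] := e01.
have [h1 _] := he A e hA e01; have [h2 _] := he B e hB e01.
apply: (loewner_heinz p01 e0 h1 h2) => y.
by rewrite !addfE !rdotDl lerD2r.
Qed.

(** Compactness bounds [1 / f] from above. The resulting [c > 0] keeps the values of [f] where [t^p]
    may be composed with it. *)
Lemma positive_lower_bound (f : R -> R) a b : {in `]0, +oo[, continuous f} ->
  (forall t, 0 < t -> 0 < f t) -> 0 < a ->
  exists2 c : R, 0 < c & forall t, a <= t <= b -> c <= f t.
Proof.
move=> cf f0 a0.
have [|K hK] := @segment_uniform_bound R a b (fun K t => (f t)^-1 <= K).
  move=> x /andP[ax _]; have x0 := lt_le_trans a0 ax.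
  have /cf : x \in `]0, +oo[ by rewrite in_itv /= andbT.
  have fx2 : 0 < f x / 2 by rewrite divr_gt0 ?f0.
  move=> /cvgrPdist_le /(_ _ fx2) [d /= d0 hd].
  exists d => //; exists (2 / f x) => K y hK /andP[ay _] yx.
  have y0 := lt_le_trans a0 ay; apply: le_trans hK.
  have /hd : ball x d y by rewrite /ball /= distrC.
  rewrite ler_norml => /andP[_ h].
  rewrite -[leRHS]invrK lef_pV2 ?posrE ?invr_gt0 ?divr_gt0 ?f0 // invf_div.
  by lra.
exists (`|K| + 1)^-1 => [|t tab]; first by rewrite invr_gt0 ltr_wpDl.
have t0 : 0 < t by case/andP: tab => + _; exact: lt_le_trans.
rewrite -[leRHS]invrK lef_pV2 ?posrE ?invr_gt0 ?f0 ?ltr_wpDl //.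
by apply: le_trans (hK t tab) _; have := ler_norm K; lra.
Qed.

Section Composition.
Variables (f : R -> R) (p : R).
Hypothesis mf : operator_monotone f.
Hypothesis f0 : forall t, 0 < t -> 0 < f t.
Hypothesis p01 : 0 <= p <= 1.

Let pf a b : 0 < a -> poly_approx a b f.
Proof. exact: (operator_monotone_form mf).1. Qed.

Lemma range_bound a b : 0 < a -> exists c d, [/\ 0 < c, c <= d &
  forall t, a <= t <= b -> c <= f t <= d].
Proof.
move=> a0; have [c c0 hc] := positive_lower_bound b mf.1 f0 a0.
have [M M0 hM] := poly_approx_bounded (pf b a0).
exists c, (M + c); split; rewrite ?lerDr // => t tab.
by rewrite hc //= (le_trans (ler_norm _)) // (le_trans (hM t tab)) // lerDl ltW.
Qed.

Lemma poly_approx_powR_comp a b : 0 < a -> poly_approx a b (fun t => f t `^ p).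
Proof.
move=> a0; have [c [d [c0 _ hcd]]] := range_bound b a0.
exact: poly_approx_comp (pf b a0) hcd (poly_approx_powR p d c0).
Qed.

Lemma op_pow_cfc (H : hilbertType R) (A : H -> H) a b : 0 < a -> between a b A ->
  op_pow (cfc f A) p = cfc (fun t => f t `^ p) A.
Proof.
move=> a0 hA; have [c [d [c0 _ hcd]]] := range_bound b a0.
exact: cfc_comp hA (pf b a0) hcd (poly_approx_powR p d c0).
Qed.

(** The power is applied after [f] by [op_pow_cfc]. This is what makes the connection represented by
    [f^p] converge. *)
Lemma form_monotone_powR_comp : form_monotone (fun t => f t `^ p).
Proof.
split=> [a b|K A B a b a0 hA hB AB x]; first exact: poly_approx_powR_comp.
have [c [d [c0 _ hcd]]] := range_bound b a0.
rewrite -(op_pow_cfc a0 hA) -(op_pow_cfc a0 hB).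
apply: (loewner_heinz p01 c0 (cfc_between hA (pf b a0) hcd) (cfc_between hB (pf b a0) hcd)).
exact: (operator_monotone_form mf).2 a0 hA hB AB.
Qed.

Lemma op_pow_half0 (H : hilbertType R) (Q : H -> H) b x : between 0 b Q ->
  op_pow Q (1 / 2) (op_pow Q (1 / 2) x) = Q x.
Proof.
move=> hQ; have ph : poly_approx 0 b (fun t => t `^ (1 / 2)).
  by apply: poly_approx_powR0; rewrite divr_ge0.
rewrite /op_pow -(cfcM _ hQ ph ph) -[in RHS](cfc_id hQ); congr (_ x).
apply: (eq_cfc hQ (poly_approxM ph ph)) => t /andP[t0 _].
rewrite -powRD -?splitr ?powRr1 //.
by apply/implyP => /eqP h; have := oner_neq0 R; rewrite h eqxx.
Qed.

Section Hansen.
Context {H : hilbertType R}.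
Variables (A B : H -> H) (e : R).
Hypothesis hA : between 0 1 A.
Hypothesis hB : between 0 1 B.
Hypothesis e01 : 0 < e < 1.

Let e0 : 0 < e. Proof. by case/andP: e01. Qed.
Let Ae := A + scalar_op e.
Let Be := B + scalar_op e.
Let hAe : between e (1 + e) Ae.
Proof. by have := betweenD_scalar e hA; rewrite add0r. Qed.
Let hBe : between e (1 + e) Be.
Proof. by have := betweenD_scalar e hB; rewrite add0r. Qed.
Let c := (1 + e)^-1.
Let c0 : 0 < c. Proof. by rewrite invr_gt0; have := e0; lra. Qed.
Let cE : c * (1 + e) = 1. Proof. by rewrite mulVf // gt_eqF //; have := e0; lra. Qed.

(** Although [A <= 1], the shift [A + e] may exceed 1; dividing by [1 + e] restores the bound, and
    [Q] is the positive remainder whose square root completes the isometry. *)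
Definition hansen_defect : H -> H := id - c%:C *: Ae.
Local Notation Q := hansen_defect.

Lemma hansen_defect_between : between 0 1 Q.
Proof.
have bA := between_bop hAe; have sA := between_sym hAe.
split; [|apply: symopB => //; exact: symopZ|move=> x].
  by apply: bounded_opB; [exact: bounded_op_id|exact: bounded_opZ].
rewrite /Q addfE oppfE scalefE rdotDl rdotNl rdotZl mul0r mul1r.
have h1 := between_ge x hAe; have h2 := between_le x hAe.
have x0 := rdot_ge0 x.
have h3 : c * rdot (Ae x) x <= c * ((1 + e) * rdot x x) by rewrite ler_pM2l.
have h4 : 0 <= c * rdot (Ae x) x.
  by rewrite mulr_ge0 // ?(ltW c0) // (le_trans _ h1) // mulr_ge0 // ltW.
by move: h3; rewrite mulrA cE mul1r => h3; apply/andP; split; lra.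
Qed.

(* Jensen's inequality for [X = (A_e / (1 + e))^(1/2)] and [Y = (1 - X^2)^(1/2)]. *)
Lemma hansen x :
  c * rdot (connection_inv (fun t => f t `^ p) Ae Be x) x <=
  rdot (op_pow (c%:C *: connection_inv f Ae Be + e%:C *: Q) p x) x.
Proof.
have le : e <= 1 + e by rewrite lerDr.
have hr := relative_between e0 le hAe hBe.
have r0 : 0 < e / (1 + e) by rewrite divr_gt0 //; have := e0; lra.
have [c1 [d1 [c10 cd1 hcd]]] := range_bound ((1 + e) / e) r0.
pose D := cfc f (relative Ae Be).
have hD : between c1 d1 D := cfc_between hr (pf _ r0) hcd.
pose s := Num.sqrt c; have ss : s * s = c by rewrite -expr2 sqr_sqrtr // ltW.
pose X := s%:C *: op_pow Ae (1 / 2); pose Y := op_pow Q (1 / 2).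
have hQ := hansen_defect_between.
have ph : poly_approx 0 1 (fun t : R => t `^ (1 / 2)).
  by apply: poly_approx_powR0; rewrite divr_ge0.
have bh := op_pow_bounded (1 / 2) e0 hAe; have sh := op_pow_sym (1 / 2) e0 hAe.
have bX : bounded_op X by exact: bounded_opZ.
have sX : symop X by exact: symopZ.
have bY : bounded_op Y by exact: cfc_bounded hQ ph.
have sY : symop Y by exact: cfc_sym hQ ph.
have XX y : X (X y) = c%:C *: Ae y.
  rewrite /X !scalefE (bopZ bh) scalerA -rmorphM ss.
  by rewrite (op_pow_half _ e0 hAe).
have YY y : Y (Y y) = Q y by exact: op_pow_half0 hQ.
have XY y : X (X y) + Y (Y y) = y by rewrite XX YY /Q /= addrC subrK.
pose m := Num.min c1 e; pose M := d1 + 1.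
have m0 : 0 < m by rewrite lt_min c10 e0.
have mM : m <= M by rewrite ge_min; apply/orP; left; rewrite /M; lra.
have hD1 : between m M D.
  by apply: between_weak hD; rewrite ?ge_min ?lexx // /M lerDl.
(* The second block is a constant because its operator is free; it is positive, as Jensen requires,
   and it disappears as [e] tends to 0. *)
have hD2 : between m M (scalar_op e : H -> H).
  apply: between_weak (between_scalar e); first by rewrite ge_min lexx orbT.
  by have /andP[_ e1] := e01; rewrite /M; lra.
have := jensen (form_monotone_powR p01) bX bY bX bY sX sY XY m0 mM hD1 hD2 x.
have -> : (fun y => X (D (X y)) + Y (scalar_op e (Y y))) =
    c%:C *: connection_inv f Ae Be + e%:C *: Q.
  apply/funext => y; rewrite addfE !scalefE; congr (_ + _).
    rewrite /X !scalefE (bopZ (between_bop hD)) (bopZ bh) scalerA -rmorphM ss.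
    by rewrite connection_invE.
  by rewrite /scalar_op (bopZ bY) YY.
apply: le_trans.
have -> : cfc (fun t => t `^ p) D = cfc (fun t => f t `^ p) (relative Ae Be).
  exact: op_pow_cfc r0 hr.
rewrite (rdot_connection_inv _ _ _ e0 hAe).
set G := cfc (fun t => f t `^ p) _.
have bG : bounded_op G := cfc_bounded hr (poly_approx_powR_comp _ r0).
(* The first block yields [c] times the connection of [f^p]; the second contributes
   [e^p rdot (Y x) (Y x) >= 0] and is dropped. *)
rewrite {1 2}/X scalefE (bopZ bG) rdotZl rdotZr mulrA ss lerDl.
rewrite (eq_cfc (between_scalar e) (poly_approx_powR p e e0) (h := fun=> e `^ p)); last first.
  by move=> t /andP[t1 t2]; rewrite (_ : t = e) //; apply/eqP; rewrite eq_le t1 t2.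
rewrite (cfc_cst _ (between_scalar e)) rdotZl.
by rewrite mulr_ge0 ?powR_ge0 ?rdot_ge0.
Qed.

End Hansen.

(** Limit of [hansen]: the factor [1 / (1 + e)] tends to 1 and [e] times the defect to 0, while the
    operators under the power stay in a common segment starting at 0. *)
Lemma connection_powR_le (H : hilbertType R) (A B : H -> H) :
  between 0 1 A -> between 0 1 B ->
  forall x, rdot (connection (fun t => f t `^ p) A B x) x <=
    rdot (op_pow (connection f A B) p x) x.
Proof.
move=> hA hB; have f0' t : 0 < t -> 0 <= f t by move=> /f0/ltW.
have fp0 t : 0 < t -> 0 <= f t `^ p by move=> _; exact: powR_ge0.
have [l1 _] := connection_cvg form_monotone_powR_comp fp0 ler01 hA hB.
have [l2 [N N0 hN]] := connection_cvg (operator_monotone_form mf) f0' ler01 hA hB.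
pose c e : R := (1 + e)^-1.
have hc e : 0 < e < 1 -> `|c e - 1| <= e.
  move=> /andP[e0 e1]; have e2 : 0 < 1 + e by lra.
  have -> : c e - 1 = - (e / (1 + e)) by rewrite /c; field; rewrite gt_eqF.
  rewrite normrN ger0_norm ?divr_ge0 ?(ltW e0) ?(ltW e2) //.
  rewrite ler_pdivrMr //; nra.
have c01 e : 0 < e < 1 -> 0 <= c e <= 1.
  move=> /andP[e0 e1]; have e2 : 0 < 1 + e by lra.
  by rewrite invr_ge0 (ltW e2) invf_le1 // lerDl ltW.
have small : strong_cvg (fun e => e%:C *: hansen_defect A e) 0.
  apply: (@strong_cvg_unif _ _ _ _ 1) => // e x e01; have /andP[e0 _] := e01.
  rewrite scalefE zerofE subr0 rnormZ gtr0_norm // mul1r ler_wpM2l ?(ltW e0) //.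
  apply: le_trans (between_norm_le (hansen_defect_between hA e01) x) _.
  by rewrite normr0 normr1 add0r mul1r.
have lR := strong_cvgD (strong_cvg_scale l2 hc) small.
rewrite addr0 in lR.
have /andP[p0 _] := p01.
have hT e : 0 < e < 1 -> between 0 (N + 1)
    ((c e)%:C *: connection_inv f (A + scalar_op e) (B + scalar_op e) +
     e%:C *: hansen_defect A e).
  move=> e01; have /andP[ce0 ce1] := c01 e e01; have /andP[e0 e1] := e01.
  have sc r K (T : H -> H) : 0 <= r -> r <= 1 -> between 0 K T -> between 0 K (r%:C *: T).
    move=> r0 r1 hT; split; [exact: bounded_opZ (between_bop hT)|exact: symopZ (between_sym hT)|].
    move=> x; have := between_ge x hT; have := between_le x hT.
    rewrite mul0r scalefE rdotZl => h1 h2; rewrite mulr_ge0 //=.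
    by apply: le_trans h1; rewrite ler_piMl.
  rewrite -[0]addr0; apply: betweenD; apply: sc => //; try exact: ltW.
    exact: hN.
  exact: hansen_defect_between.
have lim := strong_cvg_cfc (poly_approx_powR0 (N + 1) p0) lR hT.
apply: (strong_cvg_le (strong_cvg_scale l1 hc) lim) => e x e01.
by rewrite scalefE rdotZl; exact: hansen.
Qed.

End Composition.
End PowerMonotonicity.

(** * From forms back to the operator order, and conclusion *)

Section OperatorOrder.
Context {R : realType} {H : hilbertType R}.
Implicit Types (A B X Y : H -> H) (x : H).

Lemma op_le_of_forms X Y : bounded_op X /\ symop X -> bounded_op Y /\ symop Y ->
  (forall x, rdot (X x) x <= rdot (Y x) x) -> op_le X Y.
Proof.
move=> [bX sX] [bY sY] XY; apply/op_leP.
by split=> //; [exact: bounded_opB|exact: symopB].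
Qed.

Lemma positive_bounded_sym A : positive_op A -> bounded_op A /\ symop A.
Proof. by move=> /positive_opP[]. Qed.

Lemma op_pow_bounded_sym A (p : R) : 0 <= p -> positive_op A ->
  bounded_op (op_pow A p) /\ symop (op_pow A p).
Proof.
move=> p0 /positive_between[M _ hA]; have pp := poly_approx_powR0 M p0.
by split; [exact: cfc_bounded hA pp|exact: cfc_sym hA pp].
Qed.

Lemma id_sub_between A : positive_op A -> op_le A id -> between 0 1 (id - A).
Proof.
move=> /positive_opP[_ _ pA] /positive_opP[b s h]; split=> // x.
rewrite mul0r mul1r h /= addfE oppfE rdotDl rdotNl.
by rewrite gerDl oppr_le0 pA.
Qed.

End OperatorOrder.

Theorem theorem3p3 (R : realType) (H : hilbertType R) (n : nat)
    (A B : 'I_n -> H -> H) (f : R -> R) (p : R)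
    (hA : forall j, positive_op (A j)) (hB : forall j, positive_op (B j))
    (hsA : op_le (\sum_(j < n) A j) id) (hsB : op_le (\sum_(j < n) B j) id)
    (hf : mean_representing f) (hp : 0 <= p <= 1)
    (k : nat) (hk1 : (1 <= k)%N) (hkn : (k <= n - 1)%N) :
  op_le
    (connection (fun t => f t `^ p)
       (id - \sum_(j < n) A j) (id - \sum_(j < n) B j))
    (op_pow
       (connection f
          (id - \sum_(j < n | (j < k)%N) A j)
          (id - \sum_(j < n | (j < k)%N) B j)
        - \sum_(j < n | (k <= j)%N) connection f (A j) (B j)) p)
  /\
  op_le
    (op_pow
       (connection f
          (id - \sum_(j < n | (j < k)%N) A j)
          (id - \sum_(j < n | (j < k)%N) B j)
        - \sum_(j < n | (k <= j)%N) connection f (A j) (B j)) p)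
    (op_pow (id - \sum_(j < n) connection f (A j) (B j)) p).
Proof.
have [f0 mf f1] := hf; have mg := operator_monotone_form mf.
have g0 t : 0 < t -> 0 <= f t by move=> /f0/ltW.
have /andP[p0 _] := hp.
have split (C : 'I_n -> H -> H) :
    \sum_(j < n) C j = \sum_(j < n | (j < k)%N) C j + \sum_(j < n | (k <= j)%N) C j.
  rewrite (bigID (fun j : 'I_n => (j < k)%N)) /=; congr (_ + _).
  by apply: eq_bigl => j; rewrite -leqNgt.
have pos_tail (C : 'I_n -> H -> H) : (forall j, positive_op (C j)) ->
    positive_op (\sum_(j < n | (k <= j)%N) C j) by exact: positive_op_sum.
have pos_head (C : 'I_n -> H -> H) : (forall j, positive_op (C j)) ->
    positive_op (\sum_(j < n | (j < k)%N) C j) by exact: positive_op_sum.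
have headE (C : 'I_n -> H -> H) : id - \sum_(j < n | (j < k)%N) C j =
    (id - \sum_(j < n) C j) + \sum_(j < n | (k <= j)%N) C j.
  by rewrite split opprD addrA subrK.
have hC j : positive_op (connection f (A j) (B j)) by exact: connection_positive.
set T := connection f (id - \sum_(j < n) A j) (id - \sum_(j < n) B j).
have pT : positive_op T by exact: connection_positive.
have pA : positive_op (id - \sum_(j < n | (j < k)%N) A j).
  by rewrite headE; apply: positive_opD => //; exact: pos_tail.
have pB : positive_op (id - \sum_(j < n | (j < k)%N) B j).
  by rewrite headE; apply: positive_opD => //; exact: pos_tail.
set K := connection f (id - \sum_(j < n | (j < k)%N) A j) _.
have pK : positive_op K by exact: connection_positive.
set tail := \sum_(j < n | (k <= j)%N) connection f (A j) (B j).
have ptail : positive_op tail by exact: pos_tail.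
pose head := \sum_(j < n | (j < k)%N) connection f (A j) (B j).
have TK x : rdot (T x) x + rdot (tail x) x <= rdot (K x) x.
  rewrite /K !headE; apply: le_trans (connectionD_le mg g0 hsA hsB (pos_tail _ hA) (pos_tail _ hB) x).
  by rewrite lerD2l; exact: connection_sum_le.
have Kid x : rdot (K x) x + rdot (head x) x <= rdot x x.
  have pid : positive_op (id : H -> H).
    by apply: (@between0_positive _ _ 1); split=> [||x'] //; [exact: bounded_op_id|rewrite mul0r mul1r rdot_ge0 lexx].
  have := connectionD_le mg g0 pA pB (pos_head _ hA) (pos_head _ hB) x.
  rewrite !subrK (connection_id mg f1 pid); apply: le_trans.
  by rewrite lerD2l; exact: connection_sum_le.
have [bK sK] := positive_bounded_sym pK; have [bt st] := positive_bounded_sym ptail.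
have TG x : rdot (T x) x <= rdot ((K - tail) x) x.
  by have := TK x; rewrite addfE oppfE rdotDl rdotNl lerBrDr.
(* Positivity of this difference is not visible from its terms; it follows from
   [0 <= T <= K - tail], and gives access to the calculus of powers. *)
have pG : positive_op (K - tail).
  apply/positive_opP; split; [exact: bounded_opB|exact: symopB|move=> x].
  by apply: le_trans (TG x); have /positive_opP[_ _] := pT; apply.
have GF x : rdot ((K - tail) x) x <= rdot ((id - \sum_(j < n) connection f (A j) (B j)) x) x.
  rewrite split -/head -/tail !addfE !oppfE !rdotDl !rdotNl addfE rdotDl.
  by have := Kid x; lra.
have pF : positive_op (id - \sum_(j < n) connection f (A j) (B j)).
  have [bs ss] := positive_bounded_sym (positive_op_sum (index_enum 'I_n) xpredT hC).
  apply/positive_opP; split.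
  - by apply: bounded_opB => //; exact: bounded_op_id.
  - exact: symopB.
  - by move=> x; apply: le_trans (GF x); have /positive_opP[_ _] := pG; apply.
have bsG := op_pow_bounded_sym p0 pG; have bsF := op_pow_bounded_sym p0 pF.
split; last by apply: op_le_of_forms => //; exact: op_pow_monotone.
apply: op_le_of_forms => // [|x].
  apply: positive_bounded_sym; apply: connection_positive => //.
    exact: form_monotone_powR_comp.
  by move=> t _; exact: powR_ge0.
have uA := id_sub_between (positive_op_sum (index_enum 'I_n) xpredT hA) hsA.
have uB := id_sub_between (positive_op_sum (index_enum 'I_n) xpredT hB) hsB.
apply: le_trans (connection_powR_le mf f0 hp uA uB x) _.
exact: op_pow_monotone hp pT pG TG x.
Qed.
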